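(* Let $N_0\ge1$ and let the parametric generic Hopf singularity system $$\begin{pmatrix}\dot x\\ \dot y\end{pmatrix}=\begin{pmatrix}y\\-x\end{pmatrix}+\sum_{i+j+|\mathbf{n}|\ge2,\ i+j\ge1}\begin{pmatrix}\alpha_{ij\mathbf{n}}\\ \beta_{ij\mathbf{n}}\end{pmatrix}x^iy^j\mu^{\mathbf{n}},\qquad \mu\in\mathbb{R}^{N_0},$$ (a formal system with real coefficients) have parametric dimension $N_0$. Then there exist a permutation $\sigma\in S_{N_0}$ and a sequence of near-identity changes of state variables, time rescalings and reparametrization maps (near-identity as well as an invertible linear reparametrization) such that the system can be transformed to an infinite level parametric normal form, given in polar coordinates by $$\frac{d\rho}{dt}=\rho\Big[A\rho^{2N_0}+\sum_{i=1}^{N_0}\rho^{2i-2}\mu_{\sigma(i)}\Big],\qquad \frac{d\theta}{dt}=1+\rho^{2N_0}\sum_{\mathbf{n}\in\mathbb{N}_0^{N_0}}B_{\mathbf{n}}\mu^{\mathbf{n}},$$ where the coefficients $A$ and $B_{\mathbf{n}}$ are uniquely determined in terms of the $\alpha_{ij\mathbf{n}}$ and $\beta_{ij\mathbf{n}}$.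
   Context: The field is $\mathbb{F}=\mathbb{R}$; here the number of parameters is $m=N_0$ and the weight is $\alpha=2N_0+1$. For $\mathbf{n}\in\mathbb{N}_0^m$, $\mu^{\mathbf{n}}=\prod\mu_i^{n_i}$, $|\mathbf{n}|=\sum n_i$. Complex form. With $z=y+ix$ and $w=\overline z$ the system becomes a formal vector field on the reality subspace $w=\overline z$ of $\mathbb{C}^2$ (coordinates $(z,w)$) of the form $v=Y_{10}+\sum a_{jk\mathbf{n}}X_{jk}\mu^{\mathbf{n}}+\sum b_{jk\mathbf{n}}Y_{jk}\mu^{\mathbf{n}}$ with real coefficients, sums over $j+k\ge1$, $j+k+|\mathbf{n}|\ge2$, where $X_{jk}=(z^jw^k,w^jz^k)^T$, $Y_{jk}=(iz^jw^k,-iw^jz^k)^T$. Polar coordinates are given by $z=\rho e^{i\theta}$. $\mathscr{L}$ is the space of all formal series $aY_{10}+\sum a_{jk\mathbf{n}}X_{jk}\mu^{\mathbf{n}}+\sum b_{jk\mathbf{n}}Y_{jk}\mu^{\mathbf{n}}$ (same index range), a Lie algebra under $[u,v]=u'v-v'u$, graded by $\delta(X_{jk}\mu^{\mathbf{n}})=\delta(Y_{jk}\mu^{\mathbf{n}})=j+k-1+\alpha|\mathbf{n}|$, with grade-$k$ part $\mathscr{L}_k$. Time space: $\mathscr{R}=\mathbb{F}[[Z_1,\mu]]$, $Z_k=z^kw^k$, graded by $\delta(Z_k\mu^{\mathbf{n}})=2k+\alpha|\mathbf{n}|$, acting on $\mathscr{L}$ by multiplication ($Z_i\mu^{\mathbf{a}}X_{jk}\mu^{\mathbf{b}}=X_{(i+j)(i+k)}\mu^{\mathbf{a}+\mathbf{b}}$,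 likewise for $Y$). Parameter space: $\mathscr{P}^m=\mathbb{F}[[\mu]]^m$, graded by $\delta(\mu^{\mathbf{n}}\mathbf{e}_k)=\alpha|\mathbf{n}|-\alpha$. For a graded space $V$, $F^kV$ is the set of formal sums of terms of grade $\ge k$. Infinite direct sums mean formal sums. Transformations: near-identity change of state variables $\phi^S_{Y^S*}=\exp(\mathrm{ad}_{Y^S})$, $Y^S\in F^1\mathscr{L}$; near-identity time rescaling $\phi^T_{Y^T*}(v)=v+Y^Tv$, $Y^T\in F^1\mathscr{R}$; near-identity reparametrization $\phi^P_{Y^P*}$: substitution $\mu=\nu+Y^P(\nu)$, $Y^P\in F^1\mathscr{P}^m$; invertible linear reparametrization: $\mu=M\nu$, $M\in GL_m(\mathbb{R})$. Let $A^0=F^1\mathscr{P}^m\times F^1\mathscr{R}\times F^1\mathscr{L}$ with the product filtration $F^nA^0$. Extended partial normal forms. For $Y=(Y^P,Y^T,Y^S)\in A^0$ let $d(v,Y)=D_\mu(v)Y^P+Y^Tv+[Y^S,v]$. Put $\tilde v^{(0)}=v$. For $r\ge1$, let $\mathscr{T}_n^{(r)}\subseteq\mathscr{L}_n$ be the projection to $\mathscr{L}_n$ of $F^n\mathscr{L}\cap d(\tilde v^{(r-1)},F^{\max(n-r+1,1)}A^0)$, let $\mathscr{N}_n^{(r)}$ be its unique complement in $\mathscr{L}_n$, and let the $r$th level extended partial parametric normal form $\tilde v^{(r)}$ be the image of $v$ under a composition $\phi^P_{Y^P*}\circ\phi^T_{Y^T*}\circ\phi^S_{Y^S*}$ with $\tilde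 v^{(r)}\in\bigoplus_n\mathscr{N}_n^{(r)}$. (For $v=Y_{10}+\cdots$, $\mathscr{N}_n^{(1)}=\mathrm{span}\{X_{(k+1)k}\mu^{\mathbf{n}}: n=2k+\alpha|\mathbf{n}|\}$ for $n\ge1$.) The unique complement is defined by the formal basis style: the monomials of $\mathscr{L}$ are put in a fixed sequence $e_1,e_2,\dots$ in which lower grades come first and, within a grade, $Y$ terms precede $X$ terms and parameter-free terms precede terms with parameters; the unique complement of $W\subseteq\mathscr{L}_n$ is the span of $e_{n_1},e_{n_2},\dots$, where inductively $n_k$ is the least index (among basis elements of $\mathscr{L}_n$) with $e_{n_k}\notin W\oplus\mathrm{span}\{e_{n_i}:i<k\}$. Parametric dimension. The system has parametric dimension $N_0$ if for every natural number $r$ the coefficient of the parameter-free term $X_{(i+1)i}$ in $\tilde v^{(r)}$ is zero for all $i<N_0$ and the coefficient of $X_{(N_0+1)N_0}$ is nonzero. Parametric generic. The system is parametric generic if the $N_0\times m$ matrix $A^{(1)}$, whose $(k,j)$ entry ($0\le k\le N_0-1$, $1\le j\le m$) is the coefficient of $X_{(k+1)k}\mu_j$ in $\tilde v^{(1)}$, has rank $N_0$. *)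

(* Defs.v *)
From HB Require Import structures.
From mathcomp Require Import all_boot all_order all_algebra all_fingroup.
From mathcomp Require Import all_classical all_reals.
From mathcomp Require Export complex.

Set Implicit Arguments.
Unset Strict Implicit.
Unset Printing Implicit Defensive.

Import Order.TTheory GRing.Theory Num.Theory.

Local Open Scope classical_set_scope.
Local Open Scope ring_scope.

(* Exponents of z^j w^k mu^n; the first two slots are the state variables,
   which are (z, w) in complex form and (x, y) for the real system. *)
Definition exponent (N : nat) := {ffun 'I_(2 + N) -> nat}.

Notation series R N := (exponent N -> R[i]).

Section Series.
Context {R : realType} {N : nat}.
Implicit Types (d : exponent N) (f g : series R N).

Definition iz : 'I_(2 + N) := lshift N ord0.
Definition iw : 'I_(2 + N) := lshift N ord_max.
Definition imu (i : 'I_N) : 'I_(2 + N) := rshift 2 i.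

Definition coords {T : Type} (a b : T) (c : 'I_N -> T) (s : 'I_(2 + N)) : T :=
  match fintype.split s with
  | inl t => if t == ord0 then a else b
  | inr i => c i
  end.

Definition expo (j k : nat) (n : {ffun 'I_N -> nat}) : exponent N :=
  [ffun s => coords j k n s].

Definition expo1 (s : 'I_(2 + N)) : exponent N := [ffun t => (t == s) : nat].

Definition param d : {ffun 'I_N -> nat} := [ffun i => d (imu i)].

Definition unit_index (i : 'I_N) : {ffun 'I_N -> nat} :=
  [ffun i' => (i' == i) : nat].

Definition sdeg d : nat := (d iz + d iw)%N.
Definition pdeg d : nat := (\sum_(i < N) d (imu i))%N.
Definition tdeg d : nat := (sdeg d + pdeg d)%N.

Definition smonomial d : series R N := fun d' => ((d' == d)%:R : R[i]).
Definition svar (s : 'I_(2 + N)) : series R N := smonomial (expo1 s).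
Definition sone : series R N := smonomial [ffun=> 0%N].

(* The Cauchy product; the ring multiplication that the libraries put on
   functions is the pointwise one and is not used. *)
Definition smul f g : series R N := fun d =>
  \sum_(a : {ffun 'I_(2 + N) -> 'I_(tdeg d).+1} | [forall s, a s <= d s]%N)
    f [ffun s => a s : nat] * g [ffun s => (d s - a s)%N].

Definition sexp f (k : nat) : series R N := iter k (smul f) sone.

Definition sderiv (s : 'I_(2 + N)) f : series R N := fun d =>
  (d s).+1%:R * f [ffun t => (d t + (t == s))%N].

(* Substitution of series without constant term: the product of the
   [phi s]^(n s) starts in degree |n|, so exponents beyond the degree of [d]
   contribute nothing to the coefficient at [d]. *)
Definition ssubst (phi : 'I_(2 + N) -> series R N) f : series R N := fun d =>
  \sum_(n : {ffun 'I_(2 + N) -> 'I_(tdeg d).+1})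
    f [ffun s => n s : nat] *
    (\big[smul/sone]_(s < 2 + N) sexp (phi s) (n s)) d.

Definition perturbation (a : exponent N -> R) : series R N := fun d =>
  if (1 <= sdeg d)%N && (2 <= tdeg d)%N then (a d)%:C%C else 0.

Definition xdot (alpha : exponent N -> R) : series R N :=
  svar iw + perturbation alpha.
Definition ydot (beta : exponent N -> R) : series R N :=
  - svar iz + perturbation beta.

(* A vector field on the reality subspace w = conj z is represented by its
   first component, the second one being [conj_swap] of the first.  Thus
   a X_jk mu^n + b Y_jk mu^n is the series with coefficient a + i b at
   z^j w^k mu^n. *)
Definition conj_swap f : series R N := fun d =>
  conjc (f (expo (d iw) (d iz) (param d))).

(* z = y + i x gives z' = y' + i x', with x = (z - w) / (2 i) and
   y = (z + w) / 2. *)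
Definition hopf_system (alpha beta : exponent N -> R) : series R N :=
  ssubst (coords ((2%:R * ('i)%C)^-1 *: (svar iz - svar iw))
                 (2%:R^-1 *: (svar iz + svar iw))
                 (fun i => svar (imu i)))
         (ydot beta + ('i)%C *: xdot alpha).

(* A basis monomial of the space of vector fields: [(false, d)] is the X term
   and [(true, d)] the Y term with exponent [d].  The index range is
   j + k >= 1, j + k + |n| >= 2, together with Y_10. *)
Definition vmonomial := (bool * exponent N)%type.

Definition vmonomial_series (b : vmonomial) : series R N :=
  (if b.1 then ('i)%C else 1) *: smonomial b.2.

Definition Y10 : vmonomial := (true, expo1 iz).

Definition valid (b : vmonomial) : bool :=
  ((1 <= sdeg b.2)%N && (2 <= tdeg b.2)%N) || (b == Y10).

Definition vcoef f (b : vmonomial) : R :=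
  if b.1 then complex.Im (f b.2) else complex.Re (f b.2).

(* Formal (possibly infinite) real combinations of the monomials in [S]. *)
Definition fspan (S : set vmonomial) : set (series R N) :=
  [set u | forall b, vcoef u b != 0 -> S b].

Definition weight : nat := N.*2.+1.

Definition grade d : nat := ((sdeg d).-1 + weight * pdeg d)%N.

Definition filtL (n : nat) : set (series R N) :=
  fspan [set b | valid b /\ (n <= grade b.2)%N].

Definition gradedL (n : nat) : set (series R N) :=
  fspan [set b | valid b /\ grade b.2 = n].

Definition proj (n : nat) f : series R N := fun d =>
  if grade d == n then f d else 0.

Definition filtR (n : nat) : set (series R N) :=
  [set T | forall d, T d != 0 ->
     [/\ d iz = d iw, complex.Im (T d) = 0 &
         (n <= sdeg d + weight * pdeg d)%N]].

Definition filtP (n : nat) : set ('I_N -> series R N) :=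
  [set Y | forall i d, Y i d != 0 ->
     [/\ sdeg d = 0%N, complex.Im (Y i d) = 0 &
         (n + weight <= weight * pdeg d)%N]].

(* First component of [u, v] = u' v - v' u. *)
Definition bracket (u v : series R N) : series R N :=
  (smul (sderiv iz u) v + smul (sderiv iw u) (conj_swap v))
  - (smul (sderiv iz v) u + smul (sderiv iw v) (conj_swap u)).

(* For Y of grade at least 1, the k-th power of ad_Y raises grades by at least
   k, so the exponential series is finite in each coefficient. *)
Definition phiS (Y v : series R N) : series R N := fun d =>
  \sum_(k < (grade d).+1) (k`!%:R)^-1 * iter k (bracket Y) v d.

Definition phiT (Y v : series R N) : series R N := v + smul Y v.

Definition reparametrize (phi : 'I_N -> series R N) (v : series R N) :=
  ssubst (coords (svar iz) (svar iw) phi) v.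

Definition phiP (Y : 'I_N -> series R N) (v : series R N) : series R N :=
  reparametrize (fun i => svar (imu i) + Y i) v.

Definition phiLin (M : 'M[R]_N) (v : series R N) : series R N :=
  reparametrize (fun i => \sum_(j < N) (M i j)%:C%C *: svar (imu j)) v.

Inductive transformation :=
  | StateChange of series R N
  | TimeRescaling of series R N
  | Reparametrization of ('I_N -> series R N)
  | LinearReparametrization of 'M[R]_N.

Definition transform (t : transformation) (v : series R N) : series R N :=
  match t with
  | StateChange Y => phiS Y v
  | TimeRescaling Y => phiT Y v
  | Reparametrization Y => phiP Y v
  | LinearReparametrization M => phiLin M v
  end.

Definition near_identity (n : nat) (t : transformation) : Prop :=
  match t with
  | StateChange Y => filtL n Y
  | TimeRescaling Y => filtR n Y
  | Reparametrization Y => filtP n Y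
  | LinearReparametrization _ => False
  end.

Definition admissible (t : transformation) : Prop :=
  match t with
  | LinearReparametrization M => M \in unitmx
  | _ => near_identity 1 t
  end.

(* [w] is the result of applying to [v] a sequence of transformations which
   converges in the filtration topology; finite sequences are included, as
   they can be continued by [StateChange 0]. *)
Definition transforms_to (v w : series R N) : Prop :=
  exists (t : nat -> transformation) (u : nat -> series R N),
    [/\ u 0%N = v,
        forall k, admissible (t k) /\ u k.+1 = transform (t k) (u k) &
        forall n, exists K, forall k, (K <= k)%N ->
          near_identity n (t k) /\ filtL n (u k - w)].

(* The elements (Y^P, Y^T, Y^S) of F^n A^0, meaningful for n >= 1. *)
Definition filtA (n : nat) (Y : ('I_N -> series R N) * series R N * series R N)
  : Prop := [/\ filtP n Y.1.1, filtR n Y.1.2 & filtL n Y.2].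

Definition dmap (v : series R N)
    (Y : ('I_N -> series R N) * series R N * series R N) : series R N :=
  \sum_(i < N) smul (sderiv (imu i) v) (Y.1.1 i) + smul Y.1.2 v
  + bracket Y.2 v.

Definition removable (v : series R N) (r n : nat) : set (series R N) :=
  [set u | exists Y, [/\ filtA (maxn (n + 1 - r) 1) Y, filtL n (dmap v Y) &
                         u = proj n (dmap v Y)]].

(* The enumerations e_0, e_1, ... of the monomials allowed by the formal
   basis style. *)
Definition formal_basis_order (e : nat -> vmonomial) : Prop :=
  [/\ injective e, forall b, valid b <-> exists i, e i = b &
    forall i j,
      [\/ (grade (e i).2 < grade (e j).2)%N,
          [/\ grade (e i).2 = grade (e j).2, (e i).1 & ~~ (e j).1] |
          [/\ grade (e i).2 = grade (e j).2, (e i).1 = (e j).1,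
              pdeg (e i).2 = 0%N & (0 < pdeg (e j).2)%N]] -> (i < j)%N].

(* The indices below [i] chosen by the greedy construction of the unique
   complement of [W] in the grade-[n] part. *)
Fixpoint selected (e : nat -> vmonomial) (W : set (series R N)) (n i : nat)
  : set nat :=
  if i is k.+1 then
    selected e W n k `|`
    [set l | [/\ l = k, grade (e k).2 = n &
       ~ exists u s, [/\ W u, fspan (e @` selected e W n k) s &
                         vmonomial_series (e k) = u + s]]]
  else set0.

Definition unique_complement (e : nat -> vmonomial) (W : set (series R N))
    (n : nat) : set (series R N) :=
  fspan (e @` \bigcup_i selected e W n i).

Definition extended_partial_normal_form (e : nat -> vmonomial)
    (v0 v : series R N) (r : nat) (w : series R N) : Prop :=
  [/\ exists Y, filtA 1 Y /\ w = phiP Y.1.1 (phiT Y.1.2 (phiS Y.2 v)),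
      filtL 0 w &
      forall n, unique_complement e (removable v0 r n) n (proj n w)].

Definition extended_partial_levels (e : nat -> vmonomial) (v : series R N)
    (vt : nat -> series R N) : Prop :=
  vt 0%N = v /\
  forall r, extended_partial_normal_form e (vt r) v r.+1 (vt r.+1).

Definition has_parametric_dimension (vt : nat -> series R N) (N0 : nat)
  : Prop :=
  forall r, (1 <= r)%N ->
    (forall i, (i < N0)%N ->
       vcoef (vt r) (false, expo i.+1 i [ffun=> 0%N]) = 0) /\
    vcoef (vt r) (false, expo N0.+1 N0 [ffun=> 0%N]) != 0.

Definition parametric_matrix (v : series R N) (N0 : nat) : 'M[R]_(N0, N) :=
  \matrix_(k < N0, j < N) vcoef v (false, expo k.+1 k (unit_index j)).

Definition parametric_generic (vt : nat -> series R N) (N0 : nat) : Prop :=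
  \rank (parametric_matrix (vt 1%N) N0) = N0.

(* At infinite level all of A^0 is available: the non-linear part of [w] lies
   in a complement, spanned by monomials, of the whole space of directions
   [dmap w Y], so that nothing more can be removed. *)
Definition infinite_level_normal_form (w : series R N) : Prop :=
  exists S : set vmonomial,
    [/\ S `<=` [set b | valid b /\ (1 <= grade b.2)%N],
        fspan S (w - vmonomial_series Y10),
        forall u, filtL 1 u ->
          exists Y s, [/\ filtA 1 Y, fspan S s & u = dmap w Y + s] &
        forall Y, filtA 1 Y -> fspan S (dmap w Y) -> dmap w Y = 0].

(* The system given in polar coordinates z = rho e^(i theta) by
   rho' = rho * sum F k n rho^(2k) mu^n, theta' = sum G k n rho^(2k) mu^n:
   here z' / z = rho' / rho + i theta' and rho^2 = z w. *)
Definition polar_system (F G : nat -> {ffun 'I_N -> nat} -> R) : series R N :=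
  fun d => if d iz == (d iw).+1
           then (F (d iw) (param d) +i* G (d iw) (param d))%C else 0.

Definition hopf_normal_form (sigma : {perm 'I_N}) (A : R)
    (B : {ffun 'I_N -> nat} -> R) : series R N :=
  polar_system
    (fun k n => (if (k == N) && (n == [ffun=> 0%N]) then A else 0)
       + \sum_(i < N) ((k == i) && (n == unit_index (sigma i)))%:R)
    (fun k n => ((k == 0%N) && (n == [ffun=> 0%N]))%:R
       + (if k == N then B n else 0)).

End Series.

Arguments exponent N : clear implicits.
Arguments vmonomial N : clear implicits.

(* Main.v *)
Require Import Defs.
From HB Require Import structures.
From mathcomp Require Import all_boot all_order all_algebra all_fingroup.
From mathcomp Require Import all_classical all_reals.
From mathcomp Require Import zify ring lra.

(** Write Z = z w, and call a series real resonant if it is a real series in Z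
    and the parameters mu. A real vector field is handled through its derivation
    D v; then exp (ad Y) is conjugation by the substitution exp (- D Y), a time
    rescaling multiplies the derivation by a real unit, and a reparametrization
    is a substitution. Series of fields and of functions are filtered by a degree
    in which z and w have weight 1 and the parameters 2 N + 1, so that A Z^N is
    the leading part of the radial speed Q = A Z^N + sum_i Z^i mu_i.

    Existence. All monomials but z Z^k mu^n are removable at the first level, so
    the system becomes z' = z (i + g) with g real resonant (first_level_shape).
    A state change z a with a real resonant acts on g by the exponential of
    Lam a g = g E a - a E g, where E is the Euler field. Such changes remove the
    parameter-free terms of g below Z^(2 N) other than A Z^N (flatten_system),
    and a linear reparametrization by the inverse of the parametric matrix, which
    is where genericity enters, makes g equal to Q up to order 4 N (linear_step);
    the permutation sigma is then the identity. After that the field is kept in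
    the form (1 + Z^N b) z (i + g), and the equation (1 + Z^N b) g = Q, which
    says that it is the normal form, is solved grade by grade (state_step,
    nf_approx_limit). At each grade this is the homological equation

      Lam a (A Z^N) + sum_i Z^i p_i + A Z^(2 N) c = given.

    On the coefficients Z^k with k >= N, Lam a (A Z^N) is onto except for
    k = 2 N, the reparametrization p takes care of k < N, and the coefficients of
    Z^(2 N) mu^n force a change c of b. This is why the angular speed retains the
    terms Z^N mu^n (homological_grade).

    Infinite level. The same operator is the leading part of the infinitesimal
    action on the normal form. Its explicit right inverse shows that every field
    of positive grade is removable up to the monomials of the normal form
    (nf_surjective), and the same equation read backwards shows that no
    combination of those monomials is removable unless it is zero (nf_direct).

    Uniqueness. Two normal forms u and v of one system are related, up to any
    order, by a substitution Phi and a real unit T with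
    Phi (D u f) = T D v (Phi f) (transforms_to_orb). Flows of real multiples of v
    conjugate v to multiples of itself; composing Phi with them one reaches T = 1
    and Phi z = z r with r real resonant (resonant_equivalence). There remains
    one equation for r, the images h of the parameters and the coefficients of u
    and v. Its leading part is again the homological equation, so r - 1, h - mu
    and the difference of the coefficients vanish grade by grade
    (comparison_step). The only freedom is in the coefficients of Z^N in r; it
    comes from the symmetries of v, which remove it (comparison_flow). *)

Set Implicit Arguments.
Unset Strict Implicit.
Unset Printing Implicit Defensive.

Import Order.TTheory GRing.Theory Num.Theory.
Local Open Scope ring_scope.

(** * Exponents and the Cauchy product *)

Section Exponents.
Context {N : nat}.
Implicit Types (d x y : exponent N) (s : 'I_(2 + N)).

Definition eadd x y : exponent N := [ffun s => (x s + y s)%N].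
Definition esub x y : exponent N := [ffun s => (x s - y s)%N].
Definition ele x y : bool := [forall s, (x s <= y s)%N].
Definition e0 : exponent N := [ffun=> 0%N].

Lemma eleP x y : reflect (forall s, (x s <= y s)%N) (ele x y).
Proof. exact: forallP. Qed.

Lemma exponentP x y : (forall s, x s = y s) -> x = y.
Proof. by move=> xy; apply/ffunP. Qed.

Lemma eaddC x y : eadd x y = eadd y x.
Proof. by apply/ffunP => s; rewrite !ffunE addnC. Qed.

Lemma eaddK x y : esub (eadd x y) y = x.
Proof. by apply/ffunP => s; rewrite !ffunE addnK. Qed.

Lemma eaddKl x y : esub (eadd x y) x = y.
Proof. by rewrite eaddC eaddK. Qed.

Lemma esubK x y : ele x y -> eadd (esub y x) x = y.
Proof. by move=> /eleP h; apply/ffunP => s; rewrite !ffunE subnK. Qed.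

Lemma esubKC x y : ele x y -> eadd x (esub y x) = y.
Proof. by move=> h; rewrite eaddC esubK. Qed.

Lemma ele_addr x y : ele x (eadd x y).
Proof. by apply/eleP => s; rewrite ffunE leq_addr. Qed.

Lemma eaddI x : injective (eadd x).
Proof. by move=> y z /(congr1 (fun t => esub t x)); rewrite !eaddKl. Qed.

Lemma ele_sub x y : ele (esub x y) x.
Proof. by apply/eleP => s; rewrite ffunE leq_subr. Qed.

Lemma esubB x y : ele y x -> esub x (esub x y) = y.
Proof. by move=> /eleP h; apply/ffunP => s; rewrite !ffunE subKn. Qed.

(** Each grading in use is a choice of weights of the variables: the total
    degree, the degree in z and w, and the grade with heavy parameters. *)
Definition wdeg (wt : 'I_(2 + N) -> nat) d : nat := (\sum_s wt s * d s)%N.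

Lemma wdegD wt x y : wdeg wt (eadd x y) = (wdeg wt x + wdeg wt y)%N.
Proof. by rewrite /wdeg -big_split; apply: eq_bigr => s _; rewrite ffunE mulnDr. Qed.

Lemma wdeg_expo1 wt s : wdeg wt (expo1 s) = wt s.
Proof.
rewrite /wdeg (bigD1 s) //= ffunE eqxx muln1 big1 ?addn0 // => t /negbTE.
by rewrite ffunE => ->; rewrite muln0.
Qed.

Lemma wdeg0 wt : wdeg wt e0 = 0%N.
Proof. by rewrite /wdeg big1 // => s _; rewrite ffunE muln0. Qed.

Lemma wdeg_le wt x y : ele x y -> (wdeg wt x <= wdeg wt y)%N.
Proof. by move=> /esubK <-; rewrite wdegD leq_addl. Qed.

Lemma sum_slots (F : 'I_(2 + N) -> nat) :
  (\sum_s F s = F iz + F iw + \sum_(i < N) F (imu i))%N.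
Proof.
rewrite big_split_ord /= !big_ord_recl big_ord0 addn0.
by congr (F _ + F _ + _)%N; apply/val_inj.
Qed.


Lemma slotP s : [\/ s = iz, s = iw | exists i, s = imu i].
Proof.
case: (split_ordP s) => [j ->|i ->]; last by constructor 3; exists i.
case: j => [[|[|//]] ?]; [constructor 1|constructor 2];
  by congr lshift; apply: val_inj.
Qed.

End Exponents.

Section SupportSums.
Context {V : nmodType} {I : eqType}.

(** The Cauchy product sums over a box that depends on the total degree; this
    lemma lets its range be changed freely outside the support. *)
Lemma eq_big_supp (s1 s2 : seq I) (F : I -> V) : uniq s1 -> uniq s2 ->
  (forall x, F x != 0 -> (x \in s1) = (x \in s2)) ->
  \sum_(x <- s1) F x = \sum_(x <- s2) F x.
Proof.
move=> u1 u2 h; rewrite (bigID (fun x => F x == 0)) big1 /=; last first.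
  by move=> x /eqP.
rewrite [RHS](bigID (fun x => F x == 0)) [in RHS]big1 /=; last first.
  by move=> x /eqP.
rewrite !add0r -[LHS]big_filter -[RHS]big_filter; apply: perm_big.
apply: uniq_perm; rewrite ?filter_uniq // => x; rewrite !mem_filter.
by case: (boolP (F x == 0)) => //= /h.
Qed.

End SupportSums.

Section Boxes.
Context {N : nat}.
Implicit Types (d x y : exponent N) (M : nat).

Definition boxval M (a : {ffun 'I_(2 + N) -> 'I_M.+1}) : exponent N :=
  [ffun s => a s : nat].

Lemma boxval_inj M : injective (@boxval M).
Proof.
by move=> a b /ffunP h; apply/ffunP => s; apply/val_inj; have := h s; rewrite !ffunE.
Qed.

Definition box M : seq (exponent N) := map (@boxval M) (index_enum _).

Lemma box_uniq M : uniq (box M).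
Proof. by rewrite map_inj_uniq ?index_enum_uniq //; apply: boxval_inj. Qed.

Lemma mem_box M x : (x \in box M) = [forall s, (x s <= M)%N].
Proof.
apply/mapP/forallP => [[a _ ->] s|h]; first by rewrite ffunE -ltnS.
exists [ffun s => inord (x s)]; first by rewrite mem_index_enum.
by apply/ffunP => s; rewrite !ffunE inordK ?ltnS.
Qed.

Lemma exp_le_tdeg d s : (d s <= tdeg d)%N.
Proof.
rewrite /tdeg /sdeg /pdeg; case: (slotP s) => [->|->|[i ->]].
- by rewrite -addnA leq_addr.
- by rewrite addnAC leq_addl.
- by rewrite (bigD1 i) //= addnA addnAC leq_addl.
Qed.

Definition below d : seq (exponent N) := [seq x <- box (tdeg d) | ele x d].

Lemma below_uniq d : uniq (below d).
Proof. by rewrite filter_uniq // box_uniq. Qed.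

Lemma mem_below d x : (x \in below d) = ele x d.
Proof.
rewrite mem_filter mem_box andb_idr // => /eleP h; apply/forallP => s.
exact: leq_trans (h s) (exp_le_tdeg _ _).
Qed.

End Boxes.

(** * The ring of formal power series *)

(** An alias of the type of series, since the ring structure on the functions
    themselves is the pointwise one. *)
Definition psr (R : realType) (N : nat) := exponent N -> R[i].
HB.instance Definition _ R N := GRing.Zmodule.copy (psr R N) (exponent N -> R[i]).

Section Ring.
Context {R : realType} {N : nat}.
Local Notation A := (psr R N).
Implicit Types (f g h : A) (d x y : exponent N).

Lemma addE f g d : (f + g) d = f d + g d. Proof. by []. Qed.
Lemma oppE f d : (- f) d = - f d. Proof. by []. Qed.
Lemma subE f g d : (f - g) d = f d - g d. Proof. by []. Qed.
Lemma zeroE d : (0 : A) d = 0. Proof. by []. Qed.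
Lemma sumE I (r : seq I) (P : pred I) (F : I -> A) d :
  (\sum_(i <- r | P i) F i) d = \sum_(i <- r | P i) F i d.
Proof. by elim/big_ind2: _ => // f1 x f2 y <- <-. Qed.

Lemma zm0 (e : A -> A) : zmod_morphism e -> e 0 = 0.
Proof. by move=> z; have := z 0 0; rewrite subrr => ->; rewrite subrr. Qed.
Lemma zmN (e : A -> A) f : zmod_morphism e -> e (- f) = - e f.
Proof. by move=> z; rewrite -sub0r z (zm0 z) sub0r. Qed.
Lemma zmD (e : A -> A) f g : zmod_morphism e -> e (f + g) = e f + e g.
Proof. by move=> z; rewrite -{1}[g]opprK z (zmN _ z) opprK. Qed.

Lemma smulE f g d : smul f g d = \sum_(x <- below d) f x * g (esub d x).
Proof.
rewrite /smul /below big_filter /box big_map; apply: eq_big.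
  by move=> a; apply: eq_forallb => s; rewrite !ffunE.
by move=> a _; congr (_ * g _); apply/ffunP => s; rewrite !ffunE.
Qed.

Lemma smulC : commutative (@smul R N).
Proof.
move=> f g; apply/funext => d; rewrite !smulE.
rewrite [RHS](_ : _ = \sum_(x <- map (esub d) (below d)) f x * g (esub d x)).
  apply: eq_big_supp; rewrite ?below_uniq //.
    rewrite map_inj_in_uniq ?below_uniq // => x y; rewrite !mem_below => hx hy e.
    by rewrite -(esubB hx) e esubB.
  move=> x _; rewrite mem_below; apply/idP/mapP => [hx|[y _ ->]].
    by exists (esub d x); rewrite ?mem_below ?ele_sub ?esubB.
  exact: ele_sub.
rewrite big_map big_seq [RHS]big_seq; apply: eq_bigr => x.
by rewrite mem_below => hx; rewrite esubB // mulrC.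
Qed.

Lemma smulA : associative (@smul R N).
Proof.
move=> f g h; apply/funext => d; rewrite !smulE.
under eq_bigr => x _ do rewrite smulE mulr_sumr.
under [RHS]eq_bigr => t _ do rewrite smulE mulr_suml.
pose G x t := f x * g (esub t x) * h (esub d t).
transitivity (\sum_(x <- below d) \sum_(t <- below d | ele x t) G x t).
  rewrite big_seq [RHS]big_seq; apply: eq_bigr => x; rewrite mem_below => hx.
  rewrite -[RHS]big_filter.
  rewrite [RHS](_ : _ = \sum_(t <- map (eadd x) (below (esub d x))) G x t).
    rewrite big_map big_seq [RHS]big_seq; apply: eq_bigr => y.
    rewrite mem_below => hy; rewrite /G eaddKl mulrA; congr (_ * h _).
    by apply/ffunP => s; rewrite !ffunE subnDA.
  apply: eq_big_supp.
  - exact/filter_uniq/below_uniq.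
  - by rewrite (map_inj_uniq (@eaddI _ x)) below_uniq.
  move=> t _; rewrite mem_filter mem_below; apply/andP/mapP => [[xt td]|[y]].
    exists (esub t x); last by rewrite esubKC.
    rewrite mem_below; apply/eleP => s; rewrite !ffunE.
    by apply: leq_sub2r; move/eleP: td.
  rewrite mem_below => /eleP hy ->; rewrite ele_addr; split=> //.
  apply/eleP => s; rewrite ffunE; have := hy s; rewrite ffunE.
  by move/eleP: hx => /(_ s); lia.
rewrite (exchange_big_dep (fun t => true)) //= big_seq [RHS]big_seq.
apply: eq_bigr => t; rewrite mem_below => td.
rewrite -big_filter; apply: eq_big_supp; rewrite ?below_uniq //.
  exact/filter_uniq/below_uniq.
move=> x _; rewrite mem_filter !mem_below andb_idr // => /eleP xt.
by apply/eleP => s; apply: leq_trans (xt s) _; move/eleP: td.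
Qed.

Lemma smul1l : left_id (@sone R N) (@smul R N).
Proof.
move=> f; apply/funext => d; rewrite smulE.
rewrite (eq_big_supp (s2 := [:: e0])) ?below_uniq //.
  rewrite big_seq1 /sone /smonomial eqxx mul1r; congr f.
  by apply/ffunP => s; rewrite !ffunE subn0.
move=> x; rewrite mem_below inE /sone /smonomial /e0.
case: (x =P [ffun=> 0%N]) => [-> _|_]; last by rewrite mul0r eqxx.
by apply/eleP => s; rewrite ffunE.
Qed.

Lemma smulDl : left_distributive (@smul R N) (fun f g => f + g).
Proof.
move=> f g h; apply/funext => d; rewrite !smulE /= -[RHS]/(smul f h d + smul g h d).
by rewrite !smulE -big_split; apply: eq_bigr => x _; rewrite mulrDl.
Qed.

Lemma sone_neq0 : sone != 0 :> A.
Proof.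
apply/eqP => /(congr1 (fun f : A => f e0)).
by rewrite /sone /smonomial eqxx => /eqP; rewrite oner_eq0.
Qed.

End Ring.

HB.instance Definition _ (R : realType) (N : nat) :=
  GRing.Zmodule_isComNzRing.Build (psr R N)
    (@smulA R N) (@smulC R N) (@smul1l R N) (@smulDl R N) (@sone_neq0 R N).

Section RingTheory.
Context {R : realType} {N : nat}.
Local Notation A := (psr R N).
Local Notation C := R[i].
Implicit Types (f g h : A) (d x y : exponent N) (c : C).


Definition pc c : A := fun d => if d == e0 then c else 0.
Definition mono x : A := smonomial x.
Definition var s : A := svar s.

Lemma mulE f g d : (f * g) d = \sum_(x <- below d) f x * g (esub d x).
Proof. exact: smulE. Qed.

Lemma oneE d : (1 : A) d = (d == e0)%:R. Proof. by []. Qed.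

Lemma monoE x f d : (mono x * f) d = if ele x d then f (esub d x) else 0.
Proof.
rewrite mulE; case: ifP => xd.
  rewrite (eq_big_supp (s2 := [:: x])) ?below_uniq //.
    by rewrite big_seq1 /mono /smonomial eqxx mul1r.
  move=> y; rewrite mem_below inE /mono /smonomial.
  by case: (y =P x) => [-> //|]; rewrite mul0r eqxx.
rewrite big1_seq // => y /andP[_]; rewrite mem_below /mono /smonomial.
by case: (y =P x) => [->|]; rewrite ?xd // mul0r.
Qed.

Lemma monoE_add x f d : (mono x * f) (eadd x d) = f d.
Proof. by rewrite monoE ele_addr eaddKl. Qed.

Lemma mono_inj x f g : mono x * f = mono x * g -> f = g.
Proof.
by move=> h; apply/funext => d; rewrite -(monoE_add x f) h monoE_add.
Qed.

Lemma monoD x y : mono (eadd x y) = mono x * mono y.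
Proof.
apply/funext => d; rewrite monoE /mono /smonomial; case: ifPn => xd.
  by congr (_%:R); congr nat_of_bool; apply/eqP/eqP => [->|<-]; rewrite ?eaddKl ?esubKC.
by case: eqP xd => // ->; rewrite ele_addr.
Qed.

Lemma mono0 : mono e0 = 1. Proof. by []. Qed.

Lemma ele_expo1 s d : ele (expo1 s) d = (0 < d s)%N.
Proof.
apply/eleP/idP => [/(_ s)|ds t]; rewrite ffunE ?eqxx //.
by case: eqP => // ->.
Qed.

Lemma varE s f d : (var s * f) d = if (0 < d s)%N then f (esub d (expo1 s)) else 0.
Proof. by rewrite monoE ele_expo1. Qed.

Lemma varE_add s f d : (var s * f) (eadd (expo1 s) d) = f d.
Proof. exact: monoE_add. Qed.

Lemma var_inj s f g : var s * f = var s * g -> f = g.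
Proof. exact: mono_inj. Qed.

Lemma pcE c f d : (pc c * f) d = c * f d.
Proof.
rewrite mulE (eq_big_supp (s2 := [:: e0])) ?below_uniq //.
  rewrite big_seq1 /pc eqxx; congr (_ * f _).
  by apply/ffunP => s; rewrite !ffunE subn0.
move=> y; rewrite mem_below inE /pc.
case: (y =P e0) => [-> _|]; last by rewrite mul0r eqxx.
by apply/eleP => s; rewrite ffunE.
Qed.

Lemma scale_pc c (f : series R N) : c *: f = pc c * (f : A).
Proof. by apply/funext => d; rewrite pcE. Qed.

Fact pc_is_zmod_morphism : zmod_morphism pc.
Proof.
by move=> a b; apply/funext => d; rewrite subE /pc; case: eqP; rewrite ?subr0.
Qed.
Fact pc_is_monoid_morphism : monoid_morphism pc.
Proof.
split; first by apply/funext => d; rewrite oneE /pc; case: eqP.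
by move=> a b; apply/funext => d; rewrite pcE /pc; case: eqP; rewrite ?mulr0.
Qed.
HB.instance Definition _ := GRing.isZmodMorphism.Build C A pc pc_is_zmod_morphism.
HB.instance Definition _ := GRing.isMonoidMorphism.Build C A pc pc_is_monoid_morphism.

Lemma natr_pc (n : nat) : n%:R = pc n%:R.
Proof. by rewrite rmorph_nat. Qed.

Lemma natr_coefM (n : nat) f d : (n%:R * f) d = n%:R * f d.
Proof. by rewrite natr_pc pcE. Qed.

(** Diagonal operators; they are derivations when the eigenvalues are additive
    in the exponent, as for the Euler field and the rotation. *)
Definition dg (lam : exponent N -> C) f : A := fun d => lam d * f d.

Lemma dgM lam f g : (forall x y, lam (eadd x y) = lam x + lam y) ->
  dg lam (f * g) = dg lam f * g + f * dg lam g.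
Proof.
move=> lamD; apply/funext => d; rewrite addE /dg !mulE mulr_sumr -big_split /=.
rewrite big_seq [RHS]big_seq; apply: eq_bigr => x; rewrite mem_below => xd.
rewrite -{1}(esubKC xd) lamD; ring.
Qed.

Lemma dgD lam f g : dg lam (f + g) = dg lam f + dg lam g.
Proof. by apply/funext => d; rewrite /dg !addE mulrDr. Qed.

Definition pd s f : A := sderiv s f.

Fact pd_is_zmod_morphism s : zmod_morphism (pd s).
Proof. by move=> f g; apply/funext => d; rewrite subE /pd /sderiv -mulrBr. Qed.
HB.instance Definition _ s :=
  GRing.isZmodMorphism.Build A A (pd s) (pd_is_zmod_morphism s).

Lemma var_pd s f : var s * pd s f = dg (fun d => (d s)%:R) f.
Proof.
apply/funext => d; rewrite varE /dg; case: ifPn => ds.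
  rewrite /pd /sderiv !ffunE eqxx subn1 prednK //; congr (_ * f _).
  apply/ffunP => t; rewrite !ffunE; case: eqP => [->|_]; last by rewrite subn0 addn0.
  by rewrite subnK.
by move: ds; rewrite -eqn0Ngt => /eqP ->; rewrite mul0r.
Qed.

Lemma pdM s f g : pd s (f * g) = pd s f * g + f * pd s g.
Proof.
apply: (@var_inj s); rewrite var_pd dgM; last by move=> x y; rewrite ffunE natrD.
by rewrite -!var_pd; ring.
Qed.

Lemma pdC s t f : pd s (pd t f) = pd t (pd s f).
Proof.
apply/funext => d; rewrite /pd /sderiv !ffunE.
have [->//|st] := eqVneq s t.
rewrite !addn0 mulrCA; congr (_ * (_ * f _)).
by apply/ffunP => u; rewrite !ffunE addnAC.
Qed.

Lemma pd_pc s c : pd s (pc c) = 0.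
Proof.
apply/funext => d; rewrite /pd /sderiv /pc; case: eqP => [/ffunP/(_ s)|_].
  by rewrite !ffunE eqxx addn1.
by rewrite mulr0.
Qed.

Lemma pd1 s : pd s 1 = 0.
Proof. by rewrite -(rmorph1 pc) pd_pc. Qed.

Lemma pd_var s t : pd s (var t) = (t == s)%:R.
Proof.
apply/(@var_inj s)/funext => d; rewrite var_pd /dg /var /svar /smonomial.
case: (d =P expo1 t) => [->|dt].
  rewrite ffunE mulr1 eq_sym; case: eqP => [->|_]; last by rewrite mulr0.
  by rewrite mulr1 /svar /smonomial eqxx.
rewrite mulr0; case: eqP => [ts|_]; last by rewrite mulr0.
by rewrite mulr1 /svar /smonomial -ts; case: eqP.
Qed.

(** Conjugation on the reality subspace w = conj z; it turns the first
    component of a real field into the second one. *)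
Definition cs f : A := conj_swap f.
Definition sw d : exponent N := expo (d iw) (d iz) (param d).

Lemma coords_iz T (a b : T) (m : 'I_N -> T) : coords a b m iz = a.
Proof. by rewrite /coords /iz (unsplitK (inl _ _)). Qed.
Lemma coords_iw T (a b : T) (m : 'I_N -> T) : coords a b m iw = b.
Proof. by rewrite /coords /iw (unsplitK (inl _ _)). Qed.
Lemma coords_imu T (a b : T) (m : 'I_N -> T) i : coords a b m (imu i) = m i.
Proof. by rewrite /coords /imu (unsplitK (inr _ _)). Qed.
Definition coordsE := (coords_iz, coords_iw, coords_imu).

Lemma expoE j k (n : {ffun 'I_N -> nat}) :
  (expo j k n iz = j) * (expo j k n iw = k) * (forall i, expo j k n (imu i) = n i).
Proof. by split=> [|i]; rewrite ?ffunE ?coordsE. Qed.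

Lemma paramE d i : param d i = d (imu i). Proof. by rewrite ffunE. Qed.

Lemma param_expo j k (n : {ffun 'I_N -> nat}) : param (expo j k n) = n.
Proof. by apply/ffunP => i; rewrite ffunE expoE. Qed.

Lemma expo_slotP x y : x iz = y iz -> x iw = y iw ->
  (forall i, x (imu i) = y (imu i)) -> x = y.
Proof.
by move=> hz hw hm; apply/ffunP => s; case: (slotP s) => [->|->|[i ->]].
Qed.

Lemma swE d : (sw d iz = d iw) * (sw d iw = d iz) *
  (forall i, sw d (imu i) = d (imu i)).
Proof. by rewrite /sw; split=> [|i]; rewrite !expoE ?paramE. Qed.

Lemma swK : involutive sw.
Proof. by move=> d; apply: expo_slotP => [||i]; rewrite !swE. Qed.

Lemma swD x y : sw (eadd x y) = eadd (sw x) (sw y).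
Proof. by apply: expo_slotP => [||i]; rewrite !(swE, ffunE). Qed.

Lemma sw_sub x y : sw (esub x y) = esub (sw x) (sw y).
Proof. by apply: expo_slotP => [||i]; rewrite !(swE, ffunE). Qed.

Lemma ele_sw x y : ele (sw x) (sw y) = ele x y.
Proof.
have h a b : ele a b -> ele (sw a) (sw b) by move=> /esubKC <-; rewrite swD ele_addr.
by apply/idP/idP => [/h|/h//]; rewrite !swK.
Qed.

Lemma csE f d : cs f d = (f (sw d))^*%C. Proof. by []. Qed.

Fact cs_is_zmod_morphism : zmod_morphism cs.
Proof. by move=> f g; apply/funext => d; rewrite subE !csE subE rmorphB. Qed.
Fact cs_is_monoid_morphism : monoid_morphism cs.
Proof.
split.
  apply/funext => d; rewrite csE !oneE rmorph_nat; congr (_%:R); congr nat_of_bool.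
  have sw0 : sw e0 = e0 by apply: expo_slotP => [||i]; rewrite !swE !ffunE.
  by rewrite -[X in sw d == X]sw0 (inj_eq (can_inj swK)).
move=> f g; apply/funext => d; rewrite csE !mulE rmorph_sum /=.
rewrite [RHS](_ : _ = \sum_(x <- map sw (below (sw d))) cs f x * cs g (esub d x)).
  by rewrite big_map; apply: eq_bigr => x _; rewrite !csE rmorphM sw_sub !swK.
apply: eq_big_supp; rewrite ?below_uniq ?(map_inj_uniq (can_inj swK)) ?below_uniq //.
move=> x _; rewrite mem_below; apply/idP/mapP => [xd|[y]].
  by exists (sw x); rewrite ?swK // mem_below ele_sw.
by rewrite mem_below => yd ->; rewrite -ele_sw swK.
Qed.
HB.instance Definition _ := GRing.isZmodMorphism.Build A A cs cs_is_zmod_morphism.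
HB.instance Definition _ := GRing.isMonoidMorphism.Build A A cs cs_is_monoid_morphism.

Lemma csK : involutive cs.
Proof. by move=> f; apply/funext => d; rewrite !csE swK conjcK. Qed.

Lemma cs_pc c : cs (pc c) = pc (c^*)%C.
Proof.
apply/funext => d; rewrite csE /pc.
have sw0 : sw e0 = e0 by apply: expo_slotP => [||i]; rewrite !swE !ffunE.
by rewrite -[X in sw d == X]sw0 (inj_eq (can_inj swK)); case: eqP; rewrite ?rmorph0.
Qed.

Lemma cs_mono x : cs (mono x) = mono (sw x).
Proof.
apply/funext => d; rewrite csE /mono /smonomial rmorph_nat.
by rewrite (can2_eq swK swK).
Qed.

Lemma sw_expo1 : (sw (expo1 iz) = expo1 iw) * (sw (expo1 iw) = expo1 iz) *
  (forall i, sw (expo1 (imu i)) = expo1 (imu i)).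
Proof.
by split=> [|i]; [split|]; apply: expo_slotP => [||j]; rewrite !swE !ffunE.
Qed.

Lemma cs_var : (cs (var iz) = var iw) * (cs (var iw) = var iz) *
  (forall i, cs (var (imu i)) = var (imu i)).
Proof. by split=> [|i]; rewrite !cs_mono !sw_expo1. Qed.

Lemma cs_pd : (forall f, cs (pd iz f) = pd iw (cs f)) *
  (forall f, cs (pd iw f) = pd iz (cs f)) *
  (forall i f, cs (pd (imu i) f) = pd (imu i) (cs f)).
Proof.
split; [split|move=> i] => f; apply/funext => d;
  rewrite csE /pd /sderiv rmorphM rmorph_nat swE csE; congr (_ * (f _)^*%C);
  by apply: expo_slotP => [||j]; rewrite !(ffunE, swE).
Qed.

(** The derivation defined by the real vector field with first component v.
    All arguments about fields are arguments about these derivations: the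
    bracket of fields is, up to sign, the commutator. *)
Definition D (v f : A) : A := v * pd iz f + cs v * pd iw f.

Fact D_is_zmod_morphism v : zmod_morphism (D v).
Proof. by move=> f g; rewrite /D !raddfB; ring. Qed.
HB.instance Definition _ v :=
  GRing.isZmodMorphism.Build A A (D v) (D_is_zmod_morphism v).

Lemma DM v f g : D v (f * g) = D v f * g + f * D v g.
Proof. by rewrite /D !pdM; ring. Qed.

Lemma D_pc v c : D v (pc c) = 0.
Proof. by rewrite /D !pd_pc !mulr0 addr0. Qed.

Lemma D_var v : (D v (var iz) = v) * (D v (var iw) = cs v) *
  (forall i, D v (var (imu i)) = 0).
Proof.
by split=> [|i]; [split|]; rewrite /D !pd_var ?eqxx /= ?mulr1 ?mulr0 ?addr0 ?add0r.
Qed.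

Lemma cs_D v f : cs (D v f) = D v (cs f).
Proof. by rewrite /D rmorphD !rmorphM /= csK !cs_pd addrC. Qed.

Lemma DDl u v f : D (u + v) f = D u f + D v f.
Proof. by rewrite /D rmorphD /=; ring. Qed.
Lemma DNl u f : D (- u) f = - D u f.
Proof. by rewrite /D rmorphN /=; ring. Qed.
Lemma DBl u v f : D (u - v) f = D u f - D v f.
Proof. by rewrite DDl DNl. Qed.
Lemma DMl t v f : cs t = t -> D (t * v) f = t * D v f.
Proof. by move=> rt; rewrite /D rmorphM /= rt; ring. Qed.

Lemma bracketE (u v : A) : bracket u v = D v u - D u v.
Proof.
rewrite /bracket /D; congr (_ - _); congr (_ + _); exact: smulC.
Qed.

Lemma D_bracket u v f : D u (D v f) - D v (D u f) = D (D u v - D v u) f.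
Proof.
rewrite [D (D u v - _) f]/D rmorphB /= !cs_D /D !raddfD /= !pdM.
rewrite (pdC iw iz f). ring.
Qed.

End RingTheory.

(** * Filtrations *)

Section Filtration.
Context {R : realType} {N : nat}.
Local Notation A := (psr R N).
Local Notation C := R[i].
Implicit Types (f g h u v : A) (d x y : exponent N) (c : C).
Implicit Types (wt : 'I_(2 + N) -> nat).

Definition Fil wt n f : Prop := forall d, (wdeg wt d < n)%N -> f d = 0.

Section Weight.
Variable wt : 'I_(2 + N) -> nat.
Local Notation F := (Fil wt).

Lemma Fil0 f : F 0 f. Proof. by []. Qed.
Lemma Fil_zero n : F n 0. Proof. by []. Qed.
Lemma Fil_le m n f : (n <= m)%N -> F m f -> F n f.
Proof. by move=> nm h d dn; apply: h; apply: leq_trans nm. Qed.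
Lemma FilD n f g : F n f -> F n g -> F n (f + g).
Proof. by move=> hf hg d dn; rewrite addE hf ?hg ?addr0. Qed.
Lemma FilN n f : F n f -> F n (- f).
Proof. by move=> hf d dn; rewrite oppE hf ?oppr0. Qed.
Lemma FilB n f g : F n f -> F n g -> F n (f - g).
Proof. by move=> hf hg; apply: FilD => //; apply: FilN. Qed.
Lemma FilBC n f g : F n (f - g) -> F n (g - f).
Proof. by move=> /FilN; rewrite opprB. Qed.
Lemma Fil_trans n g f h : F n (f - g) -> F n (g - h) -> F n (f - h).
Proof. by move=> a b; rewrite -[f](subrK g) -addrA; apply: FilD. Qed.
Lemma Fil_sub n g f : F n (f - g) -> F n g -> F n f.
Proof. by move=> a b; rewrite -[f](subrK g); apply: FilD. Qed.

Lemma Fil_sum n I (r : seq I) (P : pred I) (G : I -> A) :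
  (forall i, P i -> F n (G i)) -> F n (\sum_(i <- r | P i) G i).
Proof. by move=> h; elim/big_ind: _ => //; [apply: FilD]. Qed.

Lemma FilM n m f g : F n f -> F m g -> F (n + m) (f * g).
Proof.
move=> hf hg d dnm; rewrite mulE big1_seq // => x /andP[_].
rewrite mem_below => xd; case: (ltnP (wdeg wt x) n) => [/hf ->|nx].
  by rewrite mul0r.
rewrite hg ?mulr0 //; move: dnm; rewrite -{1}(esubKC xd) wdegD; lia.
Qed.

Lemma FilMl n f g : F n g -> F n (f * g).
Proof. by move=> h; rewrite -[n]add0n; apply: FilM. Qed.
Lemma FilMr n f g : F n f -> F n (f * g).
Proof. by move=> h; rewrite -[n]addn0; apply: FilM. Qed.

Lemma FilX n k f : F n f -> F (k * n) (f ^+ k).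
Proof.
by move=> h; elim: k => // k IH; rewrite exprS mulSn; apply: FilM.
Qed.

Lemma Fil_mono x : F (wdeg wt x) (mono x : A).
Proof.
by move=> d; rewrite /mono /smonomial; case: eqP => // ->; rewrite ltnn.
Qed.

Lemma Fil_var s : F (wt s) (var s : A).
Proof. by have := Fil_mono (x := expo1 s); rewrite wdeg_expo1. Qed.

Lemma Fil_pd n s f : F n f -> F (n - wt s) (pd s f).
Proof.
move=> h d dn; rewrite /pd /sderiv (_ : [ffun _ => _] = eadd d (expo1 s)).
  by rewrite h ?mulr0 // wdegD wdeg_expo1; lia.
by apply/ffunP => t; rewrite !ffunE.
Qed.

Lemma Fil_dg n lam f : F n f -> F n (dg lam f).
Proof. by move=> h d dn; rewrite /dg h ?mulr0. Qed.

Lemma Fil_cs n f : wt iz = wt iw -> F n f -> F n (cs f).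
Proof.
move=> wzw h d dn; rewrite csE h ?rmorph0 //.
rewrite (_ : wdeg wt (sw d) = wdeg wt d) // /wdeg !sum_slots !swE wzw.
by congr (_ + _)%N; [rewrite addnC|apply: eq_bigr => i _; rewrite swE].
Qed.

End Weight.

(** Parameters have weight 2 N + 1, so that Z^N is the leading part of
    A Z^N + sum_i Z^i mu_i. *)
Definition wa : 'I_(2 + N) -> nat := coords 1%N 1%N (fun=> @weight N).
Definition fg d : nat := wdeg wa d.
Definition F := Fil wa.

Lemma wa_slots : (wa iz = 1%N) * (wa iw = 1%N) * (forall i, wa (imu i) = @weight N).
Proof. by rewrite /wa; split=> [|i]; rewrite !coordsE. Qed.

Lemma fgE d : fg d = (sdeg d + @weight N * pdeg d)%N.
Proof.
rewrite /fg /wdeg sum_slots !wa_slots !mul1n /sdeg /pdeg big_distrr /=.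
by congr (_ + _)%N; apply: eq_bigr => i _; rewrite wa_slots.
Qed.

Lemma fgD x y : fg (eadd x y) = (fg x + fg y)%N. Proof. exact: wdegD. Qed.

Lemma wa_gt0 s : (0 < wa s)%N.
Proof. by case: (slotP s) => [->|->|[i ->]]; rewrite wa_slots. Qed.

Lemma exp_le_fg d s : (d s <= fg d)%N.
Proof.
rewrite /fg /wdeg (bigD1 s) //=; apply: leq_trans (leq_addr _ _).
by rewrite leq_pmull // wa_gt0.
Qed.

Lemma F_eq0 f : (forall n, F n f) -> f = 0.
Proof. by move=> h; apply/funext => d; apply: (h (fg d).+1). Qed.

Lemma F_eq f g : (forall n, F n (f - g)) -> f = g.
Proof. by move=> /F_eq0/eqP; rewrite subr_eq0 => /eqP. Qed.

Lemma F_coef f g n d : F n (f - g) -> (fg d < n)%N -> f d = g d.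
Proof. by move=> h /h; rewrite subE => /eqP; rewrite subr_eq0 => /eqP. Qed.

Lemma F_cs n f : F n f -> F n (cs f).
Proof. by apply: Fil_cs; rewrite !wa_slots. Qed.

Lemma F_varz : F 1 (var iz : A).
Proof. by have := Fil_var (wt := wa) (s := iz); rewrite wa_slots. Qed.
Lemma F_varw : F 1 (var iw : A).
Proof. by have := Fil_var (wt := wa) (s := iw); rewrite wa_slots. Qed.
Lemma F_varmu i : F (@weight N) (var (imu i) : A).
Proof. by have := Fil_var (wt := wa) (s := imu i); rewrite wa_slots. Qed.

Lemma F_D n m v f : F n v -> F m f -> F (n + m).-1 (D v f).
Proof.
move=> hv hf; apply: FilD.
  have h := Fil_pd (s := iz) hf; rewrite wa_slots in h.
  by apply: Fil_le (FilM hv h); lia.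
have h := Fil_pd (s := iw) hf; rewrite wa_slots in h.
by apply: Fil_le (FilM (F_cs hv) h); lia.
Qed.

Definition trunc n f : A := \sum_(x <- box n) pc (f x) * mono x.

Lemma truncE n f d : trunc n f d = if d \in box n then f d else 0.
Proof.
rewrite /trunc sumE; case: ifPn => dn.
  rewrite (bigD1_seq d) ?box_uniq //= pcE /mono /smonomial eqxx mulr1.
  rewrite big1 ?addr0 // => x /negbTE xd.
  by rewrite pcE /smonomial eq_sym xd mulr0.
rewrite big1_seq // => x /andP[_ xn]; rewrite pcE /mono /smonomial.
by case: eqP dn => [->|]; rewrite ?xn ?mulr0.
Qed.

Lemma F_trunc n f : F n (f - trunc n f).
Proof.
move=> d dn; rewrite subE truncE mem_box ifT ?subrr //.
by apply/forallP => s; exact: leq_trans (exp_le_fg d s) (ltnW dn).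
Qed.

(** Constants and variables generate a dense subring, so continuous maps may be
    compared on the variables. *)
Lemma series_ind (P : A -> Prop) :
  (forall c, P (pc c)) -> (forall f g, P f -> P g -> P (f + g)) ->
  (forall s f, P f -> P (var s * f)) ->
  (forall f, (forall n, exists2 g, P g & F n (f - g)) -> P f) ->
  forall f, P f.
Proof.
move=> Pc PD PM Plim f; apply: Plim => n; exists (trunc n f); last exact: F_trunc.
rewrite /trunc; apply: (big_ind P) => //.
  by have := Pc 0; rewrite rmorph0.
move=> x _; move: (f x) => c.
have [m] := ubnP (tdeg x); elim: m x => // m IH x xm.
have [x0|[s xs]] : x = e0 \/ exists s, (0 < x s)%N.
  case: (pickP (fun s => 0 < x s)%N) => [s xs|h]; first by right; exists s.
  by left; apply/ffunP => s; rewrite ffunE; have := h s; case: (x s).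
- by rewrite x0 mono0 mulr1.
- rewrite -(@esubKC _ (expo1 s) x) ?ele_expo1 // monoD mulrCA; apply: PM.
  apply: IH; suff : (tdeg (esub x (expo1 s)) < tdeg x)%N by lia.
  rewrite /tdeg /sdeg /pdeg -!(sum_slots).
  rewrite [X in (_ < X)%N](bigD1 s) //= (bigD1 s) //= !ffunE eqxx.
  rewrite -addSn leq_add //; first by lia.
  by apply: leq_sum => t _; rewrite !ffunE leq_subr.
Qed.

End Filtration.
Arguments F {R N}.

Hint Resolve Fil_zero Fil0 : core.

(** * Neumann series *)

Section Neumann.
Context {R : realType} {N : nat}.
Local Notation A := (psr R N).
Implicit Types (f g : A).

Definition raises (m : nat) (E : A -> A) : Prop := forall n f, F n f -> F (n + m) (E f).

Variable E : A -> A.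
Hypotheses (Ea : zmod_morphism E) (Er : raises 1 E).

Lemma iter_zmod k : zmod_morphism (iter k E).
Proof. by elim: k => // k IH f g /=; rewrite IH Ea. Qed.

Lemma iter_raises m k : raises m E -> raises (k * m) (iter k E).
Proof.
move=> h n f hf; elim: k => [|k IH] /=; first by rewrite addn0.
by rewrite mulSn [(m + _)%N]addnC addnA; apply: h.
Qed.

Lemma iter_F k f : F k (iter k E f).
Proof. by have := @iter_raises 1 k Er 0%N f (Fil0 _); rewrite muln1. Qed.

Let EN f : E (- f) = - E f. Proof. exact: zmN. Qed.
Let ED f g : E (f + g) = E f + E g. Proof. exact: zmD. Qed.

(** A solution of f = - E f has arbitrarily high order. *)
Lemma add_raising_inj f : f + E f = 0 -> f = 0.
Proof.
move=> h; apply: F_eq0; elim=> // n IH.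
have -> : f = - E f by apply/eqP; rewrite -subr_eq0 opprK h.
by apply: FilN; rewrite -addn1; apply: Er.
Qed.

(** The inverse of id + E. An operator that raises the degree has no
    iterate beyond the one of index fg d that contributes to the coefficient at
    d, so the alternating series is a finite sum there. *)
Definition neumann f : A := fun d =>
  \sum_(k < (fg d).+1) (-1) ^+ k * iter k E f d.

Let partial n f : A := \sum_(k < n) pc ((-1) ^+ k) * iter k E f.

Let partialE n f d : (fg d < n)%N -> neumann f d = partial n f d.
Proof.
move=> dn; rewrite /neumann /partial sumE.
under [RHS]eq_bigr => k _ do rewrite pcE.
rewrite -!(big_mkord xpredT (fun k => (-1) ^+ k * iter k E f d)).
rewrite [RHS](big_cat_nat (n := (fg d).+1)) //= [X in _ + X]big_nat_cond [X in _ + X]big1 ?addr0 //.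
move=> k /andP[/andP[kd _] _].
by rewrite (@iter_F k) ?mulr0.
Qed.

Lemma neumannP f : neumann f + E (neumann f) = f.
Proof.
have sgn k g : E (pc ((-1) ^+ k) * g) = pc ((-1) ^+ k) * E g.
  by rewrite rmorphXn rmorphN1 -signr_odd; case: (odd k); rewrite ?expr1 ?expr0 ?mulN1r ?mul1r ?EN.
have Esum n : E (partial n f) = \sum_(k < n) pc ((-1) ^+ k) * iter k.+1 E f.
  rewrite /partial; elim: n => [|n IH]; first by rewrite !big_ord0 ?(zm0 Ea).
  by rewrite !big_ord_recr /= ED IH sgn.
have tele n : partial n f + E (partial n f) = f - pc ((-1) ^+ n) * iter n E f.
  rewrite Esum /partial; elim: n => [|n IH].
    by rewrite !big_ord0 expr0 rmorph1 mul1r /= subrr addr0.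
  rewrite !big_ord_recr /= addrACA IH exprS mulN1r rmorphN.
  by rewrite -/(iter n.+1 E f) /=; ring.
apply: F_eq => n.
have close : F n (neumann f - partial n f).
  by move=> d dn; rewrite subE (partialE (n := n)) // subrr.
apply: (Fil_trans (g := partial n f + E (partial n f))).
  rewrite opprD addrACA -Ea; apply: FilD => //.
  by apply: Fil_le (Er close); rewrite addn1.
rewrite tele addrAC subrr add0r; apply: FilN; apply: FilMl; exact: iter_F.
Qed.

Lemma neumannK f : neumann (f + E f) = f.
Proof.
apply/eqP; rewrite -subr_eq0; apply/eqP/add_raising_inj.
by rewrite Ea addrACA neumannP -opprD subrr.
Qed.

(** A subspace that is given by the vanishing of coefficients and stable under E
    is stable under the inverse of id + E. *)
Lemma neumann_zero (S : exponent N -> Prop) f :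
  (forall g, (forall d, S d -> g d = 0) -> (forall d, S d -> E g d = 0)) ->
  (forall d, S d -> f d = 0) -> forall d, S d -> neumann f d = 0.
Proof.
move=> h hf d Sd; rewrite /neumann big1 // => k _.
have itz j : forall d', S d' -> iter j E f d' = 0.
  by elim: j => // j IH; apply: h.
by rewrite itz ?mulr0.
Qed.

End Neumann.

(** * Exponentials *)

Section TriangularSums.
Variables (V : nmodType) (G : nat -> nat -> V).

Lemma sum_antidiagonals K :
  \sum_(k < K) \sum_(j < k.+1) G j (k - j)
  = \sum_(j < K) \sum_(l < K | (j + l < K)%N) G j l.
Proof.
have diag (k : 'I_K) : \sum_(j < k.+1) G j (k - j)
    = \sum_(j < K) \sum_(l < K | (j + l == k)%N) G j l.
  rewrite (big_ord_widen_cond K xpredT (fun j => G j (k - j)%N)) ?ltn_ord //=.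
  rewrite big_mkcond; apply: eq_bigr => j _; rewrite ltnS; case: leqP => jk.
    have lK : (k - j < K)%N by apply: leq_ltn_trans (leq_subr _ _) (ltn_ord k).
    rewrite (bigD1 (Ordinal lK)) /= ?subnKC ?eqxx // big1 ?addr0 // => l.
    case/andP => /eqP jl /negP[]; apply/eqP/val_inj => /=.
    by rewrite -jl addnC addnK.
  rewrite big1 // => l /eqP jl; move: jk; rewrite -jl.
  by rewrite ltnNge leq_addr.
under eq_bigr do rewrite diag.
rewrite exchange_big; apply: eq_bigr => j _ /=.
rewrite (exchange_big_dep (fun l : 'I_K => (j + l < K)%N)) /=; last first.
  by move=> k l _ /eqP ->; apply: ltn_ord.
apply: eq_bigr => l jl; rewrite (bigD1 (Ordinal jl)) //= big1 ?addr0 // => k.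
by case/andP => /eqP jk /negP[]; apply/eqP/val_inj => /=.
Qed.

Variable X : V -> V.
Hypotheses (X0 : X 0 = 0) (XD : forall u v, X (u + v) = X u + X v).
Hypothesis XG : forall j l, X (G j l) = G j.+1 l + G j l.+1.

Lemma iter_leibniz k :
  iter k X (G 0%N 0%N) = \sum_(j < k.+1) G j (k - j) *+ 'C(k, j).
Proof.
elim: k => [|k IH]; first by rewrite big_ord1.
have Xsum (r : seq 'I_k.+1) (H : 'I_k.+1 -> V) :
    X (\sum_(i <- r) H i) = \sum_(i <- r) X (H i).
  by elim: r => [|i r IHr]; rewrite ?big_nil // !big_cons XD IHr.
have Xn u n : X (u *+ n) = X u *+ n.
  by elim: n => [|n IHn]; rewrite ?mulr0n // !mulrS XD IHn.
rewrite /= IH Xsum; under [LHS]eq_bigr => j _ do rewrite Xn XG mulrnDl.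
rewrite big_split /= [RHS]big_ord_recl /= bin0 [X in _ + X = _]big_ord_recl /=.
rewrite !bin0 !subn0 addrCA; congr (_ + _).
under [RHS]eq_bigr => j _ do rewrite /bump /= add1n binS subSS mulrnDr.
rewrite [RHS]big_split /= addrC; congr (_ + _).
rewrite [RHS]big_ord_recr /= bin_small ?mulr0n ?addr0 //.
by apply: eq_bigr => j _; rewrite /bump /= add1n subnSK.
Qed.

End TriangularSums.

Section Exp.
Context {R : realType} {N : nat}.
Local Notation A := (psr R N).
Local Notation C := R[i].
Implicit Types (f g : A) (X : A -> A).

(** The operators whose exponential series is finite in each coefficient. *)
Definition nilop X : Prop := zmod_morphism X /\ raises 1 X.

Definition invfact k : C := (k`!%:R)^-1.

Definition exps X f : A := fun d => \sum_(k < (fg d).+1) invfact k * iter k X f d.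

Definition exps_upto X n f : A := \sum_(k < n) pc (invfact k) * iter k X f.

Lemma exps_uptoE X n f d : nilop X -> (fg d < n)%N -> exps X f d = exps_upto X n f d.
Proof.
move=> [Xa Xr] dn; rewrite /exps /exps_upto sumE.
under [RHS]eq_bigr => k _ do rewrite pcE.
rewrite -!(big_mkord xpredT (fun k => invfact k * iter k X f d)).
rewrite [RHS](big_cat_nat (n := (fg d).+1)) //= [X in _ + X]big_nat_cond.
rewrite [X in _ + X]big1 ?addr0 // => k /andP[/andP[kd _] _].
by rewrite (@iter_F _ _ X Xr k) ?mulr0.
Qed.

Lemma F_exps_upto X n f : nilop X -> F n (exps X f - exps_upto X n f).
Proof. by move=> hX d dn; rewrite subE (exps_uptoE (n := n)) // subrr. Qed.

Lemma exps_zmod X : nilop X -> zmod_morphism (exps X).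
Proof.
move=> [Xa _] f g; apply/funext => d; rewrite subE /exps -sumrB.
by apply: eq_bigr => k _; rewrite iter_zmod // subE mulrBr.
Qed.

Lemma exps_sub_id X f d : nilop X ->
  (exps X f - f) d = \sum_(k < fg d) invfact k.+1 * iter k.+1 X f d.
Proof.
move=> _; rewrite subE /exps big_ord_recl /invfact fact0 invr1 mul1r /=.
by rewrite addrAC subrr add0r.
Qed.

Lemma exps_raises X m : nilop X -> raises m X -> (0 < m)%N ->
  raises m (fun f => exps X f - f).
Proof.
move=> hX Xm m0 n f hf d dn; rewrite exps_sub_id // big1 // => k _.
rewrite (iter_raises (k := k.+1) Xm hf) ?mulr0 //; apply: leq_trans dn _.
by rewrite leq_add2l mulSn leq_addr.
Qed.

(** The terms of exp X f after f + X f contain X f and at least one more X. *)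
Lemma exps_second X m n f : nilop X -> raises m X -> F n (X f) ->
  F (n + m) (exps X f - f - X f).
Proof.
move=> hX Xm hf d dn; rewrite subE exps_sub_id //.
case E : (fg d) => [|k].
  have dn0 : (fg d < n + m)%N := dn.
  rewrite big_ord0 sub0r; case: (posnP n) => [n0|n0]; last first.
    by rewrite hf ?oppr0 // -/(fg d) E.
  have Xr := proj2 hX; have := Xr 0%N f (Fil0 _); rewrite add0n => ->; rewrite ?oppr0 //.
  by rewrite -/(fg d) E.
rewrite big_ord_recl /invfact invr1 mul1r /= addrAC subrr add0r big1 // => j _.
have -> : X (iter (bump 0 j) X f) = iter j.+1 X (X f) by rewrite -iterSr.
rewrite (iter_raises (k := j.+1) Xm hf) ?mulr0 //; apply: leq_trans dn _.
by rewrite leq_add2l mulSn leq_addr.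
Qed.

Lemma exps_zero X f (S : exponent N -> Prop) :
  (forall g, (forall d, S d -> g d = 0) -> (forall d, S d -> X g d = 0)) ->
  (forall d, S d -> f d = 0) -> forall d, S d -> exps X f d = 0.
Proof.
move=> h hf d Sd; rewrite /exps big1 // => k _.
have itz j : forall d', S d' -> iter j X f d' = 0.
  by elim: j => // j IH; apply: h.
by rewrite itz ?mulr0.
Qed.

Lemma exps_fixed X f : nilop X -> X f = 0 -> exps X f = f.
Proof.
move=> [Xa _] h; apply/funext => d; rewrite /exps big_ord_recl big1 ?addr0.
  by rewrite /invfact invr1 mul1r.
have X0 := zm0 Xa.
move=> k _; have -> : iter (lift ord0 k) X f = iter k X (X f) by rewrite -iterSr.
rewrite h; have -> : iter k X 0 = 0 by elim: (nat_of_ord k) => //= j ->.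
by rewrite zeroE mulr0.
Qed.

(** A Leibniz rule X p(f, g) = p(L f, g) + p(f, M g) gives, by the binomial
    formula for its iterates, the same rule for exponentials. With p the product
    it makes exponentials of derivations multiplicative; with p(v, f) = D v f it
    says that exp (ad Y) on fields is conjugation by exp (- D Y). *)
Lemma exps_pair X L M (p : A -> A -> A) : nilop X -> nilop L -> nilop M ->
  (forall f, zmod_morphism (p f)) -> (forall g, zmod_morphism (p^~ g)) ->
  (forall n m f g, F n f -> F m g -> F (n + m).-1 (p f g)) ->
  (forall f g, X (p f g) = p (L f) g + p f (M g)) ->
  forall f g, exps X (p f g) = p (exps L f) (exps M g).
Proof.
move=> hX hL hM pr pl pF XP f g; apply: F_eq => n.
pose T j l := p (iter j L f) (iter l M g).
have pDr h u v : p h (u + v) = p h u + p h v by exact: zmD.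
have pDl h u v : p (u + v) h = p u h + p v h by exact: (zmD _ _ (pl h)).
have p0r h : p h 0 = 0 by exact: zm0.
have p0l h : p 0 h = 0 by exact: (zm0 (pl h)).
have pnl k u v : p (k%:R * u) v = k%:R * p u v.
  by elim: k => [|k IH]; rewrite ?mul0r // !mulrSr !mulrDl !mul1r pDl IH.
have pnr k u v : p u (k%:R * v) = k%:R * p u v.
  by elim: k => [|k IH]; rewrite ?mul0r // !mulrSr !mulrDl !mul1r pDr IH.
have invn k u : k`!%:R * (pc (invfact k) * u) = u :> A.
  by rewrite mulrA natr_pc -rmorphM /= divff ?rmorph1 ?mul1r // pnatr_eq0 -lt0n fact_gt0.
have invn' k u : pc (invfact k) * (k`!%:R * u) = u :> A by rewrite mulrCA invn.
have pfl k u v : p (pc (invfact k) * u) v = pc (invfact k) * p u v.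
  by rewrite -{2}(invn k u) pnl invn'.
have pfr k u v : p u (pc (invfact k) * v) = pc (invfact k) * p u v.
  by rewrite -{2}(invn k v) pnr invn'.
pose K := n.+1.
have suml (r : seq 'I_K) (P : pred 'I_K) H v : p (\sum_(i <- r | P i) H i) v = \sum_(i <- r | P i) p (H i) v.
  by apply: (big_morph (p^~ v)).
have sumr u (r : seq 'I_K) (P : pred 'I_K) H : p u (\sum_(i <- r | P i) H i) = \sum_(i <- r | P i) p u (H i).
  by apply: (big_morph (p u)).
have X0 : X 0 = 0 := zm0 hX.1.
have XD u v : X (u + v) = X u + X v by exact: zmD hX.1.
pose U j l := pc (invfact j) * (pc (invfact l) * T j l).
have left : exps_upto X K (p f g) = \sum_(j < K) \sum_(l < K | (j + l < K)%N) U j l.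
  rewrite -sum_antidiagonals; apply: eq_bigr => k _.
  have XT j l : X (T j l) = T j.+1 l + T j l.+1 by rewrite /T XP.
  rewrite (@iter_leibniz _ T _ X0 XD XT) mulr_sumr; apply: eq_bigr => j _.
  rewrite /U mulrA -rmorphM /= -[_ *+ _]mulr_natl natr_pc mulrA -rmorphM; congr (pc _ * _).
  rewrite /invfact -invfM -natrM; apply: (@mulfI _ (k`!%:R)).
    by rewrite pnatr_eq0 -lt0n fact_gt0.
  rewrite mulrA divff ?mul1r; last by rewrite pnatr_eq0 -lt0n fact_gt0.
  apply: (@mulIf _ ((j`! * (k - j)`!)%:R)).
    by rewrite pnatr_eq0 -lt0n muln_gt0 !fact_gt0.
  rewrite mulfVK -?natrM ?bin_fact //; first by rewrite -ltnS ltn_ord.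
  by rewrite pnatr_eq0 -lt0n muln_gt0 !fact_gt0.
have right : p (exps_upto L K f) (exps_upto M K g) = \sum_(j < K) \sum_(l < K) U j l.
  rewrite /exps_upto suml; apply: eq_bigr => j _; rewrite sumr.
  by apply: eq_bigr => l _; rewrite pfl pfr.
apply: (Fil_trans (g := exps_upto X K (p f g))).
  by apply: Fil_le (F_exps_upto (n := K) _ hX).
apply: FilBC; apply: (Fil_trans (g := p (exps_upto L K f) (exps_upto M K g))).
  rewrite -[p _ _](subrK (p (exps_upto L K f) (exps M g))) -pl -addrA -pr.
  apply: FilD.
    by have := pF K 0%N _ _ (F_exps_upto (n := K) f hL) (Fil0 (exps M g)); rewrite addn0.
  by have := pF 0%N K _ _ (Fil0 (exps_upto L K f)) (F_exps_upto (n := K) g hM).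
rewrite left right -sumrB; apply: Fil_sum => j _.
rewrite [X in X - _](bigID (fun l : 'I_K => (j + l < K)%N)) /= addrAC subrr add0r.
apply: Fil_sum => l; rewrite -leqNgt => jl; apply: FilMl; apply: FilMl.
have := pF j l _ _ (@iter_F _ _ L hL.2 j f) (@iter_F _ _ M hM.2 l g).
by apply: Fil_le; move: jl; rewrite /K; lia.
Qed.

End Exp.

(** * Substitution *)

Section Homomorphisms.
Context {R : realType} {N : nat}.
Local Notation A := (psr R N).
Implicit Types (f g v : A) (d x y : exponent N).

(** Series in the parameters alone; the derivations of fields kill them. *)
Definition pure f : Prop := forall d, sdeg d != 0%N -> f d = 0.

(** Endomorphisms of the algebra of series; preserving every order makes them
    continuous. *)
Record shom (Phi : A -> A) : Prop := Hom {
  hom_zmod : zmod_morphism Phi;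
  homM : forall f g, Phi (f * g) = Phi f * Phi g;
  hom_pc : forall c, Phi (pc c) = pc c;
  homF : forall n f, F n f -> F n (Phi f) }.

Section HomTheory.
Variables (Phi : A -> A) (hP : shom Phi).

Lemma homB f g : Phi (f - g) = Phi f - Phi g. Proof. exact: hom_zmod. Qed.
Lemma hom0 : Phi 0 = 0. Proof. exact/zm0/hom_zmod. Qed.
Lemma homN f : Phi (- f) = - Phi f. Proof. exact/zmN/hom_zmod. Qed.
Lemma homD f g : Phi (f + g) = Phi f + Phi g. Proof. exact/zmD/hom_zmod. Qed.
Lemma hom1 : Phi 1 = 1.
Proof. by rewrite -(rmorph1 pc) hom_pc. Qed.
Lemma homX f k : Phi (f ^+ k) = Phi f ^+ k.
Proof. by elim: k => [|k IH]; rewrite ?expr0 ?hom1 // !exprS (homM hP) IH. Qed.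
Lemma hom_sum I (r : seq I) (P : pred I) (G : I -> A) :
  Phi (\sum_(i <- r | P i) G i) = \sum_(i <- r | P i) Phi (G i).
Proof. by apply: (big_morph Phi); [apply: homD|apply: hom0]. Qed.
Lemma hom_congF n f g : F n (f - g) -> F n (Phi f - Phi g).
Proof. by rewrite -homB; apply: homF. Qed.
End HomTheory.

Lemma hom_near Phi Psi m : shom Phi -> shom Psi ->
  (forall s, F m (Phi (var s) - Psi (var s))) -> forall f, F m (Phi f - Psi f).
Proof.
move=> hP hQ hv; apply: series_ind => [c|f g hf hg|s f hf|f hf].
- by rewrite (hom_pc hP) (hom_pc hQ) subrr.
- by rewrite (homD hP) (homD hQ) opprD addrACA; apply: FilD.
- rewrite (homM hP) (homM hQ); have -> : Phi (var s) * Phi f - Psi (var s) * Psi f =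
    (Phi (var s) - Psi (var s)) * Phi f + Psi (var s) * (Phi f - Psi f) by ring.
  by apply: FilD; [exact: FilMr (hv s)|exact: FilMl hf].
- have [g hg fg] := hf m.
  apply: (Fil_trans (g := Phi g)); first exact: hom_congF.
  exact: Fil_trans hg (hom_congF hQ (FilBC fg)).
Qed.

Lemma hom_ext Phi Psi : shom Phi -> shom Psi ->
  (forall s, Phi (var s) = Psi (var s)) -> forall f, Phi f = Psi f.
Proof.
move=> hP hQ hv f; apply: F_eq => m; apply: hom_near => // s.
by rewrite hv subrr.
Qed.

Lemma hom_comp Phi Psi : shom Phi -> shom Psi -> shom (Phi \o Psi).
Proof.
move=> hP hQ; split=> [f g|f g|c|n f hf] /=.
- by rewrite (hom_zmod hQ) (hom_zmod hP).
- by rewrite (homM hQ) (homM hP).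
- by rewrite !hom_pc.
- by apply: homF => //; apply: homF.
Qed.

(** Derivations along a homomorphism are determined by the variables, again by
    density. This is how fields are shown to be related by a substitution. *)
Lemma hom_deriv_ext (Phi : A -> A) (d1 d2 : A -> A) (k : nat) : shom Phi ->
  zmod_morphism d1 -> zmod_morphism d2 ->
  (forall c, d1 (pc c) = 0) -> (forall c, d2 (pc c) = 0) ->
  (forall f g, d1 (f * g) = d1 f * Phi g + Phi f * d1 g) ->
  (forall f g, d2 (f * g) = d2 f * Phi g + Phi f * d2 g) ->
  (forall n f, F n f -> F (n - 1) (d1 f)) -> (forall n f, F n f -> F (n - 1) (d2 f)) ->
  (forall s, F k (d1 (var s) - d2 (var s))) -> forall f, F k (d1 f - d2 f).
Proof.
move=> hP z1 z2 c1 c2 m1 m2 F1 F2 hv.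
apply: series_ind => [c|f g hf hg|s f hf|f hf].
- by rewrite c1 c2 subrr.
- by rewrite (zmD _ _ z1) (zmD _ _ z2) opprD addrACA; apply: FilD.
- have -> : d1 (var s * f) - d2 (var s * f) =
    (d1 (var s) - d2 (var s)) * Phi f + Phi (var s) * (d1 f - d2 f).
    by rewrite m1 m2; ring.
  by apply: FilD; [exact: FilMr (hv s)|exact: FilMl hf].
- have [g hg fg] := hf k.+1.
  have h1 := F1 _ _ fg; have h2 := F2 _ _ (FilBC fg).
  rewrite subn1 /= in h1 h2; rewrite z1 in h1; rewrite z2 in h2.
  exact: Fil_trans h1 (Fil_trans hg h2).
Qed.

Lemma pure_pc c : pure (pc c).
Proof.
by move=> d; rewrite /pc; case: (d =P e0) => // ->; rewrite /sdeg !ffunE.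
Qed.

Lemma pureD f g : pure f -> pure g -> pure (f + g).
Proof. by move=> hf hg d dn; rewrite addE hf ?hg ?addr0. Qed.

Lemma pureN f : pure f -> pure (- f).
Proof. by move=> hf d dn; rewrite oppE hf ?oppr0. Qed.

Lemma pureM f g : pure f -> pure g -> pure (f * g).
Proof.
move=> hf hg d dn; rewrite mulE big1_seq // => x /andP[_]; rewrite mem_below => xd.
have [x0|x0] := eqVneq (sdeg x) 0%N; last by rewrite hf ?mul0r.
rewrite [X in _ * X]hg ?mulr0 //; apply: contraNneq dn => h.
by move: h x0; rewrite -(esubKC xd) eaddKl /sdeg !ffunE; lia.
Qed.

Lemma pureX f k : pure f -> pure (f ^+ k).
Proof.
move=> h; elim: k => [|k IH]; last by rewrite exprS; apply: pureM.
by rewrite expr0 -(rmorph1 pc); apply: pure_pc.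
Qed.

Lemma pure_var i : pure (var (imu i) : A).
Proof.
move=> d; rewrite /var /svar /smonomial; case: (d =P expo1 (imu i)) => // ->.
by rewrite /sdeg !ffunE.
Qed.

Lemma pure_D v f : pure f -> D v f = 0.
Proof.
move=> hf; have h s : s = iz \/ s = iw -> pd s f = 0.
  move=> hs; apply/funext => d; rewrite /pd /sderiv hf ?mulr0 //.
  by rewrite /sdeg !ffunE; case: hs => ->; rewrite eqxx; lia.
by rewrite /D !h ?mulr0 ?addr0; auto.
Qed.

End Homomorphisms.

Section Subst.
Context {R : realType} {N : nat}.
Local Notation A := (psr R N).
Implicit Types (f g : A) (d x y : exponent N) (phi : 'I_(2 + N) -> A).

Definition subst phi f : A := ssubst phi f.
Definition pw phi x : A := \prod_s phi s ^+ x s.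

Lemma sexpE f k : sexp f k = f ^+ k.
Proof. by elim: k => [|k IH] //; rewrite exprS -IH. Qed.

Lemma Fil_pw wt phi x : (forall s, Fil wt (wt s) (phi s)) ->
  Fil wt (wdeg wt x) (pw phi x).
Proof.
move=> h; rewrite /pw /wdeg; elim/big_ind2: _ => //; first by move=> *; apply: FilM.
by move=> s _; rewrite mulnC; apply: FilX.
Qed.

Lemma pwD phi x y : pw phi (eadd x y) = pw phi x * pw phi y.
Proof.
by rewrite /pw -big_split; apply: eq_bigr => s _; rewrite ffunE exprD.
Qed.

Lemma pw_expo1 phi s : pw phi (expo1 s) = phi s.
Proof.
rewrite /pw (bigD1 s) //= ffunE eqxx expr1 big1 ?mulr1 // => t /negbTE.
by rewrite ffunE => ->; rewrite expr0.
Qed.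

Lemma pw0 phi : pw phi e0 = 1.
Proof. by rewrite /pw big1 // => s _; rewrite ffunE expr0. Qed.

Lemma wdeg1 d : wdeg (fun=> 1%N) d = tdeg d.
Proof.
rewrite /wdeg sum_slots /tdeg /sdeg /pdeg !mul1n; congr (_ + _)%N.
by apply: eq_bigr => i _; rewrite mul1n.
Qed.

Section Fixed.
Variable phi : 'I_(2 + N) -> A.
Hypothesis hphi : forall s, F (wa s) (phi s).

Let pw_tdeg x d : (tdeg d < tdeg x)%N -> pw phi x d = 0.
Proof.
have h s : Fil (fun=> 1%N) 1 (phi s).
  move=> y y1; apply: hphi; rewrite (_ : y = e0) ?wdeg0 ?wa_gt0 //.
  apply/ffunP => t; rewrite ffunE; move: y1 (exp_le_tdeg y t); rewrite wdeg1.
  by rewrite ltnS leqn0 => /eqP ->; rewrite leqn0 => /eqP ->.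
by have := Fil_pw (x := x) h; rewrite -!wdeg1; apply.
Qed.

Lemma substE M f d : (tdeg d <= M)%N ->
  subst phi f d = \sum_(x <- box M) f x * pw phi x d.
Proof.
move=> dM; rewrite /subst /ssubst.
transitivity (\sum_(x <- box (tdeg d)) f x * pw phi x d).
  rewrite /box big_map; apply: eq_bigr => a _; congr (_ * _ d).
  by apply: eq_bigr => s _; rewrite sexpE ffunE.
apply: eq_big_supp; rewrite ?box_uniq // => x xn.
have xd : (tdeg x <= tdeg d)%N.
  by rewrite leqNgt; apply: contraNN xn => /pw_tdeg ->; rewrite mulr0.
rewrite !mem_box; transitivity true; last symmetry; apply/forallP => s.
  exact: leq_trans (exp_le_tdeg x s) _.
exact: leq_trans (exp_le_tdeg x s) (leq_trans _ dM).
Qed.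

Lemma subst_zmod : zmod_morphism (subst phi).
Proof.
move=> f g; apply/funext => d; rewrite subE !(substE (M := tdeg d)) // -sumrB.
by apply: eq_bigr => x _; rewrite subE mulrBl.
Qed.

Lemma Fil_subst wt n f : (forall s, Fil wt (wt s) (phi s)) ->
  Fil wt n f -> Fil wt n (subst phi f).
Proof.
move=> h hf d dn; rewrite (substE (M := tdeg d)) // big1 // => x _.
case: (ltnP (wdeg wt x) n) => [/hf ->|nx]; first by rewrite mul0r.
by rewrite (Fil_pw (x := x) h) ?mulr0 //; apply: leq_trans nx.
Qed.

Lemma subst_pc c : subst phi (pc c) = pc c.
Proof.
apply/funext => d; rewrite (substE (M := tdeg d)) //.
rewrite (bigD1_seq e0) ?box_uniq ?mem_box //=; last by apply/forallP => s; rewrite ffunE.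
rewrite {1}/pc eqxx pw0 oneE big1 ?addr0; last first.
  by move=> x /negbTE h; rewrite /pc h mul0r.
by rewrite /pc; case: eqP; rewrite ?mulr1 ?mulr0.
Qed.

Lemma subst_varM s f : subst phi (var s * f) = phi s * subst phi f.
Proof.
apply/funext => d; pose M := tdeg d.
rewrite mulE (substE (M := M.+1)) //.
transitivity (\sum_(y <- box M) f y * pw phi (eadd (expo1 s) y) d).
  rewrite (bigID (fun x : exponent N => 0 < x s)%N) /= [X in _ + X]big1 ?addr0; last first.
    by move=> x /negbTE h; rewrite varE h mul0r.
  rewrite -big_filter.
  have -> : \sum_(y <- box M) f y * pw phi (eadd (expo1 s) y) d =
    \sum_(x <- map (eadd (expo1 s)) (box M)) (var s * f) x * pw phi x d.
    by rewrite [RHS]big_map; apply: eq_bigr => y _; rewrite varE_add.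
  apply: eq_big_supp; first exact/filter_uniq/box_uniq.
    by rewrite (map_inj_uniq (@eaddI _ _)) box_uniq.
  move=> x xn; rewrite mem_filter mem_box.
  have xd : (tdeg x <= tdeg d)%N.
    by rewrite leqNgt; apply: contraNN xn => /pw_tdeg ->; rewrite mulr0.
  have xs : (0 < x s)%N.
    by rewrite lt0n; apply: contraNneq xn => xs; rewrite varE xs mul0r.
  rewrite xs /=; transitivity true; last symmetry.
    by apply/forallP => t; apply: leq_trans (exp_le_tdeg x t) (leqW xd).
  apply/mapP; exists (esub x (expo1 s)); last by rewrite esubKC // ele_expo1.
  rewrite mem_box; apply/forallP => t; rewrite ffunE.
  apply: leq_trans (leq_subr _ _) (leq_trans (exp_le_tdeg x t) xd).
under eq_bigr => y _ do rewrite pwD pw_expo1 mulE mulr_sumr.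
rewrite exchange_big /= big_seq [RHS]big_seq; apply: eq_bigr => x.
rewrite mem_below => xd; rewrite (substE (M := M)) ?mulr_sumr.
  by apply: eq_bigr => y _; rewrite mulrCA.
by rewrite /M -!wdeg1; apply: wdeg_le; apply: ele_sub.
Qed.

Lemma subst_var s : subst phi (var s) = phi s.
Proof. by rewrite -[var s]mulr1 subst_varM -(rmorph1 pc) subst_pc rmorph1 mulr1. Qed.

Let F_subst n f : F n f -> F n (subst phi f).
Proof. exact: Fil_subst. Qed.

Lemma substM f g : subst phi (f * g) = subst phi f * subst phi g.
Proof.
have sD u v : subst phi (u + v) = subst phi u + subst phi v by exact/zmD/subst_zmod.
have cM c h : subst phi (pc c * h) = pc c * subst phi h.
  apply/funext => d; rewrite pcE !(substE (M := tdeg d)) // mulr_sumr.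
  by apply: eq_bigr => x _; rewrite pcE mulrA.
move: f; apply: series_ind => [c|f1 f2 h1 h2|s f h|f h].
- by rewrite cM subst_pc.
- by rewrite mulrDl !sD h1 h2 mulrDl.
- by rewrite -mulrA !subst_varM h mulrA.
- apply: F_eq => n; have [f' hf' ff'] := h n.
  apply: (Fil_trans (g := subst phi (f' * g))).
    by rewrite -subst_zmod -mulrBl; apply: F_subst; apply: FilMr.
  by rewrite hf' -mulrBl -subst_zmod; apply: FilMr; apply: F_subst; apply: FilBC.
Qed.

Lemma hom_subst : shom (subst phi).
Proof.
by split; [apply: subst_zmod|apply: substM|apply: subst_pc|apply: F_subst].
Qed.

Lemma pure_subst f : (forall i, pure (phi (imu i))) -> pure f -> pure (subst phi f).
Proof.
move=> h hf d dn; rewrite (substE (M := tdeg d)) // big1 // => x _.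
have [x0|x0] := eqVneq (sdeg x) 0%N; last by rewrite hf ?mul0r.
rewrite [X in _ * X](_ : _ = 0) ?mulr0 //.
suff : pure (pw phi x) by apply.
have hz : x iz = 0%N by move: x0; rewrite /sdeg; lia.
have hw : x iw = 0%N by move: x0; rewrite /sdeg; lia.
rewrite /pw; apply: (big_ind pure) => [||s _].
- by rewrite -(rmorph1 pc); apply: pure_pc.
- exact: pureM.
- case: (slotP s) => [->|->|[i ->]]; last exact: pureX.
    by rewrite hz expr0 -(rmorph1 pc); apply: pure_pc.
  by rewrite hw expr0 -(rmorph1 pc); apply: pure_pc.
Qed.

(** Both sides are endomorphisms that agree on the variables. *)
Lemma subst_cs f : cs (phi iz) = phi iw -> (forall i, cs (phi (imu i)) = phi (imu i)) ->
  subst phi (cs f) = cs (subst phi f).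
Proof.
move=> hz hm; have hw : cs (phi iw) = phi iz by rewrite -hz csK.
pose G f := cs (subst phi (cs f)).
suff h : forall f, G f = subst phi f by rewrite -h /G csK.
apply: hom_ext; last 1 first.
- move=> s; rewrite /G; case: (slotP s) => [->|->|[i ->]];
  by rewrite cs_var !subst_var ?hz ?hw ?hm.
- split=> [u v|u v|c|n u hu]; rewrite /G.
  + by rewrite rmorphB subst_zmod rmorphB.
  + by rewrite rmorphM substM rmorphM.
  + by rewrite cs_pc subst_pc cs_pc conjcK.
  + by apply/F_cs/F_subst/F_cs.
- exact: hom_subst.
Qed.

End Fixed.
End Subst.

(** * Vector fields and near-identity transformations *)

Section VectorFields.
Context {R : realType} {N : nat}.
Local Notation A := (psr R N).
Local Notation C := R[i].
Local Notation transf := (@transformation R N).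
Implicit Types (f g u v w Y : A) (d x y : exponent N).

Definition ci : C := ('i)%C.
Lemma ci2 : ci * ci = -1. Proof. by have := sqr_i R; rewrite expr2. Qed.
Lemma conj_ci : (ci^*)%C = - ci.
Proof. by apply/eqP; rewrite eq_complex /= oppr0 !eqxx. Qed.
Lemma ci_neq0 : ci != 0.
Proof. by rewrite eq_complex /= oner_eq0 andbF. Qed.

Definition ws : 'I_(2 + N) -> nat := coords 1%N 1%N (fun=> 0%N).
Lemma wsE d : wdeg ws d = sdeg d.
Proof.
rewrite /wdeg sum_slots /ws !coordsE !mul1n big1 ?addn0 // => i _.
by rewrite coordsE.
Qed.

Lemma Fil_D wt n m v f : wt iz = 1%N -> wt iw = 1%N ->
  Fil wt n v -> Fil wt m f -> Fil wt (n + m).-1 (D v f).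
Proof.
move=> hz hw hv hf; apply: FilD.
  by apply: Fil_le (FilM hv (Fil_pd (s := iz) hf)); lia.
have hc : Fil wt n (cs v) by apply: Fil_cs => //; rewrite hz hw.
by apply: Fil_le (FilM hc (Fil_pd (s := iw) hf)); lia.
Qed.

(** Fields of grade at least n: a field of grade n has order n + 1 as a series,
    and it vanishes at the origin for every value of the parameters. *)
Definition Lf n v : Prop := Fil ws 1 v /\ F n.+1 v.

Lemma Lf0P v : Fil ws 1 v -> Lf 0 v.
Proof.
move=> h; split=> // d dn; apply: h; rewrite wsE.
by move: dn; rewrite -/(fg d) fgE; lia.
Qed.

Lemma Lf_le n m v : (n <= m)%N -> Lf m v -> Lf n v.
Proof. by move=> nm [h1 h2]; split=> //; apply: Fil_le h2. Qed.

Lemma LfD n u v : Lf n u -> Lf n v -> Lf n (u + v).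
Proof. by move=> [? ?] [? ?]; split; apply: FilD. Qed.
Lemma LfM n m f v : F n f -> Lf m v -> Lf (n + m) (f * v).
Proof. by move=> hf [h1 h2]; split; [apply: FilMl|rewrite -addnS; apply: FilM]. Qed.

Lemma fg_grade d : (0 < sdeg d)%N -> fg d = (grade d).+1.
Proof. by rewrite fgE /grade => h; lia. Qed.

Lemma weight_gt0 : (0 < @weight N)%N. Proof. by []. Qed.

Lemma vcoef_neq0 f b : vcoef f b != 0 -> f b.2 != 0.
Proof. by apply: contraNneq; rewrite /vcoef => ->; case: b.1. Qed.

Lemma vcoef_exists f d : f d != 0 -> exists b, vcoef f (b, d) != 0.
Proof.
rewrite eq_complex negb_and => /orP[h|h]; first by exists false.
by exists true.
Qed.

Lemma filtLP n f : (1 <= n)%N -> filtL n f <-> Lf n f.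
Proof.
move=> n1; split=> [h|[h1 h2] b /vcoef_neq0 fb].
  have hd d : f d != 0 -> (0 < sdeg d)%N /\ (n <= grade d)%N.
    move=> /vcoef_exists[b /h [/= val ng]]; split=> //.
    case/orP: val => [/andP[]//|/eqP[_ ->]].
    by rewrite /sdeg !ffunE eqxx.
  split=> d dn; apply/eqP; apply: contraTT dn => /hd [s0 ng]; rewrite -leqNgt.
    by rewrite wsE.
  by rewrite -/(fg d) fg_grade.
have s0 : (0 < sdeg b.2)%N.
  by rewrite lt0n; apply: contraNneq fb => s0; rewrite h1 // wsE s0.
have ng : (n <= grade b.2)%N.
  rewrite leqNgt; apply: contraNN fb => gn; apply/eqP/h2.
  by rewrite -/(fg b.2) fg_grade.
split=> //; rewrite /valid s0 /=; apply/orP; left.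
move: ng; rewrite /grade /tdeg; case: (posnP (pdeg b.2)) => [->|]; lia.
Qed.

Lemma filtL0 f : filtL 0 f -> Lf 0 f.
Proof.
move=> h; apply: Lf0P => d; rewrite wsE ltnS leqn0 => /eqP s0.
apply/eqP; apply: contraTT isT => /vcoef_exists[b /h [/= val _]].
case/orP: val => [|/eqP[_ dz]]; first by rewrite s0.
by move: s0; rewrite dz /sdeg !ffunE eqxx.
Qed.

Lemma Lf_bracket n m u v : Lf n u -> Lf m v -> Lf (n + m) (bracket u v).
Proof.
move=> [u1 u2] [v1 v2]; rewrite bracketE; split; apply: FilB.
- by apply: Fil_le (Fil_D _ _ v1 u1); rewrite // /ws coordsE.
- by apply: Fil_le (Fil_D _ _ u1 v1); rewrite // /ws coordsE.
- by apply: Fil_le (F_D v2 u2); lia.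
- by apply: Fil_le (F_D u2 v2); lia.
Qed.

Lemma bracket_zmod u : zmod_morphism (@bracket R N u : A -> A).
Proof. by move=> v w; rewrite !bracketE DBl raddfB /=; ring. Qed.

Lemma bracket_raises n u : F n.+1 u -> raises n (@bracket R N u : A -> A).
Proof.
move=> h k v hv; rewrite bracketE; apply: FilB.
  by apply: Fil_le (F_D hv h); lia.
by apply: Fil_le (F_D h hv); lia.
Qed.

Lemma D_raises n u : F n.+1 u -> raises n (D u).
Proof. by move=> h k v hv; apply: Fil_le (F_D h hv); lia. Qed.

Lemma raises_le n m (X : A -> A) : (n <= m)%N -> raises m X -> raises n X.
Proof. by move=> nm h k f hf; apply: Fil_le (h k f hf); rewrite leq_add2l. Qed.

Lemma bracket_nilop u : F 2 u -> nilop (@bracket R N u : A -> A).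
Proof. by move=> h; split; [apply: bracket_zmod|apply: bracket_raises]. Qed.

Lemma D_nilop u : F 2 u -> nilop (D u).
Proof. by move=> h; split; [exact: raddfB|apply: D_raises]. Qed.

Lemma bracket_ws u v : Fil ws 1 u -> Fil ws 1 v -> Fil ws 1 (bracket u v : A).
Proof. by move=> hu hv; have [] := Lf_bracket (Lf0P hu) (Lf0P hv). Qed.

(** The series at the coefficient d is cut at the grade of d in one case and at
    its degree in the other; the extra term vanishes since fields of positive
    grade raise the order. *)
Lemma phiS_exps Y u : Lf 1 Y -> Lf 0 u -> phiS Y u = exps (@bracket R N Y : A -> A) u.
Proof.
move=> [Y1 Y2] [u1 u2]; have hX := bracket_nilop Y2.
have itw k : Fil ws 1 (iter k (@bracket R N Y : A -> A) u).
  by elim: k => //= k IH; apply: bracket_ws.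
apply/funext => d; rewrite /phiS /exps.
case: (posnP (sdeg d)) => [s0|s0].
  rewrite !big1 // => k _; have h : (wdeg ws d < 1)%N by rewrite wsE s0.
    by rewrite (itw k) ?mulr0.
  by have -> : iter k (bracket Y) u d = 0 by [apply: (itw k)]; rewrite mulr0.
rewrite fg_grade // [RHS]big_ord_recr /=.
have -> : bracket Y (iter (grade d) (@bracket R N Y : A -> A) u) d = 0.
  have := @iter_raises _ _ _ 1 (grade d).+1 hX.2 _ _ u2; apply.
  by rewrite muln1 -/(fg d) fg_grade.
by rewrite mulr0 addr0.
Qed.

Lemma phiS_near n Y u : (1 <= n)%N -> Lf n Y -> Lf 0 u -> Lf n (phiS Y u - (u : A)).
Proof.
move=> n1 hY hu; have hY1 := Lf_le n1 hY; rewrite phiS_exps //.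
have hX := bracket_nilop hY1.2; split.
  apply: FilB; last exact: hu.1.
  apply: (exps_zero (S := fun d => (wdeg ws d < 1)%N)) hu.1 => g hg.
  exact: bracket_ws hY1.1 hg.
by have := exps_raises hX (bracket_raises hY.2) n1 hu.2.
Qed.

Lemma pw_var x : pw (fun s => var s : A) x = mono x.
Proof.
have [m] := ubnP (tdeg x); elim: m x => // m IH x xm.
have [x0|[s xs]] : x = e0 \/ exists s, (0 < x s)%N.
  case: (pickP (fun s => 0 < x s)%N) => [s xs|h]; first by right; exists s.
  by left; apply/ffunP => s; rewrite ffunE; have := h s; case: (x s).
- by rewrite x0 pw0 mono0.
- rewrite -(@esubKC _ (expo1 s) x) ?ele_expo1 // monoD pwD pw_expo1 IH //.
  suff : (tdeg (esub x (expo1 s)) < tdeg x)%N by lia.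
  rewrite -!wdeg1 -[X in (_ < wdeg _ X)%N](@esubKC _ (expo1 s) x) ?ele_expo1 //.
  by rewrite wdegD wdeg_expo1.
Qed.

Lemma pw_diff n (phi psi : 'I_(2 + N) -> A) x :
  (forall s, F (wa s) (phi s)) -> (forall s, F (wa s) (psi s)) ->
  (forall s, (0 < x s)%N -> F (wa s + n) (phi s - psi s)) ->
  F (fg x + n) (pw phi x - pw psi x).
Proof.
have [m] := ubnP (tdeg x); elim: m x => // m IH x xm h1 h2 h3.
have [x0|[s xs]] : x = e0 \/ exists s, (0 < x s)%N.
  case: (pickP (fun s => 0 < x s)%N) => [s xs|h]; first by right; exists s.
  by left; apply/ffunP => s; rewrite ffunE; have := h s; case: (x s).
  by rewrite x0 !pw0 subrr.
have ex := @esubKC _ (expo1 s) x; rewrite -ex ?ele_expo1 // !pwD !pw_expo1.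
set y := esub x (expo1 s) in ex *.
have hy : F (fg y + n) (pw phi y - pw psi y).
  apply: IH => // [|t yt]; last by apply: h3; move: yt; rewrite /y ffunE; lia.
  have xy : (tdeg y < tdeg x)%N by rewrite -!wdeg1 -[X in (_ < wdeg _ X)%N]ex ?ele_expo1 // wdegD wdeg_expo1.
  exact: leq_trans xy xm.
have -> : phi s * pw phi y - psi s * pw psi y
  = (phi s - psi s) * pw phi y + psi s * (pw phi y - pw psi y) by ring.
rewrite fgD /fg wdeg_expo1; apply: FilD.
  apply: Fil_le (FilM (h3 s xs) (Fil_pw (x := y) h1)); lia.
apply: Fil_le (FilM (h2 s) hy); rewrite /fg; lia.
Qed.

Lemma subst_raises n (phi : 'I_(2 + N) -> A) :
  (forall s, F (wa s + n) (phi s - var s)) -> raises n (fun f => subst phi f - f).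
Proof.
move=> h k f hf d dk.
have h1 s : F (wa s) (phi s).
  by apply: (Fil_sub (g := var s)); [apply: Fil_le (h s); rewrite leq_addr|apply: Fil_var].
have fd : f d = \sum_(x <- box (tdeg d)) f x * mono x d.
  rewrite (bigD1_seq d) ?box_uniq ?mem_box //=; last first.
    by apply/forallP => s; apply: exp_le_tdeg.
  rewrite /mono /smonomial eqxx mulr1 big1 ?addr0 // => x /negbTE.
  by rewrite eq_sym => ->; rewrite mulr0.
rewrite subE (substE h1 (M := tdeg d)) // [in X in _ - X]fd -sumrB big1 // => x _.
case: (ltnP (fg x) k) => [/hf ->|kx]; first by rewrite !mul0r subrr.
rewrite -mulrBr -pw_var -subE (@pw_diff n) ?mulr0 // => [s|].
  exact: Fil_var.
by move: dk kx; rewrite -/(fg d) -/(fg x); lia.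
Qed.

Definition sub_mu (h : 'I_N -> A) : 'I_(2 + N) -> A := coords (var iz) (var iw) h.

Lemma sub_mu_F h : (forall i, F (@weight N) (h i)) -> forall s, F (wa s) (sub_mu h s).
Proof.
move=> hh s; case: (slotP s) => [->|->|[i ->]]; rewrite wa_slots /sub_mu coordsE //.
- exact: F_varz.
- exact: F_varw.
Qed.

Lemma filtP_F n (Y : 'I_N -> A) : filtP n Y ->
  forall i, [/\ F (n + @weight N) (Y i), pure (Y i) & cs (Y i) = Y i].
Proof.
move=> h i; split=> [d dn|d ds|].
- apply/eqP; apply: contraTT dn => /h[s0 _ hp]; rewrite -leqNgt.
  by rewrite -/(fg d) fgE s0.
- by apply/eqP; apply: contraNT ds => /h[->].
- apply/funext => d; rewrite csE.
  have sds : sdeg (sw d) = sdeg d by rewrite /sdeg !swE addnC.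
  have [s0|s0] := eqVneq (sdeg d) 0%N; last first.
    have z e : sdeg e != 0%N -> Y i e = 0.
      by move=> es; apply/eqP; apply: contraNT es => /h[->].
    by rewrite !z ?sds ?rmorph0.
  have -> : sw d = d.
    by move: s0; rewrite /sdeg => s0; apply: expo_slotP => [||j]; rewrite !swE //; lia.
  have [->|/h[_ + _]] := eqVneq (Y i d) 0; first by rewrite rmorph0.
  by case: (Y i d) => a b /= ->; rewrite oppr0.
Qed.

Lemma phiPE (Y : 'I_N -> A) u :
  phiP Y u = subst (sub_mu (fun i => var (imu i) + Y i)) u.
Proof. by []. Qed.

Lemma phiP_subF n (Y : 'I_N -> A) : filtP n Y ->
  forall s, F (wa s + n) (sub_mu (fun i => var (imu i) + Y i) s - var s).
Proof.
move=> /filtP_F h s; case: (slotP s) => [->|->|[i ->]]; rewrite /sub_mu coordsE ?subrr //.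
by rewrite wa_slots addrAC subrr add0r addnC; have [] := h i.
Qed.

Lemma phiP_hom n (Y : 'I_N -> A) : filtP n Y -> shom (phiP Y : A -> A).
Proof.
move=> hY; apply: hom_subst => s.
by apply: (Fil_sub (g := var s)); [apply: Fil_le (phiP_subF hY (s := s)); lia|apply: Fil_var].
Qed.

Lemma phiP_raises n (Y : 'I_N -> A) : filtP n Y -> raises n (fun f => phiP Y f - f).
Proof. by move=> hY; apply: subst_raises; apply: phiP_subF. Qed.

Lemma phiP_ws n m (Y : 'I_N -> A) f : filtP n Y -> Fil ws m f -> Fil ws m (phiP Y f : A).
Proof.
move=> hY hf; apply: Fil_subst => // s.
  by apply: (Fil_sub (g := var s)); [apply: Fil_le (phiP_subF hY (s := s)); lia|apply: Fil_var].
have := Fil_var (wt := ws) (s := s).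
case: (slotP s) => [->|->|[i ->]]; rewrite /sub_mu /ws !coordsE // => _.
Qed.

Lemma filtR_F n (T : A) : filtR n T -> F n T.
Proof.
move=> h d dn; apply/eqP; apply: contraTT dn => /h[_ _]; rewrite -leqNgt.
by rewrite -/(fg d) fgE.
Qed.

Lemma near_step n (t : transf) u : (1 <= n)%N -> near_identity n t -> Lf 0 u ->
  Lf n (transform t u - (u : A)).
Proof.
move=> n1; case: t => [Y|T|Y|M] //= h hu.
- by apply: phiS_near => //; apply/filtLP.
- have -> : phiT T u = u + (T : A) * u by [].
  rewrite addrAC subrr add0r -[n]addn0.
  by apply: LfM => //; apply: filtR_F.
- split; first by apply: FilB; [apply: phiP_ws h _; case: hu|case: hu].
  by have := phiP_raises h hu.2.
Qed.

Lemma near_step0 n (t : transf) u : (1 <= n)%N -> near_identity n t -> Lf 0 u ->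
  Lf 0 (transform t u).
Proof.
move=> n1 ht hu; rewrite -[transform t u](subrK (u : A)); apply: LfD => //.
exact: Lf_le (near_step n1 ht hu).
Qed.

End VectorFields.

(** * Resonant series and the first level normal form *)

Section Resonance.
Context {R : realType} {N : nat}.
Local Notation A := (psr R N).
Local Notation C := R[i].
Implicit Types (f g h u v w Y : A) (d x y : exponent N).

Definition res f : Prop := forall d, d iz != d iw -> f d = 0.
Definition rl f : Prop := forall d, ((f d)^*)%C = f d.
(** The real series in Z = z w and the parameters: they are the real functions
    invariant under rotation. *)
Definition RR f : Prop := res f /\ rl f.

Lemma conjC_eq (c : C) : (c^*)%C = c <-> complex.Im c = 0.
Proof.
split=> [|h]; last first.
  by apply/eqP; case: c h => a b /= ->; rewrite oppr0.
case: c => a b /= [] /eqP; rewrite eq_sym -subr_eq0 opprK => /eqP h; lra.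
Qed.

Lemma rl_pc (c : C) : (c^*)%C = c -> rl (pc c).
Proof. by move=> hc d; rewrite /pc; case: eqP => // _; rewrite rmorph0. Qed.
Lemma rlD f g : rl f -> rl g -> rl (f + g).
Proof. by move=> hf hg d; rewrite addE rmorphD /= hf hg. Qed.
Lemma rlN f : rl f -> rl (- f).
Proof. by move=> hf d; rewrite oppE rmorphN /= hf. Qed.
Lemma rlM f g : rl f -> rl g -> rl (f * g).
Proof.
move=> hf hg d; rewrite mulE rmorph_sum; apply: eq_bigr => x _.
by rewrite rmorphM /= hf hg.
Qed.
Lemma rl_mono x : rl (mono x).
Proof. by move=> d; rewrite /mono /smonomial rmorph_nat. Qed.

Lemma res_pc c : res (pc c).
Proof. by move=> d; rewrite /pc; case: (d =P e0) => // ->; rewrite !ffunE eqxx. Qed.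
Lemma resD f g : res f -> res g -> res (f + g).
Proof. by move=> hf hg d dd; rewrite addE hf // hg // addr0. Qed.
Lemma resN f : res f -> res (- f).
Proof. by move=> hf d dd; rewrite oppE hf // oppr0. Qed.
Lemma resM f g : res f -> res g -> res (f * g).
Proof.
move=> hf hg d dd; rewrite mulE big1_seq // => x /andP[_]; rewrite mem_below => xd.
have [xx|xx] := eqVneq (x iz) (x iw); last by rewrite hf ?mul0r.
rewrite [X in _ * X]hg ?mulr0 //; apply: contraNneq dd => h.
by move: h; rewrite -(esubKC xd) eaddKl !ffunE => ->; rewrite xx.
Qed.

Lemma RR_pc (c : C) : (c^*)%C = c -> RR (pc c).
Proof. by move=> h; split; [apply: res_pc|apply: rl_pc]. Qed.
Lemma RR_real (r : R) : RR (pc r%:C%C).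
Proof. by apply: RR_pc; apply/conjC_eq. Qed.
Lemma RR0 : RR 0.
Proof. by split=> d; rewrite zeroE ?rmorph0. Qed.
Lemma RR1 : RR 1.
Proof. by rewrite -(rmorph1 pc); apply: RR_pc; rewrite rmorph1. Qed.
Lemma RRD f g : RR f -> RR g -> RR (f + g).
Proof. by move=> [? ?] [? ?]; split; [apply: resD|apply: rlD]. Qed.
Lemma RRN f : RR f -> RR (- f).
Proof. by move=> [? ?]; split; [apply: resN|apply: rlN]. Qed.
Lemma RRB f g : RR f -> RR g -> RR (f - g).
Proof. by move=> ? ?; apply: RRD => //; apply: RRN. Qed.
Lemma RRM f g : RR f -> RR g -> RR (f * g).
Proof. by move=> [? ?] [? ?]; split; [apply: resM|apply: rlM]. Qed.
Lemma RRX f k : RR f -> RR (f ^+ k).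
Proof. by move=> h; elim: k => [|k IH]; [apply: RR1|rewrite exprS; apply: RRM]. Qed.
Lemma RR_sum I (r : seq I) (P : pred I) (G : I -> A) :
  (forall i, P i -> RR (G i)) -> RR (\sum_(i <- r | P i) G i).
Proof. by move=> h; apply: (big_ind RR) => //; [apply: RR0|apply: RRD]. Qed.
Lemma RR_pd_mu i f : RR f -> RR (pd (imu i) f).
Proof.
move=> [h1 h2]; split=> d; rewrite /pd /sderiv; last by rewrite rmorphM /= rmorph_nat h2.
by move=> dd; rewrite h1 ?mulr0 // !ffunE /= !addn0.
Qed.

Definition Z : A := var iz * var iw.

Lemma RR_mono x : x iz = x iw -> RR (mono x).
Proof.
move=> hx; split; last exact: rl_mono.
move=> d dd; rewrite /mono /smonomial; case: (d =P x) => // h.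
by rewrite h hx eqxx in dd.
Qed.

Lemma RR_Z : RR Z.
Proof.
rewrite /Z /var -/(mono _) -[svar iw]/(mono (expo1 iw)) -monoD; apply: RR_mono.
by rewrite !ffunE.
Qed.

Lemma RR_mu i : RR (var (imu i)).
Proof. by apply: RR_mono; rewrite !ffunE. Qed.

Lemma RR_cs f : RR f -> cs f = f.
Proof.
move=> [h1 h2]; apply/funext => d; rewrite csE.
have [dd|dd] := eqVneq (d iz) (d iw); last by rewrite !h1 ?rmorph0 // !swE eq_sym.
have -> : sw d = d by apply: expo_slotP => [||i]; rewrite !swE // dd.
exact: h2.
Qed.

Definition Theta f : A := dg (fun d => (d iz)%:R - (d iw)%:R) f.
Definition Eul f : A := dg (fun d => (sdeg d)%:R) f.

Lemma ThetaE f d : Theta f d = ((d iz)%:R - (d iw)%:R) * f d. Proof. by []. Qed.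
Lemma EulE f d : Eul f d = (sdeg d)%:R * f d. Proof. by []. Qed.

Lemma Theta_D f : Theta f = var iz * pd iz f - var iw * pd iw f.
Proof. by rewrite !var_pd; apply/funext => d; rewrite subE /Theta /dg mulrBl. Qed.
Lemma Eul_D f : Eul f = var iz * pd iz f + var iw * pd iw f.
Proof.
by rewrite !var_pd; apply/funext => d; rewrite addE /Eul /dg /sdeg natrD mulrDl.
Qed.

Lemma ThetaM f g : Theta (f * g) = Theta f * g + f * Theta g.
Proof. by rewrite !Theta_D !pdM; ring. Qed.
Lemma EulM f g : Eul (f * g) = Eul f * g + f * Eul g.
Proof. by rewrite !Eul_D !pdM; ring. Qed.
Lemma EulD f g : Eul (f + g) = Eul f + Eul g. Proof. exact: dgD. Qed.
Lemma EulB f g : Eul (f - g) = Eul f - Eul g.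
Proof. by rewrite !Eul_D !raddfB /=; ring. Qed.
Lemma ThetaB f g : Theta (f - g) = Theta f - Theta g.
Proof. by rewrite !Theta_D !raddfB /=; ring. Qed.
Lemma ThetaD f g : Theta (f + g) = Theta f + Theta g. Proof. exact: dgD. Qed.

Lemma RR_Theta f : res f -> Theta f = 0.
Proof.
move=> h; apply/funext => d; rewrite ThetaE zeroE.
have [->|dd] := eqVneq (d iz) (d iw); first by rewrite subrr mul0r.
by rewrite h ?mulr0.
Qed.

Lemma RR_Eul f : RR f -> RR (Eul f).
Proof.
move=> [h1 h2]; split=> d; rewrite EulE; first by move=> dd; rewrite h1 ?mulr0.
by rewrite rmorphM /= rmorph_nat h2.
Qed.

Lemma F_Eul n f : F n f -> F n (Eul f). Proof. exact: Fil_dg. Qed.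
Lemma F_Theta n f : F n f -> F n (Theta f). Proof. exact: Fil_dg. Qed.

Lemma Theta_z : Theta (var iz) = var iz.
Proof. by rewrite Theta_D !pd_var eqxx /=; ring. Qed.
Lemma Eul_z : Eul (var iz) = var iz.
Proof. by rewrite Eul_D !pd_var eqxx /=; ring. Qed.
Lemma Eul_w : Eul (var iw) = var iw.
Proof. by rewrite Eul_D !pd_var eqxx /=; ring. Qed.
Lemma Eul_Z : Eul Z = 2%:R * Z.
Proof. by rewrite /Z EulM Eul_z Eul_w; ring. Qed.
Lemma Eul_ZX k : Eul (Z ^+ k) = (2 * k)%:R * Z ^+ k.
Proof.
elim: k => [|k IH]; first by rewrite expr0 Eul_D !pd1 muln0; ring.
by rewrite exprS EulM IH Eul_Z mulnS natrD; ring.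
Qed.
Lemma pure_Eul f : pure f -> Eul f = 0.
Proof.
move=> h; apply/funext => d; rewrite EulE zeroE.
have [->|dd] := eqVneq (sdeg d) 0%N; first by rewrite mul0r.
by rewrite h ?mulr0.
Qed.

(** In polar form z' = z (a + i b) is the Euler field with speed a plus the
    rotation with speed b. *)
Lemma D_zr a f : cs a = a -> D (var iz * a) f = a * Eul f.
Proof.
by move=> ha; rewrite /D rmorphM /= cs_var ha Eul_D; ring.
Qed.

Lemma cs_ci : cs (pc ci : A) = - pc ci.
Proof. by rewrite cs_pc conj_ci rmorphN. Qed.

Lemma D_zi b f : cs b = b -> D (var iz * (pc ci * b)) f = pc ci * b * Theta f.
Proof.
by move=> hb; rewrite /D !rmorphM /= cs_var hb cs_ci Theta_D; ring.
Qed.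

Lemma D_zir b a f : cs b = b -> cs a = a ->
  D (var iz * (pc ci * b + a)) f = pc ci * b * Theta f + a * Eul f.
Proof. by move=> hb ha; rewrite mulrDr DDl D_zi // D_zr. Qed.

Definition iZ : A := var iz * pc ci.

Lemma D_iZ f : D iZ f = pc ci * Theta f.
Proof. by rewrite /iZ -[pc ci]mulr1 D_zi ?rmorph1. Qed.

Lemma bracket_iZ Y : bracket Y iZ = pc ci * (Theta Y - Y) :> A.
Proof.
rewrite bracketE D_iZ /iZ DM D_pc D_var; ring.
Qed.

End Resonance.

Section FirstLevel.
Context {R : realType} {N : nat}.
Local Notation A := (psr R N).
Local Notation C := R[i].
Implicit Types (f g h u v w Y : A) (d x y : exponent N).

Lemma scaleE (c : C) (f : series R N) : c *: f = pc c * (f : A).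
Proof. exact: scale_pc. Qed.

Local Notation gproj := (@Defs.proj R N).

Definition Hopf_like v : Prop := Lf 0 v /\ F 2 (v - iZ).

(** With z = y + i x the linear part x' = y, y' = - x becomes z' = i z. *)
Lemma hopf_system_like alpha beta : Hopf_like (@hopf_system R N alpha beta).
Proof.
set phi := coords ((2%:R * ('i)%C)^-1 *: (svar iz - svar iw))
                 (2%:R^-1 *: (svar iz + svar iw)) (fun i : 'I_N => svar (imu i)) : 'I_(2 + N) -> A.
have phi_z : phi iz = pc (2%:R * ci)^-1 * (var iz - var iw).
  by rewrite /phi coordsE scaleE.
have phi_w : phi iw = pc 2%:R^-1 * (var iz + var iw).
  by rewrite /phi coordsE scaleE.
have phi_m i : phi (imu i) = var (imu i) by rewrite /phi coordsE.
have Fil_phi wt s : wt iz = wt iw -> Fil wt (wt s) (phi s).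
  move=> e; case: (slotP s) => [->|->|[i ->]].
  - rewrite phi_z; apply/FilMl/FilB; first exact: Fil_var.
    by rewrite e; apply: Fil_var.
  - rewrite phi_w; apply/FilMl/FilD; last exact: Fil_var.
    by rewrite -e; apply: Fil_var.
  - by rewrite phi_m; apply: Fil_var.
have hphi s : F (wa s) (phi s) by apply: Fil_phi; rewrite !wa_slots.
have hP := hom_subst hphi.
pose pa := perturbation alpha : A; pose pb := perturbation beta : A.
have vE : (hopf_system alpha beta : A) = subst phi (- var iz + pb + pc ci * (var iw + pa)).
  rewrite /hopf_system -/phi /ydot /xdot scaleE; congr (subst phi _).
have lin : subst phi (- var iz + pc ci * var iw) = iZ.
  rewrite (homD hP) (homN hP) (homM hP) (hom_pc hP) !(subst_var hphi) phi_z phi_w /iZ.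
  have e1 : (2%:R * ci)^-1 = - (2%:R^-1 * ci) :> C.
    by rewrite invfM -[ci^-1]mulr1 -[1]opprK -ci2 mulrN mulKf ?ci_neq0 // mulrN.
  rewrite e1 rmorphN rmorphM /=.
  have h2 : pc 2%:R^-1 * 2%:R = 1 :> A.
    by rewrite natr_pc -rmorphM /= mulVf ?rmorph1 // pnatr_eq0.
  transitivity (var iz * pc ci * (pc 2%:R^-1 * 2%:R) : A); last by rewrite h2 mulr1.
  ring.
have perF wt n a : wt iz = 1%N -> wt iw = 1%N ->
    (forall d, (1 <= sdeg d)%N -> (2 <= tdeg d)%N -> (n <= wdeg wt d)%N) ->
    Fil wt n (perturbation a : A).
  move=> ez ew h d dn; rewrite /perturbation; case: ifP => // /andP[d1 d2].
  by move: dn; rewrite ltnNge h.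
have vE2 : (hopf_system alpha beta : A) = iZ + subst phi (pb + pc ci * pa).
  by rewrite vE -lin -(homD hP); congr (subst phi _); ring.
have wsz : (@ws N) iz = 1%N /\ (@ws N) iw = 1%N by rewrite /ws !coordsE.
split.
  apply: Lf0P; rewrite vE2; apply: FilD.
    apply: FilMr; have := Fil_var (R := R) (wt := ws) (s := @iz N).
    by rewrite wsz.1.
  apply: Fil_subst => // [s|]; first by apply: Fil_phi; rewrite wsz.1 wsz.2.
  by apply: FilD; [|apply: FilMl]; apply: perF; rewrite ?wsz.1 ?wsz.2 // => d; rewrite wsE.
rewrite vE2 addrAC subrr add0r; apply: (homF hP).
have fd d : (1 <= sdeg d)%N -> (2 <= tdeg d)%N -> (2 <= wdeg wa d)%N.
  rewrite -/(fg d) fgE /tdeg => h1 h2; case: (posnP (pdeg d)) => h; first by lia.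
  by have := @weight_gt0 N; nia.
by apply: FilD; [|apply: FilMl]; apply: perF => //; rewrite wa_slots.
Qed.

Lemma proj_id n f : (forall d, f d != 0 -> grade d = n) -> gproj n f = f.
Proof.
move=> h; apply/funext => d; rewrite /Defs.proj; case: eqP => // dn; apply/esym/eqP.
by apply/negPn/negP => /h.
Qed.

Lemma proj_Lf n u : Lf n.+1 u -> gproj n u = 0.
Proof.
move=> [h1 h2]; apply/funext => d; rewrite /Defs.proj; case: eqP => // dn.
case: (posnP (sdeg d)) => [s0|s0]; first by apply: h1; rewrite wsE s0.
by apply: h2; rewrite -/(fg d) fg_grade // dn.
Qed.

Lemma projD n f g : gproj n (f + g) = (gproj n f : A) + gproj n g.
Proof.
by apply/funext => d; rewrite addE /Defs.proj; case: eqP; rewrite ?addr0.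
Qed.

Lemma selected_not_in e (W : set (series R N)) n i l :
  selected e W n i l -> ~ W (vmonomial_series (e l)).
Proof.
elim: i => //= i IH [/IH //|/= [-> _ nW] We]; apply: nW.
exists (vmonomial_series (e i)), 0; split=> //; last by rewrite addr0.
by move=> b; rewrite /vcoef /=; case: b.1; rewrite eqxx.
Qed.

Lemma vmonomial_seriesE b d :
  vmonomial_series (b, d) = pc (if b then ci else 1) * mono d :> A.
Proof. by rewrite /vmonomial_series scaleE. Qed.

Lemma dmapE v (Y : ('I_N -> A) * A * A) : dmap v Y =
  \sum_(i < N) pd (imu i) v * Y.1.1 i + Y.1.2 * v + bracket Y.2 v :> A.
Proof.
by rewrite /dmap; congr (_ + _ + _).
Qed.

Lemma filtA_state n Y : (1 <= n)%N -> Lf n Y ->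
  filtA n ((fun=> 0, 0, Y) : ('I_N -> series R N) * series R N * series R N).
Proof.
move=> n1 hY; split; last by apply/filtLP.
  by move=> i d /=; rewrite eqxx.
by move=> d /=; rewrite eqxx.
Qed.

Lemma grade_expoS k n : grade (expo k.+1 k n : exponent N) = fg (expo k k n : exponent N).
Proof.
have pE j : pdeg (expo j k n : exponent N) = (\sum_(i < N) n i)%N.
  by apply: eq_bigr => i _; rewrite expoE.
by rewrite /grade fgE !pE /sdeg !expoE addSn.
Qed.

(** The bracket with the rotation multiplies the monomial z^j w^k mu^n by a
    multiple of j - k - 1, so a change of state removes it unless j = k + 1; the
    terms Y_{k+1,k} are multiples of the rotation and fall to a time rescaling. *)
Lemma removable_monomial v b d n : Hopf_like v -> (1 <= n)%N -> grade d = n ->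
  (0 < sdeg d)%N -> (d iz != (d iw).+1) || b ->
  removable v 1 n (vmonomial_series (b, d)).
Proof.
move=> [v0 v2] n1 gd s0 hb; pose kap : C := if b then ci else 1.
have hm : Lf n (pc kap * mono d : A).
  split; apply: FilMl.
    by apply: Fil_le (Fil_mono (x := d)); rewrite wsE.
  by apply: Fil_le (Fil_mono (x := d)); rewrite -/(fg d) fg_grade // gd.
have pm : gproj n (pc kap * mono d : A) = pc kap * mono d.
  apply: proj_id => x; rewrite pcE /mono /smonomial.
  by case: (x =P d) => [-> //|_]; rewrite mulr0 eqxx.
have v1 : Lf 1 (v - iZ).
  split=> //; apply: FilB; first by case: v0.
  by apply: FilMr; have := Fil_var (R := R) (wt := ws) (s := @iz N); rewrite /ws coordsE.
have fin (Y : ('I_N -> A) * A * A) : filtA n Y ->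
    Lf n.+1 (dmap v Y - pc kap * mono d : A) ->
    removable v 1 n (vmonomial_series (b, d)).
  move=> hY hd.
  have maxE : maxn (n + 1 - 1) 1 = n by rewrite addnK; apply/maxn_idPl.
  have e : dmap v Y = pc kap * mono d + (dmap v Y - pc kap * mono d : A).
    by rewrite addrC subrK.
  exists Y; rewrite maxE; split=> //.
    by rewrite e; apply/filtLP => //; apply: LfD => //; apply: Lf_le hd.
  by rewrite [in RHS]e projD pm (proj_Lf hd) addr0 vmonomial_seriesE.
have brv Y : bracket Y v = bracket Y iZ + bracket Y (v - iZ) :> A.
  by rewrite [bracket Y (_ - _)]bracket_zmod; ring.
have [dd|dd] := eqVneq (d iz) (d iw).+1.
  have bt : b by move: hb; rewrite dd eqxx.
  pose x : exponent N := expo (d iw) (d iw) (param d).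
  have dx : d = eadd (expo1 iz) x.
    by apply: expo_slotP => [||i]; rewrite !ffunE ?coordsE ?ffunE ?addn0 ?dd ?add1n.
  have gx : fg x = n.
    rewrite -gd -grade_expoS; congr grade; rewrite -dd.
    by apply: expo_slotP => [||i]; rewrite !expoE ?paramE.
  apply: (fin (fun=> 0, mono x, 0)).
    split=> [i y /=|y /=|].
    - by rewrite eqxx.
    - rewrite /mono /smonomial; case: (y =P x) => [-> _|_]; last by rewrite eqxx.
      by rewrite !expoE -gx fgE.
    - by apply/filtLP.
  rewrite dmapE /= big1; last by move=> i _; rewrite mulr0.
  have -> : bracket 0 v = 0 :> A.
    by rewrite bracketE raddf0 /D mul0r rmorph0 mul0r addr0 subr0.
  have -> : 0 + mono x * v + 0 - pc kap * mono d = mono x * (v - iZ).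
    by rewrite dx monoD /kap bt /iZ -[mono (expo1 iz)]/(var iz); ring.
  by rewrite -addn1; apply: LfM => //; rewrite -gx; apply: Fil_mono.
pose c : C := kap / (ci * ((d iz)%:R - (d iw)%:R - 1)).
have c0 : (d iz)%:R - (d iw)%:R - 1 != 0 :> C.
  rewrite -addrA -opprD subr_eq0 natr1 eqr_nat; exact: dd.
have hY : Lf n (pc c * mono d : A).
  by have := hm; move=> [h1 h2]; split; apply: FilMl;
     apply: Fil_le (Fil_mono (x := d)); rewrite ?wsE // -/(fg d) fg_grade // gd.
apply: (fin (fun=> 0, 0, pc c * mono d)).
  exact: filtA_state.
rewrite dmapE /= big1; last by move=> i _; rewrite mulr0.
rewrite mul0r !add0r brv bracket_iZ.
have -> : pc ci * (Theta (pc c * mono d) - pc c * mono d) = pc kap * mono d :> A.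
  apply/funext => y; rewrite !pcE subE ThetaE pcE /mono /smonomial.
  case: (y =P d) => [->|_]; last by rewrite !mulr0 subrr mulr0.
  rewrite !mulr1 -[X in _ - X]mul1r -mulrBl mulrA mulrC.
  by rewrite /c divfK // mulf_neq0 ?ci_neq0.
rewrite addrAC subrr add0r -addn1; exact: Lf_bracket.
Qed.

(** A removable monomial is never selected by the greedy complement, hence only
    X_{k+1,k} mu^n survive at the first level. *)
Lemma first_level_shape e v w : formal_basis_order e -> Hopf_like v ->
  extended_partial_normal_form e v v 1 w ->
  exists g, [/\ RR g, F 1 g & w = var iz * (pc ci + g)].
Proof.
move=> [_ eval _] hv [[Y [[hP hT hS] wE]] w0 hn].
have Lw : Lf 0 w by apply: filtL0.
have w2 : F 2 ((w : A) - iZ).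
  have h1 := near_step (t := StateChange Y.2) (leqnn 1) hS hv.1.
  have l1 := near_step0 (t := StateChange Y.2) (leqnn 1) hS hv.1.
  have h2 := near_step (t := TimeRescaling Y.1.2) (leqnn 1) hT l1.
  have l2 := near_step0 (t := TimeRescaling Y.1.2) (leqnn 1) hT l1.
  have h3 := near_step (t := Reparametrization Y.1.1) (leqnn 1) hP l2.
  rewrite wE; apply: Fil_trans h3.2 _; apply: Fil_trans h2.2 _.
  exact: Fil_trans h1.2 hv.2.
have van b d : (0 < sdeg d)%N -> (1 <= grade d)%N -> (d iz != (d iw).+1) || b ->
    vcoef w (b, d) = 0.
  move=> s0 g1 hb; apply/eqP/negP => /negP wn.
  have pn : vcoef (gproj (grade d) w) (b, d) != 0.
    by move: wn; rewrite /vcoef /Defs.proj /= eqxx.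
  have [l [i _ sel] eb] := hn (grade d) (b, d) pn.
  apply: (selected_not_in sel); rewrite eb.
  exact: removable_monomial.
have wz : w (expo1 iz) = ci.
  rewrite (F_coef w2) ?/iZ; last by rewrite /fg wdeg_expo1 wa_slots.
  rewrite varE ffunE eqxx /=.
  have -> : esub (expo1 iz) (expo1 iz) = e0 :> exponent N.
    by apply/ffunP => s; rewrite !ffunE subnn.
  by rewrite /pc eqxx.
have w1 d : grade d = 0%N -> (0 < sdeg d)%N -> d != expo1 iz -> w d = 0.
  move=> g0 s0 dz; rewrite (F_coef w2); last by rewrite fg_grade // g0.
  rewrite /iZ varE; case: ifP => // dz0; rewrite /pc; case: eqP => // h.
  case/eqP: dz; rewrite -(@esubKC _ (expo1 iz) d) ?ele_expo1 // h.
  by apply/ffunP => s; rewrite !ffunE addn0.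
have wn d : d iz != (d iw).+1 -> w d = 0.
  move=> dn; case: (posnP (sdeg d)) => [s0|s0]; first by apply: Lw.1; rewrite wsE s0.
  case: (posnP (grade d)) => [g0|g1].
    by apply: w1 => //; apply: contraNneq dn => ->; rewrite !ffunE.
  have := van false d s0 g1; have := van true d s0 g1; rewrite dn /vcoef /=.
  by case: (w d) => a b /= -> // ->.
pose g : A := fun d => if d == e0 then 0 else w (eadd (expo1 iz) d).
have gE d : g d != 0 -> d iz = d iw.
  rewrite /g; case: (d =P e0) => [_|_]; first by rewrite eqxx.
  move=> h; apply/eqP; apply: contraNT h => dd; apply/eqP/wn.
  by rewrite !ffunE eqxx /= add0n add1n eqSS.
exists g; split.
- split=> d; first by move=> dd; apply/eqP; apply: contraNT dd => /gE ->.
  apply/conjC_eq; rewrite /g; case: (d =P e0) => // d0.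
  have s1 : (0 < sdeg (eadd (expo1 iz) d))%N by rewrite /sdeg !ffunE eqxx.
  apply: (van true (eadd (expo1 iz) d)); rewrite ?orbT //.
  have := fg_grade s1; rewrite fgD {1}/fg wdeg_expo1 wa_slots add1n => -[<-].
  rewrite lt0n; apply/eqP => f0; apply: d0; apply/ffunP => s; rewrite ffunE.
  by have := exp_le_fg d s; rewrite f0 leqn0 => /eqP.
- move=> d dn; rewrite /g ifT //; apply/eqP/ffunP => s; rewrite ffunE.
  by apply/eqP; rewrite -leqn0; apply: leq_trans (exp_le_fg d s) _.
- apply/funext => d; rewrite varE; case: ifPn => d0; last first.
    by apply: wn; move: d0; rewrite -eqn0Ngt => /eqP ->.
  rewrite addE /g /pc; case: (_ =P e0) => [h|_].
    rewrite addr0 -wz; congr w.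
    rewrite -(@esubKC _ (expo1 iz) d) ?ele_expo1 // h.
    by apply/ffunP => s; rewrite !ffunE addn0.
  by rewrite add0r esubKC // ele_expo1.
Qed.

End FirstLevel.

(** * The normal form and the amplitude equation *)

Section Amplitude.
Context {R : realType} {N : nat}.
Local Notation A := (psr R N).
Local Notation C := R[i].
Local Notation par := {ffun 'I_N -> nat}.
Implicit Types (a b f g h u v w Y : A) (d x y : exponent N) (n : par) (k j m : nat).

Definition zz k n : exponent N := expo k k n.
Definition msz n : nat := (\sum_(i < N) n i)%N.
Definition par0 : par := [ffun=> 0%N].

Lemma zzE k n : (zz k n iz = k) * (zz k n iw = k) * (forall i, zz k n (imu i) = n i).
Proof. exact: expoE. Qed.

Lemma sdeg_zz k n : sdeg (zz k n) = k.*2.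
Proof. by rewrite /sdeg !zzE addnn. Qed.

Lemma pdeg_zz k n : pdeg (zz k n) = msz n.
Proof. by apply: eq_bigr => i _; rewrite zzE. Qed.

Lemma fg_zz k n : fg (zz k n) = (k.*2 + @weight N * msz n)%N.
Proof. by rewrite fgE sdeg_zz pdeg_zz. Qed.

Lemma res_zz d : d iz = d iw -> d = zz (d iz) (param d).
Proof. by move=> h; apply: expo_slotP => [||i]; rewrite !zzE ?paramE. Qed.

Lemma msz0 n : msz n = 0%N -> n = par0.
Proof.
move=> /eqP; rewrite sum_nat_eq0 => /forallP h; apply/ffunP => i; rewrite ffunE.
by apply/eqP/(implyP (h i)).
Qed.

Lemma msz1 n : msz n = 1%N -> exists i, n = unit_index i.
Proof.
move=> h; have [j nj] : exists j : 'I_N, (0 < n j)%N.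
  case: (pickP (fun i => 0 < n i)%N) => [j nj|z]; first by exists j.
  by move: h; rewrite /msz big1 // => j _; have := z j; case: (n j).
exists j; apply/ffunP => i; rewrite ffunE.
move: h; rewrite /msz (bigD1 j) //= => h.
move: h; rewrite -(prednK nj) addSn => -[/eqP]; rewrite addn_eq0 => /andP[/eqP p0 s0].
case: eqP => [->|/eqP ij]; first by rewrite -(prednK nj) p0.
by move: s0; rewrite sum_nat_eq0 => /forallP/(_ i); rewrite ij => /eqP.
Qed.

Lemma msz_unit (j : 'I_N) : msz (unit_index j) = 1%N.
Proof.
rewrite /msz (bigD1 j) //= ffunE eqxx big1 // => i /negbTE.
by rewrite ffunE => ->.
Qed.

Lemma RR_F m f : RR f -> (forall k n, (fg (zz k n) < m)%N -> f (zz k n) = 0) -> F m f.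
Proof.
move=> [h _] hz d; rewrite -/(fg d).
have [dd|dd] := eqVneq (d iz) (d iw); last by rewrite h.
by rewrite (res_zz dd); apply: hz.
Qed.

Lemma ZXE k : Z ^+ k = mono (zz k par0) :> A.
Proof.
elim: k => [|k IH].
  by rewrite expr0 -mono0; congr mono; apply: expo_slotP => [||i]; rewrite !zzE !ffunE.
rewrite exprS IH /Z /var -/(mono _) -[svar iw]/(mono (expo1 iw)) -!monoD; congr mono.
by apply: expo_slotP => [||i]; rewrite !(zzE, ffunE) /= ?addn0 ?add0n ?add1n.
Qed.

Lemma ZXM_zz j f k n :
  (Z ^+ j * f) (zz k n) = if (j <= k)%N then f (zz (k - j) n) else 0.
Proof.
rewrite ZXE monoE; have -> : ele (zz j par0) (zz k n) = (j <= k)%N.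
  apply/eleP/idP => [/(_ iz)|jk s]; first by rewrite !zzE.
  by case: (slotP s) => [->|->|[i ->]]; rewrite !zzE // ffunE.
case: ifP => // jk; congr f.
by apply: expo_slotP => [||i]; rewrite !(zzE, ffunE) // subn0.
Qed.

Lemma ZX_zz j k n : (Z ^+ j : A) (zz k n) = ((j == k) && (n == par0))%:R.
Proof.
rewrite ZXE /mono /smonomial; congr (_%:R); congr nat_of_bool.
apply/eqP/andP => [h|[/eqP -> /eqP ->] //]; split; apply/eqP.
  by have := congr1 (fun x : exponent N => x iz) h; rewrite !zzE.
by apply/ffunP => i; have := congr1 (fun x : exponent N => x (imu i)) h; rewrite !zzE.
Qed.

Lemma mu_zz i k n : (var (imu i) : A) (zz k n) = ((k == 0%N) && (n == unit_index i))%:R.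
Proof.
rewrite /var /svar /smonomial; congr (_%:R); congr nat_of_bool.
apply/eqP/andP => [h|[/eqP -> /eqP ->]].
  split; apply/eqP.
    by have := congr1 (fun x : exponent N => x iz) h; rewrite !zzE ffunE.
  apply/ffunP => j; have := congr1 (fun x : exponent N => x (imu j)) h.
  by rewrite !zzE !ffunE (inj_eq (@rshift_inj _ _)).
apply: expo_slotP => [||j]; rewrite !zzE !ffunE //.
Qed.

Lemma Eul_zz f k n : Eul f (zz k n) = (2 * k)%:R * f (zz k n).
Proof. by rewrite EulE sdeg_zz mul2n. Qed.

Lemma pure_zz f k n : pure f -> (0 < k)%N -> f (zz k n) = 0.
Proof. by move=> h k0; apply: h; rewrite sdeg_zz; case: k k0. Qed.

Definition Qn (A0 : R) : A := pc A0%:C%C * Z ^+ N + \sum_(i < N) Z ^+ i * var (imu i).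
Definition Den b : A := 1 + Z ^+ N * b.
Definition bser (B : par -> R) : A :=
  fun d => if sdeg d == 0%N then (B (param d))%:C%C else 0.
(** The normal form z' = z (i Den b + Qn A0), with the angular speed
    1 + Z^N b and the radial speed A0 Z^N + sum_i Z^i mu_i. *)
Definition nfA (A0 : R) b : A := var iz * (pc ci * Den b + Qn A0).

Lemma pure_bser B : pure (bser B).
Proof. by move=> d /negbTE h; rewrite /bser h. Qed.

Lemma rl_bser B : rl (bser B).
Proof. by move=> d; rewrite /bser; case: ifP => _; apply/conjC_eq. Qed.

Lemma RR_pure b : pure b -> rl b -> RR b.
Proof.
move=> h1 h2; split=> // d dd; apply: h1; apply: contraNneq dd.
by rewrite /sdeg => h; apply/eqP; lia.
Qed.

Lemma RR_ZX k : RR (Z ^+ k : A). Proof. exact/RRX/RR_Z. Qed.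
Lemma RR_Den b : RR b -> RR (Den b).
Proof. by move=> h; apply: RRD; [apply: RR1|apply: RRM => //; apply: RR_ZX]. Qed.
Lemma RR_Qn A0 : RR (Qn A0).
Proof.
apply: RRD; first by apply: RRM; [apply: RR_real|apply: RR_ZX].
by apply: RR_sum => i _; apply: RRM; [apply: RR_ZX|apply: RR_mu].
Qed.

Lemma F_ZX k : F k.*2 (Z ^+ k : A).
Proof.
rewrite -muln2; apply: FilX; have := FilM (@F_varz R N) (@F_varw R N).
exact.
Qed.

Lemma F_ZXM k m f : F m f -> F (k.*2 + m) (Z ^+ k * f).
Proof. by move=> h; apply: FilM => //; apply: F_ZX. Qed.

Lemma F_Qn_lead A0 : F N.*2.+1 (Qn A0 - pc A0%:C%C * Z ^+ N).
Proof.
rewrite /Qn addrAC subrr add0r; apply: Fil_sum => i _.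
apply: Fil_le (F_ZXM (k := i) (@F_varmu R N i)).
by rewrite /weight; lia.
Qed.

Lemma F_Qn A0 : F N.*2 (Qn A0).
Proof.
apply: Fil_sub (Fil_le (leqnSn _) (@F_Qn_lead A0)) _; apply: FilMl; exact: F_ZX.
Qed.

Lemma hopf_nfE A0 (B : par -> R) :
  hopf_normal_form 1 A0 B = nfA A0 (bser B) :> A.
Proof.
apply/funext => d; rewrite /hopf_normal_form /polar_system /nfA varE.
set x := esub d (expo1 iz).
have [dd|dd] := eqVneq (d iz) (d iw).+1; last first.
  case: ifP => // d0; rewrite addE [X in X + _]pcE.
  have xx : x iz != x iw.
    rewrite /x !ffunE eqxx /= subn0; apply: contraNneq dd => e; apply/eqP.
    by rewrite -e; lia.
  have [r1 _] := @RR_Den (bser B) (RR_pure (pure_bser B) (rl_bser B)).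
  by have [r2 _] := RR_Qn A0; rewrite r1 // r2 // mulr0 addr0.
rewrite dd /=.
have xE : x = zz (d iw) (param d).
  apply: expo_slotP => [||i]; rewrite !zzE /x !ffunE ?dd ?eqxx ?subn0 //=; lia.
rewrite xE; set k := d iw; set n := param d.
have e1 : (1 : A) (zz k n) = ((k == 0%N) && (n == par0))%:R.
  by rewrite -[1](expr0 Z) ZX_zz eq_sym.
have e2 : (Z ^+ N * bser B) (zz k n) = (if k == N then B n else 0)%:C%C.
  rewrite ZXM_zz; case: (ltngtP k N) => [//|Nd|->]; last first.
    by rewrite subnn /bser sdeg_zz /= /zz param_expo.
  by rewrite /bser sdeg_zz double_eq0 subn_eq0 leqNgt Nd.
have e3 : (\sum_(i < N) Z ^+ i * var (imu i) : A) (zz k n)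
  = (\sum_(i < N) ((k == i) && (n == unit_index ((1%g : {perm 'I_N}) i)))%:R)%:C%C.
  rewrite sumE rmorph_sum; apply: eq_bigr => i _; rewrite ZXM_zz rmorph_nat perm1.
  case: leqP => id; rewrite ?mu_zz; last by rewrite (ltn_eqF id).
  by rewrite subn_eq0 eqn_leq id andbT.
have e4 : (pc A0%:C%C * Z ^+ N : A) (zz k n)
  = (if (k == N) && (n == [ffun=> 0%N]) then A0 else 0)%:C%C.
  rewrite pcE ZX_zz eq_sym /par0.
  by case: (_ && _); rewrite ?mulr1 ?mulr0.
transitivity (ci * ((1 : A) (zz k n) + (Z ^+ N * bser B) (zz k n)) +
  ((pc A0%:C%C * Z ^+ N : A) (zz k n)
   + (\sum_(i < N) Z ^+ i * var (imu i) : A) (zz k n))); last first.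
  by rewrite [RHS]addE [in RHS]pcE /Den /Qn ![in RHS]addE.
rewrite e1 e2 e3 e4.
rewrite -[X in _ * (X + _)](rmorph_nat (real_complex R)) -!rmorphD /=.
apply/eqP; rewrite eq_complex /ci /=; apply/andP; split; apply/eqP; ring.
Qed.

End Amplitude.

(** * Transformations of resonant fields *)

Section ResonantSteps.
Context {R : realType} {N : nat}.
Local Notation A := (psr R N).
Local Notation C := R[i].
Local Notation par := {ffun 'I_N -> nat}.
Local Notation zz := (@zz N).
Implicit Types (a b f g h u v w Y : A) (d x y : exponent N) (n : par) (k j m : nat).

(** The bracket of z a with a resonant field z (i + g), as an operator on the
    amplitude g. *)
Definition Lam a g : A := g * Eul a - a * Eul g.

Lemma Lam_zmod a : zmod_morphism (Lam a).
Proof. by move=> f g; rewrite /Lam EulB; ring. Qed.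

Lemma Lam_raises m a : F m a -> raises m (Lam a).
Proof.
move=> h k f hf; apply: FilB; first by apply: FilM => //; apply: F_Eul.
by rewrite addnC; apply: FilM => //; apply: F_Eul.
Qed.

Lemma Lam_nilop a : F 1 a -> nilop (Lam a).
Proof. by move=> h; split; [apply: Lam_zmod|apply: Lam_raises]. Qed.

Lemma RR_Lam a g : RR a -> RR g -> RR (Lam a g).
Proof. by move=> ha hg; apply: RRB; apply: RRM => //; apply: RR_Eul. Qed.

Lemma RR_coef_sum (I : finType) (c : I -> C) (G : I -> A) :
  (forall i, ((c i)^*)%C = c i) -> (forall i, RR (G i)) -> RR (\sum_i pc (c i) * G i).
Proof. by move=> hc hG; apply: RR_sum => i _; apply: RRM => //; apply: RR_pc. Qed.

Lemma invfact_real k : ((invfact k : C)^*)%C = invfact k.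
Proof. by rewrite /invfact fmorphV /= rmorph_nat. Qed.

Lemma RR_exps (X : A -> A) f : nilop X -> (forall g, RR g -> RR (X g)) -> RR f ->
  RR (exps X f).
Proof.
move=> hX h hf; have hu m : RR (exps_upto X m f).
  apply: RR_coef_sum => i; first exact: invfact_real.
  by elim: (nat_of_ord i) => //= j IH; apply: h.
split=> d.
  move=> dd; rewrite (exps_uptoE (n := (fg d).+1)) //.
  by have [r _] := hu (fg d).+1; apply: r.
rewrite (exps_uptoE (n := (fg d).+1)) //.
by have [_ r] := hu (fg d).+1; apply: r.
Qed.

Lemma bracket_zz a g : RR a -> RR g ->
  bracket (var iz * a) (var iz * g) = var iz * Lam a g :> A.
Proof.
move=> ha hg; rewrite bracketE !D_zr ?RR_cs // !EulM Eul_z /Lam; ring.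
Qed.

Lemma ThetazE a : res a -> Theta (var iz * a) = var iz * a.
Proof. by move=> ha; rewrite ThetaM Theta_z RR_Theta // mulr0 addr0. Qed.

Lemma bracket_ziZ a : res a -> bracket (var iz * a) iZ = 0 :> A.
Proof. by move=> ha; rewrite bracket_iZ ThetazE // subrr mulr0. Qed.

Lemma Fws_z a : Fil ws 1 (var iz * a).
Proof. by apply: FilMr; have := Fil_var (R := R) (wt := ws) (s := @iz N); rewrite /ws coordsE. Qed.

Lemma Lf_z m a : F m a -> Lf m (var iz * a).
Proof.
move=> h; split; first exact: Fws_z.
by rewrite -add1n; apply: FilM => //; apply: F_varz.
Qed.

Lemma zM_zmod f : zmod_morphism (fun g : A => f * g).
Proof. by move=> g h; rewrite mulrBr. Qed.

Lemma exps_bracket_z a g : RR a -> F 1 a -> RR g ->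
  exps (@bracket R N (var iz * a) : A -> A) (var iz * (pc ci + g))
  = var iz * (pc ci + exps (Lam a) g).
Proof.
move=> ha a1 hg; have ya := (Lf_z a1).2; have hb := bracket_nilop ya.
have hL := Lam_nilop a1.
rewrite mulrDr (zmD _ _ (exps_zmod hb)) mulrDr; congr (_ + _).
  by apply: exps_fixed => //; apply: bracket_ziZ; case: ha.
apply: F_eq => m; apply: (Fil_trans (F_exps_upto (n := m) (var iz * g) hb)).
apply: (Fil_trans (g := var iz * exps_upto (Lam a) m g)); last first.
  by rewrite -mulrBr; apply: FilMl; apply: FilBC; apply: F_exps_upto.
suff -> : exps_upto (@bracket R N (var iz * a) : A -> A) m (var iz * g)
   = var iz * exps_upto (Lam a) m g by rewrite subrr.
rewrite /exps_upto mulr_sumr; apply: eq_bigr => k _; rewrite mulrCA; congr (_ * _).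
suff [-> //] : iter k (@bracket R N (var iz * a) : A -> A) (var iz * g)
   = var iz * iter k (Lam a) g /\ RR (iter k (Lam a) g).
elim: (nat_of_ord k) => //= j [-> hj]; split; first exact: bracket_zz.
exact: RR_Lam.
Qed.

(** A state change acts on a real function times a field factor by factor. The
    scalar is symmetrized under conjugation, so that the pairing is additive
    over all series and the exponential of a Leibniz rule applies. *)
Lemma exps_bracketM Y b u : F 2 Y -> cs b = b ->
  exps (@bracket R N Y : A -> A) (b * u)
  = exps (D (- Y)) b * exps (@bracket R N Y : A -> A) u.
Proof.
move=> hY hb; pose p f g : A := pc 2%:R^-1 * (f + cs f) * g.
have hD : nilop (D (- Y)) by apply: D_nilop; apply: FilN.
have pE f g : cs f = f -> p f g = f * g.
  move=> hf; rewrite /p hf; have h2 : pc 2%:R^-1 * 2%:R = 1 :> A.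
    by rewrite natr_pc -rmorphM /= mulVf ?rmorph1 // pnatr_eq0.
  transitivity (pc 2%:R^-1 * 2%:R * (f * g)); first by ring.
  by rewrite h2 mul1r.
have c2 : cs (pc 2%:R^-1) = pc 2%:R^-1 :> A by rewrite cs_pc fmorphV rmorph_nat.
have ce : cs (exps (D (- Y)) b) = exps (D (- Y)) b.
  apply/F_eq => m; have close := F_exps_upto (n := m) b hD.
  apply: (Fil_trans (g := cs (exps_upto (D (- Y)) m b))).
    by rewrite -rmorphB; apply: F_cs.
  apply: Fil_trans (FilBC close).
  suff -> : cs (exps_upto (D (- Y)) m b) = exps_upto (D (- Y)) m b by rewrite subrr.
  rewrite /exps_upto rmorph_sum; apply: eq_bigr => k _.
  rewrite rmorphM /= cs_pc invfact_real; congr (_ * _).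
  by elim: (nat_of_ord k) => //= j IH; rewrite cs_D IH.
rewrite -(pE b u hb) -(pE _ _ ce).
apply: exps_pair => //; first exact: bracket_nilop.
- exact: bracket_nilop.
- by move=> f g h; rewrite /p mulrBr.
- by move=> g f h; rewrite /p rmorphB /=; ring.
- move=> k l f g hf hg; apply: Fil_le (leq_pred _) _; apply: FilM => //.
  by apply: FilMl; apply: FilD => //; apply: F_cs.
- move=> f g; set f2 := pc 2%:R^-1 * (f + cs f).
  have f2r : cs f2 = f2 by rewrite /f2 rmorphM /= rmorphD /= csK c2 [cs f + f]addrC.
  have -> : p (D (- Y) f) g = - D Y f2 * g.
    by rewrite /p /f2 cs_D -raddfD /= DNl DM D_pc; ring.
  rewrite /p -/f2 !bracketE DMl // DM; ring.
Qed.

(** The geometric series, as an instance of the inverse of id + E. *)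
Lemma inv_unit h : F 1 h -> exists k : A,
  [/\ (1 + h) * k = 1, RR h -> RR k & forall m, F m h -> F m (k - 1)].
Proof.
move=> h1; pose E := fun f : A => h * f.
have Ea : zmod_morphism E by exact: zM_zmod.
have Er : raises 1 E by move=> m f hf; rewrite addnC; apply: FilM.
pose k := neumann E 1; have kE : k + h * k = 1 by exact: neumannP.
exists k; split.
- by rewrite mulrDl mul1r.
- move=> [hr hl]; have kr : res k.
    move=> d dd; apply: (neumann_zero (S := fun d => d iz != d iw)) dd.
      by move=> g hg d' dd'; apply: resM hr _ _ dd'.
    by have [] := @RR1 R N.
  split=> // d; have [dd|dd] := eqVneq (d iz) (d iw); last by rewrite kr ?rmorph0.
  have kc : cs k = k.
    apply/eqP; rewrite -subr_eq0; apply/eqP; apply: (add_raising_inj Er).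
    have : cs (k + h * k) = k + h * k by rewrite kE rmorph1.
    rewrite rmorphD rmorphM /= (RR_cs (conj hr hl)) /E => e.
    by rewrite mulrBr addrACA -opprD e subrr.
  rewrite -{2}kc csE; have -> // : sw d = d.
  by apply: expo_slotP => [||i]; rewrite !swE // dd.
- move=> m hm; have -> : k - 1 = - (h * k) by rewrite -kE; ring.
  by apply/FilN/FilMr.
Qed.

End ResonantSteps.

Section Step.
Context {R : realType} {N : nat}.
Local Notation A := (psr R N).
Local Notation C := R[i].
Local Notation par := {ffun 'I_N -> nat}.
Local Notation zz := (@zz N).
Implicit Types (a b f g h u v w Y : A) (d x y : exponent N) (n : par) (k j m : nat).
Variables (A0 : R) (A0_neq0 : A0 != 0).
Hypothesis N_gt0 : (0 < N)%N.
Local Notation Q := (@Qn R N A0).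
Local Notation lead := (pc A0%:C%C * Z ^+ N : A).

Lemma A0C : (A0%:C%C : C) != 0.
Proof. by rewrite eq_complex /= eqxx andbT. Qed.

Lemma amplitude_order b g m : F m (Den b * g - Q) -> (N.*2 <= m)%N -> F N.*2 g.
Proof.
move=> h Nm; have -> : g = (Den b * g - Q) + Q - Z ^+ N * (b * g) by rewrite /Den; ring.
apply: FilB; last by apply: FilMr; apply: F_ZX.
by apply: FilD; [apply: Fil_le h|apply: F_Qn].
Qed.

Lemma amplitude_order2 b g m : F m (Den b * g - Q) -> (4 * N <= m)%N -> F (4 * N) (g - Q).
Proof.
move=> h Nm; have g2 : F N.*2 g by apply: (amplitude_order h); lia.
have -> : g - Q = (Den b * g - Q) - Z ^+ N * (b * g) by rewrite /Den; ring.
apply: FilB; first exact: Fil_le h.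
by apply: Fil_le (F_ZXM (FilMl b g2)); lia.
Qed.

Lemma lead_order b g m : F m (Den b * g - Q) -> (4 * N <= m)%N -> F N.*2.+1 (g - lead).
Proof.
move=> h Nm; apply: (Fil_trans (g := Q)); last exact: F_Qn_lead.
by apply: Fil_le (amplitude_order2 h Nm); lia.
Qed.

Lemma Lam_lead_zz a k n : Lam a lead (zz k n) =
  if (N <= k)%N then 2%:R * A0%:C%C * (k%:R - 2%:R * N%:R) * a (zz (k - N) n) else 0.
Proof.
have -> : Lam a lead = pc A0%:C%C * (Z ^+ N * (Eul a - (2 * N)%:R * a)).
  rewrite /Lam EulM Eul_ZX [Eul (pc _)](_ : _ = 0); first by ring.
  by apply: pure_Eul; apply: pure_pc.
rewrite pcE ZXM_zz; case: leqP => Nk; last by rewrite mulr0.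
rewrite subE Eul_zz natr_coefM.
have -> : (k%:R : C) = (k - N)%:R + N%:R by rewrite -natrD subnK.
by rewrite !natrM; ring.
Qed.

Lemma sum_pure_zz (p : 'I_N -> A) k n : (forall i, pure (p i)) ->
  (\sum_(i < N) Z ^+ i * p i) (zz k n)
  = if insub k is Some i then p i (zz 0 n) else 0.
Proof.
move=> hp; rewrite sumE; case: insubP => [i _ <-|kN].
  rewrite (bigD1 i) //= ZXM_zz leqnn subnn big1 ?addr0 // => l li.
  rewrite ZXM_zz; case: leqP => // le; apply: pure_zz => //; rewrite subn_gt0 ltn_neqAle le andbT.
  by apply: contraNneq li => e; apply/eqP/val_inj.
rewrite big1 // => i _; rewrite ZXM_zz; case: leqP => // le.
apply: pure_zz => //; rewrite subn_gt0; apply: leq_trans (ltn_ord i) _.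
by rewrite leqNgt.
Qed.

(** The homological equation at one grade. The operator Lam, with the leading
    part A0 Z^N, sends a_j Z^j to 2 A0 (j - N) a_j Z^(j + N), so state changes
    reach Z^k for k >= N except k = 2 N; reparametrizations reach k < N; the
    remaining Z^(2 N) is absorbed by a change of the angular coefficient. *)
Lemma homological_grade G E : (4 * N <= G)%N -> RR E -> exists a (p : 'I_N -> A) c,
  [/\ RR a /\ F (G - N.*2) a, forall i, [/\ pure (p i), RR (p i) & F (G - i.*2) (p i)],
      [/\ pure c, RR c & F (G - 4 * N) c] &
      forall k n, fg (zz k n) = G ->
       (E + Lam a lead + \sum_(i < N) Z ^+ i * p i + Z ^+ N * (c * lead)) (zz k n) = 0].
Proof.
move=> NG hE.
pose sh j d := eadd d (zz j par0).
have shE j d : (sh j d iz = d iz + j)%N * (sh j d iw = d iw + j)%N *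
    (forall i, sh j d (imu i) = d (imu i)).
  by rewrite /sh; split=> [|i]; rewrite !ffunE ?coordsE // ffunE addn0.
have sh_zz j k n : sh j (zz k n) = zz (k + j) n.
  by apply: expo_slotP => [||i]; rewrite !shE !zzE.
have mask (P : pred (exponent N)) (q : exponent N -> R) j :
    RR (fun d => if (d iz == d iw) && P d then (q d)%:C%C * E (sh j d) else 0 : C).
  split=> d; first by move=> /negbTE ->.
  case: ifP => _; last by rewrite rmorph0.
  by rewrite rmorphM /=; have [_ ->] := hE; congr (_ * _); rewrite oppr0.
pose a : A := fun d => if (d iz == d iw) && ((fg d + N.*2 == G)%N && (d iz != N)) then
   (- (2%:R * A0 * ((d iz)%:R - N%:R))^-1)%:C%C * E (sh N d) else 0.
pose p (i : 'I_N) : A := fun d => if (d iz == d iw) && ((sdeg d == 0%N) && (fg d + i.*2 == G)%N)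
   then (-1)%:C%C * E (sh i d) else 0.
pose c : A := fun d => if (d iz == d iw) && ((sdeg d == 0%N) && (fg d + 4 * N == G)%N)
   then (- A0^-1)%:C%C * E (sh N.*2 d) else 0.
have Fm m0 (P : pred (exponent N)) (q : exponent N -> C) : (forall d, P d -> (m0 <= fg d)%N) ->
    F m0 (fun d => if P d then q d else 0 : C).
  move=> h d dn; case: ifP => // /h; rewrite leqNgt => /negP[]; exact: dn.
exists a, p, c; split.
- split; first exact: mask.
  by apply: Fm => d /andP[_ /andP[/eqP <- _]]; rewrite addnK.
- move=> i; split; [|exact: mask|].
    by move=> d /negbTE s0; rewrite /p s0 andbF.
  by apply: Fm => d /andP[_ /andP[_ /eqP <-]]; rewrite addnK.
- split; [|exact: mask|].
    by move=> d /negbTE s0; rewrite /c s0 andbF.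
  by apply: Fm => d /andP[_ /andP[_ /eqP <-]]; rewrite addnK.
move=> k n kG; rewrite !addE Lam_lead_zz sum_pure_zz; last first.
  by move=> i d /negbTE s0; rewrite /p s0 andbF.
have -> : Z ^+ N * (c * lead) = pc A0%:C%C * (Z ^+ N.*2 * c).
  by rewrite -addnn exprD; ring.
rewrite pcE ZXM_zz.
have fgs j : (j <= k)%N -> (fg (zz (k - j) n) + j.*2 = G)%N.
  by move=> jk; rewrite -kG !fg_zz doubleB; lia.
have e4 : (4 * N)%N = N.*2.*2 by lia.
have cz : (if (N.*2 <= k)%N then c (zz (k - N.*2) n) else 0)
    = if k == N.*2 then - (A0%:C%C)^-1 * E (zz k n) else 0.
  case: leqP => le; last by rewrite (ltn_eqF le).
  rewrite /c !zzE eqxx e4 (fgs _ le) eqxx andbT sdeg_zz double_eq0 subn_eq0 /=.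
  rewrite [in RHS]eqn_leq le andbT; case: ifP => // _.
  by rewrite sh_zz subnK // rmorphN fmorphV.
have az : (N <= k)%N -> k != N.*2 ->
    2%:R * A0%:C%C * (k%:R - 2%:R * N%:R) * a (zz (k - N) n) = - E (zz k n).
  move=> le kN; rewrite /a !zzE eqxx (fgs _ le) eqxx /=.
  have -> : (k - N != N)%N by apply: contraNneq kN => h; apply/eqP; lia.
  have e : (k%:R : C) = (k - N)%:R + N%:R by rewrite -natrD subnK.
  have q0 : 2%:R * A0%:C%C * ((k - N)%:R - N%:R) != 0 :> C.
    rewrite !mulf_neq0 ?pnatr_eq0 ?A0C // subr_eq0 eqr_nat.
    by apply: contraNneq kN => h; apply/eqP; lia.
  rewrite sh_zz subnK // mulrA rmorphN fmorphV !rmorphM rmorphB !rmorph_nat.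
  have -> : 2%:R * A0%:C%C * (k%:R - 2%:R * N%:R) = 2%:R * A0%:C%C * ((k - N)%:R - N%:R) :> C.
    by rewrite e; ring.
  by rewrite mulrN divff // mulN1r.
have pz (i : 'I_N) : nat_of_ord i = k -> p i (zz 0 n) = - E (zz k n).
  move=> ik; have := fgs i; rewrite ik leqnn subnn => /(_ isT) h.
  by rewrite /p !zzE eqxx sdeg_zz ik h eqxx /= sh_zz add0n rmorphN1 mulN1r.
rewrite cz; case: insubP => [i ik iE|kN].
  rewrite pz // leqNgt ik /= addr0.
  by rewrite ltn_eqF ?mulr0 ?addr0 ?subrr //; lia.
rewrite -leqNgt in kN; rewrite kN addr0; have [kE|kE] := eqVneq k N.*2.
  have -> : (k%:R : C) = 2%:R * N%:R by rewrite kE -mul2n natrM.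
  rewrite subrr mulr0 mul0r addr0.
  by rewrite mulNr mulrN mulrA divff ?A0C // mul1r subrr.
by rewrite az // subrr mulr0 addr0.
Qed.


Lemma RR_pw (phi : 'I_(2 + N) -> A) x : RR (phi iz * phi iw) ->
  (forall i, RR (phi (imu i))) -> x iz = x iw -> RR (pw phi x).
Proof.
move=> hz hh xx; rewrite /pw big_split_ord /= !big_ord_recl big_ord0 mulr1.
have e1 : lshift N ord0 = iz by [].
have e2 : lshift N (lift ord0 ord0) = iw by congr lshift; apply: val_inj.
rewrite e1 e2 xx -exprMn; apply: RRM; first exact: RRX.
apply: (big_ind RR) => [||i _]; [exact: RR1|exact: RRM|].
by rewrite -[rshift _ _]/(imu i); apply: RRX.
Qed.

Lemma RR_subst (phi : 'I_(2 + N) -> A) f : (forall s, F (wa s) (phi s)) ->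
  RR (phi iz * phi iw) -> (forall i, RR (phi (imu i))) -> RR f -> RR (subst phi f).
Proof.
move=> hphi hz hh [f1 f2].
have hx d x : f x * pw phi x d != 0 -> x iz = x iw.
  by move=> n0; apply/eqP; apply: contraNT n0 => xx; rewrite f1 ?mul0r.
split=> d.
  move=> dd; rewrite (substE hphi (M := tdeg d)) // big1 // => x _.
  apply/eqP/negPn/negP => n0; have [r _] := RR_pw hz hh (hx _ _ n0).
  by move: n0; rewrite r ?mulr0 ?eqxx.
rewrite (substE hphi (M := tdeg d)) // rmorph_sum; apply: eq_bigr => x _.
have [->|n0] := eqVneq (f x * pw phi x d) 0; first by rewrite rmorph0.
by rewrite rmorphM /= f2; have [_ ->] := RR_pw hz hh (hx _ _ n0).
Qed.

Lemma RR_sub_mu (h : 'I_N -> A) f : (forall i, F (@weight N) (h i)) ->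
  (forall i, RR (h i)) -> RR f -> RR (subst (sub_mu h) f).
Proof.
move=> hF hh; apply: RR_subst; first exact: sub_mu_F.
  by rewrite /sub_mu !coordsE; apply: RR_Z.
by move=> i; rewrite /sub_mu coordsE.
Qed.

Lemma filtP_RR m (p : 'I_N -> A) : filtP m p -> forall i, RR (p i).
Proof.
move=> hp i; have [_ hpure hcs] := filtP_F hp i.
apply: RR_pure => // d; apply/conjC_eq.
have [->|/hp[_ ->]] := eqVneq (p i d) 0; by [].
Qed.

Lemma RR_phiP m (p : 'I_N -> A) f : filtP m p -> RR f -> RR (phiP p f).
Proof.
move=> hp hf; rewrite phiPE; apply: RR_sub_mu => // i.
  by apply: FilD; [apply: F_varmu|have [h _ _] := filtP_F hp i; apply: Fil_le h; apply: leq_addl].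
by apply: RRD; [apply: RR_mu|apply: filtP_RR hp i].
Qed.

Lemma phiP_z m (p : 'I_N -> A) : filtP m p -> phiP p (var iz) = var iz.
Proof.
move=> hp; rewrite phiPE subst_var /sub_mu ?coordsE // => s.
by apply: (Fil_sub (g := var s)); [apply: Fil_le (phiP_subF hp (s := s)); rewrite leq_addr|apply: Fil_var].
Qed.
Lemma phiP_w m (p : 'I_N -> A) : filtP m p -> phiP p (var iw) = var iw.
Proof.
move=> hp; rewrite phiPE subst_var /sub_mu ?coordsE // => s.
by apply: (Fil_sub (g := var s)); [apply: Fil_le (phiP_subF hp (s := s)); rewrite leq_addr|apply: Fil_var].
Qed.
Lemma phiP_mu m (p : 'I_N -> A) i : filtP m p -> phiP p (var (imu i)) = var (imu i) + p i.
Proof.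
move=> hp; rewrite phiPE subst_var /sub_mu ?coordsE // => s.
by apply: (Fil_sub (g := var s)); [apply: Fil_le (phiP_subF hp (s := s)); rewrite leq_addr|apply: Fil_var].
Qed.

Lemma hom_Z (Phi : A -> A) : shom Phi -> Phi (var iz) = var iz -> Phi (var iw) = var iw ->
  Phi Z = Z.
Proof. by move=> h hz hw; rewrite /Z (homM h) hz hw. Qed.

Lemma hom_Qn (Phi : A -> A) : shom Phi -> Phi (var iz) = var iz -> Phi (var iw) = var iw ->
  Phi Q - Q = \sum_(i < N) Z ^+ i * (Phi (var (imu i)) - var (imu i)).
Proof.
move=> h hz hw; rewrite /Qn (homD h) (homM h) (hom_pc h) (homX h) (hom_Z h hz hw) (hom_sum h).
rewrite opprD addrACA subrr add0r -sumrB; apply: eq_bigr => i _.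
by rewrite (homM h) (homX h) (hom_Z h hz hw) mulrBr.
Qed.

(** The equation (1 + Z^N b) g = Q for the amplitude is improved by one grade.
    The corrections are those of the homological equation, whose error terms are
    of higher order because the rest of Q exceeds Z^N. *)
Lemma amplitude_step G b g : (4 * N <= G)%N -> pure b -> RR b -> RR g ->
  F G (Den b * g - Q) ->
  exists a (p : 'I_N -> A) b',
  [/\ RR a /\ F (G - N.*2) a, filtP (G - 4 * N).+1 p,
      [/\ pure b', RR b' & F (G - 4 * N) (b' - b)] &
      F G.+1 (Den b' * phiP p (exps (Lam a) g) - Q)].
Proof.
move=> NG bp br gr hE; set E := Den b * g - Q in hE.
have Er : RR E by apply: RRB; [apply: RRM => //; apply: RR_Den|apply: RR_Qn].
have [a [p [c [[ar aF] hp [cp cr cF] hom0]]]] := homological_grade NG Er.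
have pF : filtP (G - 4 * N).+1 p.
  move=> i d pd; have [p1 p2 p3] := hp i; split.
  - by apply/eqP; apply: contraNT pd => /p1 ->.
  - by have [_ h] := p2; apply/conjC_eq.
  - have : (G - i.*2 <= fg d)%N.
      by rewrite leqNgt; apply: contraNN pd => h; apply/eqP/p3.
    rewrite fgE; have -> : sdeg d = 0%N by apply/eqP; apply: contraNT pd => /p1 ->.
    by rewrite add0n; apply: leq_trans; rewrite /weight; have := ltn_ord i; lia.
exists a, p, (b + c); split=> //.
  by split; [apply: pureD|apply: RRD|rewrite addrAC subrr add0r].
have g2 : F N.*2 g by apply: (amplitude_order hE); lia.
have gl : F N.*2.+1 (g - lead) by apply: lead_order hE NG.
have gQ : F (4 * N) (g - Q) by apply: amplitude_order2 hE NG.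
have a1 : F 1 a by apply: Fil_le aF; lia.
have LF : F G (Lam a g) by apply: Fil_le (Lam_raises aF g2); lia.
set g1 := exps (Lam a) g; set g' := phiP p g1.
have hPhi := phiP_hom pF; have PR := phiP_raises pF.
have d1 : F G.+1 (g1 - g - Lam a lead).
  apply: (Fil_trans (g := Lam a g)) => [|{}].
    by apply: Fil_le (exps_second (Lam_nilop a1) (Lam_raises aF) LF); lia.
  by rewrite -Lam_zmod; apply: Fil_le (Lam_raises aF gl); lia.
have g1g : F G (g1 - g).
  have := exps_raises (Lam_nilop a1) (Lam_raises aF) _ g2; rewrite -/g1 => h.
  by apply: Fil_le (h _); lia.
have d2 : F G.+1 (g' - g1 - \sum_(i < N) Z ^+ i * p i).
  have -> : \sum_(i < N) Z ^+ i * p i = phiP p Q - Q.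
    rewrite (hom_Qn hPhi) ?(phiP_z pF) ?(phiP_w pF) //; apply: eq_bigr => i _.
    by rewrite (phiP_mu _ pF) addrAC subrr add0r.
  have -> : g' - g1 - (phiP p Q - Q) = phiP p (g1 - Q) - (g1 - Q).
    by rewrite (homB hPhi) /g'; ring.
  apply: Fil_le (PR _ _ _); last first.
    apply: (Fil_trans (g := g)); last exact: gQ.
    by apply: Fil_le g1g.
  by lia.
have g'g : F G (g' - g).
  apply: (Fil_trans (g := g1)) => //; have s0 : F G (\sum_(i < N) Z ^+ i * p i).
    apply: Fil_sum => i _; have [_ _ h] := hp i.
    by apply: Fil_le (F_ZXM (k := i) h); lia.
  by apply: Fil_sub s0; apply: Fil_le d2.
have -> : Den (b + c) * g' - Q =
   (E + Lam a lead + \sum_(i < N) Z ^+ i * p i + Z ^+ N * (c * lead))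
   + (g1 - g - Lam a lead) + (g' - g1 - \sum_(i < N) Z ^+ i * p i)
   + Z ^+ N * (b * (g' - g)) + Z ^+ N * (c * (g' - lead)).
  by rewrite /E /Den; ring.
apply: FilD; last first.
  have h : F N.*2.+1 (g' - lead).
    by apply: (Fil_trans (g := g)) gl; apply: Fil_le g'g; lia.
  by apply: Fil_le (F_ZXM (k := N) (FilM cF h)); lia.
apply: FilD; last by apply: Fil_le (F_ZXM (k := N) (FilMl b g'g)); lia.
apply: FilD => //; apply: FilD => //.
have XF : F G (E + Lam a lead + \sum_(i < N) Z ^+ i * p i + Z ^+ N * (c * lead)).
  apply: FilD; last first.
    have l2 : F N.*2 lead by apply: FilMl; apply: F_ZX.
    by apply: Fil_le (F_ZXM (k := N) (FilM cF l2)); lia.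
  apply: FilD.
    apply: FilD => //; have l2 : F N.*2 lead by apply: FilMl; apply: F_ZX.
    by apply: Fil_le (Lam_raises aF l2); lia.
  apply: Fil_sum => i _; have [_ _ h] := hp i.
  by apply: Fil_le (F_ZXM (k := i) h); lia.
apply: RR_F => [|k n].
  have lr : RR lead by apply: RRM; [apply: RR_real|apply: RR_ZX].
  apply: RRD; last by apply: RRM; [apply: RR_ZX|apply: RRM].
  apply: RRD; first by apply: RRD => //; apply: RR_Lam.
  by apply: RR_sum => i _; apply: RRM; [apply: RR_ZX|have [] := hp i].
rewrite ltnS leq_eqVlt => /orP[/eqP kG|kG]; first exact: hom0.
exact: XF.
Qed.

Lemma phiS_state a b g : RR a -> F 1 a -> RR b -> RR g ->
  phiS (var iz * a) (b * (var iz * (pc ci + g)))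
  = exps (D (- (var iz * a))) b * (var iz * (pc ci + exps (Lam a) g)) :> A.
Proof.
move=> ar a1 br gr; rewrite phiS_exps; first last.
- by apply: Lf0P; apply: FilMl; apply: Fws_z.
- exact: Lf_z.
rewrite exps_bracketM ?RR_cs // ?exps_bracket_z //.
exact: (Lf_z a1).2.
Qed.

(** The same improvement for the field (1 + Z^N b) z (i + g). The state change
    and the reparametrization alter the real factor, and an exact time rescaling
    restores its form. *)
Lemma state_step G b g : (4 * N <= G)%N -> pure b -> RR b -> RR g ->
  F G (Den b * g - Q) ->
  exists (t1 t2 t3 : @transformation R N) b' g',
  [/\ [/\ near_identity (G - 4 * N).+1 t1, near_identity (G - 4 * N).+1 t2
         & near_identity (G - 4 * N).+1 t3],
     transform t3 (transform t2 (transform t1 (Den b * (var iz * (pc ci + g)))))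
       = Den b' * (var iz * (pc ci + g')),
     [/\ pure b', RR b' & F (G - 4 * N) (b' - b)], RR g' & F G.+1 (Den b' * g' - Q)].
Proof.
move=> NG bp br gr hE.
have [a [p [b' [[ar aF] pF [b'p b'r b'F] g'F]]]] := amplitude_step NG bp br gr hE.
have a1 : F 1 a by apply: Fil_le aF; lia.
set Y := var iz * a; set g1 := exps (Lam a) g in g'F; set g' := phiP p g1 in g'F.
have g1r : RR g1.
  by apply: RR_exps => //; [apply: Lam_nilop|move=> h hr; apply: RR_Lam].
have g'r : RR g' by apply: RR_phiP pF g1r.
have Y2 : F 2 (- Y) by apply: FilN; apply: (Lf_z a1).2.
have Yr : raises (G - N.*2) (D (- Y)).
  by apply: D_raises; apply: FilN; apply: (Lf_z aF).2.
set B1 := exps (D (- Y)) (Den b).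
have B1r : RR B1.
  apply: RR_exps; [exact: D_nilop| |exact: RR_Den].
  by move=> h hr; rewrite DNl D_zr ?RR_cs //; apply/RRN/RRM => //; apply: RR_Eul.
have hX := D_nilop Y2.
have DF : F N.*2 (Den b - 1) by rewrite /Den addrAC subrr add0r; apply: FilMr; apply: F_ZX.
have B1F : F G (B1 - Den b).
  have -> : B1 - Den b = exps (D (- Y)) (Den b - 1) - (Den b - 1).
    rewrite exps_zmod // [exps _ 1]exps_fixed //; first by rewrite /B1; ring.
    by rewrite -(rmorph1 pc) D_pc.
  by apply: Fil_le (exps_raises hX Yr _ DF); lia.
have hPhi := phiP_hom pF; have PR := phiP_raises pF.
pose B2 : A := phiP p B1.
have B2r : RR B2 by apply: RR_phiP pF B1r.
have B1F' : F N.*2 (B1 - 1).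
  by apply: (Fil_trans (g := Den b)) DF; apply: Fil_le B1F; lia.
have B2F : F (G - N.*2) (B2 - Den b).
  apply: (Fil_trans (g := B1)); last by apply: Fil_le B1F; lia.
  have -> : B2 - B1 = phiP p (B1 - 1) - (B1 - 1).
    by rewrite (homB hPhi) (hom1 hPhi) /B2; ring.
  by apply: Fil_le (PR _ _ B1F'); lia.
have B2_1 : F 1 (B2 - 1).
  have x1 : F 1 (B2 - Den b) by apply: Fil_le B2F; lia.
  have x2 : F 1 (Den b - 1) by apply: Fil_le DF; lia.
  exact: Fil_trans x1 x2.
have [q [hq qr _]] := inv_unit B2_1; rewrite addrC subrK in hq.
set T := (Den b' - B2) * q.
have Tr : RR T.
  by apply: RRM; [apply: RRB => //; apply: RR_Den|apply: qr; apply: RRB => //; apply: RR1].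
have TF : F (G - N.*2) T.
  apply: FilMr; apply: (Fil_trans (g := Den b)); last exact: FilBC.
  have -> : Den b' - Den b = Z ^+ N * (b' - b) by rewrite /Den; ring.
  by apply: Fil_le (F_ZXM (k := N) b'F); lia.
exists (StateChange Y), (Reparametrization p), (TimeRescaling T), b', g'; split=> //.
- split=> //=.
    apply/filtLP => //; apply: Lf_le (Lf_z aF); lia.
  move=> d Td; have [T1 T2] := Tr; split.
  + by apply/eqP; apply: contraNT Td => /T1 ->.
  + exact/conjC_eq.
  + rewrite -fgE; have : (G - N.*2 <= fg d)%N.
      by rewrite leqNgt; apply: contraNN Td => h; apply/eqP/TF.
    by apply: leq_trans; lia.
- rewrite /= phiS_state //; last exact: RR_Den.
  rewrite -/B1 -/g1 !(homM hPhi) (homD hPhi) (hom_pc hPhi) (phiP_z pF) -[phiP p B1]/B2 -/g'.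
  set u := var iz * (pc ci + g').
  have -> : phiT T (B2 * u) = (B2 * u + T * (B2 * u) : A) by [].
  have -> : B2 * u + T * (B2 * u) = B2 * u + (Den b' - B2) * (B2 * q) * u :> A.
    by rewrite /T; ring.
  have e : B2 * u + (Den b' - B2) * 1 * u = Den b' * u :> A by ring.
  by rewrite hq; exact: e.
Qed.

End Step.

(** * Existence of the normal form *)

Section Existence.
Context {R : realType} {N : nat}.
Local Notation A := (psr R N).
Local Notation C := R[i].
Local Notation par := {ffun 'I_N -> nat}.
Local Notation zz := (@zz N).
Local Notation transf := (@transformation R N).
Implicit Types (a b f g h u v w Y : A) (d : exponent N) (x : 'cV[R]_N) (n : par) (k j m : nat).

Lemma transforms_to_step (t : transf) v w : admissible t ->
  transforms_to (transform t v) w -> transforms_to v w.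
Proof.
move=> ht [ts [us [u0 st lim]]].
exists (fun k => if k is l.+1 then ts l else t), (fun k => if k is l.+1 then us l else v).
split=> //.
  by case=> [|k] /=; [split=> //; rewrite u0|exact: st].
move=> n; have [K hK] := lim n; exists K.+1; case=> // k; rewrite ltnS; exact: hK.
Qed.

Lemma near_identity_le k m (t : transf) : (k <= m)%N -> near_identity m t -> near_identity k t.
Proof.
move=> nm; case: t => [Y|T|Y|M] //= h.
- by move=> b /h [v1 v2]; split=> //; apply: leq_trans v2.
- by move=> d /h [v1 v2 v3]; split=> //; apply: leq_trans v3.
- by move=> i d /h [v1 v2 v3]; split=> //; apply: leq_trans v3; rewrite leq_add2r.
Qed.

Lemma filtL_le k m f : (k <= m)%N -> filtL m f -> filtL k f.
Proof. by move=> nm h b /h [v1 v2]; split=> //; apply: leq_trans v2. Qed.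

Lemma near_admissible k (t : transf) : (1 <= k)%N -> near_identity k t -> admissible t.
Proof. by move=> n1 h; have := near_identity_le n1 h; case: t h. Qed.

Section Leading.
Variables (A0 : R) (A0_neq0 : A0 != 0).
Hypothesis N_gt0 : (0 < N)%N.
Local Notation Q := (@Qn R N A0).
Local Notation lead := (pc A0%:C%C * Z ^+ N : A).

Lemma Lam_ZX_zz (c : C) j g k n : Lam (pc c * Z ^+ j) g (zz k n) =
  if (j <= k)%N then c * (2%:R * (2%:R * j%:R - k%:R)) * g (zz (k - j) n) else 0.
Proof.
have -> : Lam (pc c * Z ^+ j) g = pc c * (Z ^+ j * ((2 * j)%:R * g - Eul g)).
  rewrite /Lam EulM Eul_ZX [Eul (pc _)](_ : _ = 0); first by ring.
  by apply: pure_Eul; apply: pure_pc.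
rewrite pcE ZXM_zz; case: leqP => jk; last by rewrite mulr0.
rewrite subE Eul_zz natr_coefM.
have -> : (k%:R : C) = (k - j)%:R + j%:R by rewrite -natrD subnK.
by rewrite !natrM; ring.
Qed.

(** The parametric matrix of z (i + g), in terms of the amplitude. *)
Definition lin_mx g : 'M[R]_N := \matrix_(k < N, j < N) complex.Re (g (zz k (unit_index j))).
Definition generic g : Prop := forall x : 'cV[R]_N, lin_mx g *m x = 0 -> x = 0.

Definition lin_at (x : 'cV[R]_N) g k : C := \sum_(j < N) g (zz k (unit_index j)) * (x j 0)%:C%C.

Lemma lin_atE x g (k : 'I_N) : RR g -> lin_at x g k = ((lin_mx g *m x) k 0)%:C%C.
Proof.
move=> [_ hr]; rewrite mxE rmorph_sum; apply: eq_bigr => j _; rewrite mxE rmorphM /=.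
congr (_ * _); have := hr (zz k (unit_index j)) => /conjC_eq.
by case: (g _) => p q /= ->.
Qed.

Lemma genericP g : RR g -> (forall x, (forall k, (k < N)%N -> lin_at x g k = 0) -> x = 0)
  <-> generic g.
Proof.
move=> gr; split=> [h x gx|h x gx].
  apply: h => k kN; rewrite (lin_atE x (Ordinal kN) gr) gx mxE.
  by rewrite rmorph0.
apply: h; apply/matrixP => k o; rewrite ord1 [RHS]mxE.
have := gx k (ltn_ord k); rewrite lin_atE // => /eqP.
by rewrite eq_complex /= => /andP[/eqP].
Qed.

Lemma generic_unit g : generic g -> lin_mx g \in unitmx.
Proof.
move=> h; rewrite -unitmx_tr -row_free_unit; apply: inj_row_free => v vg.
by apply: trmx_inj; rewrite trmx0; apply: h; apply: trmx_inj; rewrite trmx_mul trmxK vg trmx0.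
Qed.

Lemma unit_generic g : lin_mx g \in unitmx -> generic g.
Proof. by move=> h x gx; rewrite -[x](mulKmx h) gx mulmx0. Qed.

(** The operator Lam with c Z^j shifts the rows of the parametric matrix down,
    hence is nilpotent on them. *)
Lemma lin_at_Lam x (c : C) j g m : (0 < j)%N ->
  (forall k, (k < m)%N -> lin_at x g k = 0) ->
  forall k, (k < m.+1)%N -> lin_at x (Lam (pc c * Z ^+ j) g) k = 0.
Proof.
move=> j0 hg k km; rewrite /lin_at.
under eq_bigr => i _ do rewrite Lam_ZX_zz.
case: leqP => jk; last by rewrite big1 // => i _; rewrite mul0r.
under eq_bigr => i _ do rewrite -mulrA.
by rewrite -mulr_sumr -/(lin_at x g (k - j)) hg ?mulr0 //; lia.
Qed.

Lemma generic_exps (c : C) j g : (0 < j)%N -> (c^*)%C = c -> RR g -> generic g ->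
  generic (exps (Lam (pc c * Z ^+ j)) g).
Proof.
move=> j0 hc gr hg; set X := Lam _.
have ar : RR (pc c * Z ^+ j : A) by apply: RRM; [apply: RR_pc|apply: RR_ZX].
have a1 : F 1 (pc c * Z ^+ j : A).
  by apply: FilMl; apply: Fil_le (@F_ZX R N j); lia.
have hX : nilop X by apply: Lam_nilop.
have g'r : RR (exps X g) by apply: RR_exps => // h hr; apply: RR_Lam.
apply/genericP => // x hx.
have {}hg := proj2 (genericP gr) hg x; apply: hg.
have low m : (m <= N)%N -> forall k, (k < m)%N -> lin_at x g k = 0.
  elim: m => // m IH mN k; rewrite ltnS leq_eqVlt => /orP[/eqP ->|km]; last first.
    by apply: IH => //; apply: ltnW.
  have {}IH := IH (ltnW mN).
  have itV i : forall k, (k < m.+1)%N -> lin_at x (iter i.+1 X g) k = 0.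
    elim: i => [|i IHi]; first exact: lin_at_Lam.
    by apply: (@lin_at_Lam _ _ _ _ m) => // k' k'm; apply: IHi; apply: ltnW.
  have -> : lin_at x g m = lin_at x (exps X g) m - lin_at x (exps X g - g) m.
    rewrite /lin_at -sumrB; apply: eq_bigr => i _.
    by rewrite subE mulrBl; ring.
  rewrite hx // sub0r /lin_at.
  under eq_bigr => i _ do rewrite exps_sub_id // fg_zz msz_unit mulr_suml.
  rewrite exchange_big /= big1 ?oppr0 // => l _.
  under eq_bigr => i _ do rewrite -mulrA.
  by rewrite -mulr_sumr -/(lin_at x (iter l.+1 X g) m) itV ?mulr0.
exact: low.
Qed.

Definition flat m g : Prop := g (zz N par0) = A0%:C%C /\
  forall k, (k < m)%N -> k != N -> g (zz k par0) = 0.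

Definition wp : 'I_(2 + N) -> nat := coords 0%N 0%N (fun=> 1%N).
Lemma wpE d : wdeg wp d = pdeg d.
Proof.
rewrite /wdeg sum_slots /wp !coordsE !mul0n !add0n; apply: eq_bigr => i _.
by rewrite coordsE mul1n.
Qed.

Lemma msz_par0 : msz (@par0 N) = 0%N.
Proof. by rewrite /msz big1 // => i _; rewrite ffunE. Qed.

Lemma flat_exps m g : (N < m)%N -> (m < N.*2)%N -> RR g -> flat m g ->
  exists2 c : C, (c^*)%C = c & flat m.+1 (exps (Lam (pc c * Z ^+ (m - N))) g).
Proof.
move=> Nm m2 gr [gN gk]; set j := (m - N)%N.
have j0 : (0 < j)%N by rewrite subn_gt0.
pose c : C := - g (zz m par0) / (2%:R * (m%:R - 2%:R * N%:R) * A0%:C%C).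
have cr : (c^*)%C = c.
  rewrite /c rmorphM rmorphN fmorphV !rmorphM rmorphB rmorphM !rmorph_nat /=.
  by have [_ ->] := gr; rewrite oppr0.
exists c => //; set a : A := pc c * Z ^+ j; set X := Lam a.
have a2 : F j.*2 a by apply: FilMl; apply: F_ZX.
have a1 : F 1 a by apply: Fil_le a2; lia.
have hX : nilop X by apply: Lam_nilop.
pose g0 : A := fun d => if pdeg d == 0%N then g d else 0.
have g0r : RR g0.
  have [r1 r2] := gr; split=> d; rewrite /g0; case: ifP => // _; first exact: r1.
  by rewrite rmorph0.
have g0E k : g0 (zz k par0) = g (zz k par0) by rewrite /g0 pdeg_zz msz_par0.
have g1 : Fil wp 1 (g - g0).
  by move=> d; rewrite wpE ltnS leqn0 subE /g0 => ->; rewrite subrr.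
have eg1 : Fil wp 1 (exps X (g - g0)).
  apply: (exps_zero (S := fun d => (wdeg wp d < 1)%N)) g1 => f hf.
  by apply: FilB; [apply: FilMr|apply: FilMl; apply: Fil_dg].
have eE k : exps X g (zz k par0) = exps X g0 (zz k par0).
  have := eg1 (zz k par0); rewrite wpE pdeg_zz msz_par0 => /(_ isT).
  by rewrite exps_zmod // subE => /eqP; rewrite subr_eq0 => /eqP.
have g0F : F N.*2 g0.
  apply: RR_F => // k n; rewrite fg_zz => kn; rewrite /g0 pdeg_zz.
  case: eqP => // /msz0 n0; rewrite n0 gk //; first by move: kn; lia.
  by apply: contraTneq kn => ->; rewrite -leqNgt leq_addr.
have XF : F m.*2 (X g0) by apply: Fil_le (Lam_raises a2 g0F); rewrite /j; lia.
have val k : (k <= m)%N -> exps X g (zz k par0) = g (zz k par0) + X g0 (zz k par0).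
  move=> km; rewrite eE -g0E; have h := exps_second hX (Lam_raises a2) XF.
  rewrite -addrA -opprD in h; apply: (F_coef h).
  by rewrite fg_zz msz_par0; lia.
have XE k : X g0 (zz k par0)
    = if (j <= k)%N then c * (2%:R * (2%:R * j%:R - k%:R)) * g (zz (k - j) par0) else 0.
  by rewrite /X Lam_ZX_zz g0E.
have low k : (k < m)%N -> X g0 (zz k par0) = 0.
  move=> km; rewrite XE; case: leqP => // jk; rewrite gk ?mulr0 //; first by lia.
  by apply/eqP => h; lia.
split; first by rewrite val ?low ?addr0 //; apply: ltnW.
move=> k; rewrite ltnS leq_eqVlt => /orP[/eqP -> _|km kN]; last first.
  by rewrite val ?low ?addr0 ?gk //; apply: ltnW.
have mj : (m - j)%N = N by rewrite /j subKn // ltnW.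
rewrite val // XE /j leq_subr mj gN /c.
have e : (m%:R : C) = (m - N)%:R + N%:R by rewrite -natrD subnK // ltnW.
have q0 : 2%:R * (m%:R - 2%:R * N%:R) * A0%:C%C != 0 :> C.
  rewrite !mulf_neq0 ?pnatr_eq0 ?(A0C A0_neq0) // subr_eq0 -natrM eqr_nat.
  by apply/eqP => h; lia.
have -> : - g (zz m par0) / (2%:R * (m%:R - 2%:R * N%:R) * A0%:C%C)
   * (2%:R * (2%:R * (m - N)%:R - m%:R)) * A0%:C%C
  = - g (zz m par0) * ((2%:R * (m%:R - 2%:R * N%:R) * A0%:C%C)
     / (2%:R * (m%:R - 2%:R * N%:R) * A0%:C%C)).
  have -> : 2%:R * (2%:R * (m - N)%:R - m%:R) = 2%:R * (m%:R - 2%:R * N%:R) :> C.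
    by rewrite e; ring.
  by ring.
by rewrite divff // mulr1 subrr.
Qed.

(** Parameter-free terms below Z^(2 N) are removed by state changes c Z^j z.
    Such a change acts on the linear parameter dependence by a unipotent
    triangular matrix, so genericity survives. *)
Lemma flatten_system (W : series R N -> Prop) m g :
  (forall (t : transf) v, admissible t -> W (transform t v) -> W v) ->
  (N <= m)%N -> (m <= N.*2)%N -> RR g -> F 1 g -> flat m g ->
  generic g ->
  (forall g', RR g' -> F 1 g' -> flat N.*2 g' -> generic g' ->
     W (var iz * (pc ci + g'))) ->
  W (var iz * (pc ci + g)).
Proof.
move=> Wstep Nm m2 gr g1 gf gg hw.
have [k] := ubnP (N.*2 - m)%N; elim: k m g Nm m2 gr g1 gf gg => // k IH m g Nm m2 gr g1 gf gg km.
have [mE|mN] := eqVneq m N.*2; first by apply: hw => //; rewrite -mE.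
have m2' : (m < N.*2)%N by rewrite ltn_neqAle mN.
have [mE|Nm'] := eqVneq m N.
  apply: (IH m.+1 g) => //; [lia| |lia].
  have [f1 f2] := gf; split=> // l; rewrite ltnS leq_eqVlt => /orP[/eqP ->|].
    by rewrite mE eqxx.
  exact: f2.
have {}Nm : (N < m)%N by rewrite ltn_neqAle eq_sym Nm'.
have [c cr cf] := flat_exps Nm m2' gr gf.
set a : A := pc c * Z ^+ (m - N).
have ar : RR a by apply: RRM; [apply: RR_pc|apply: RR_ZX].
have a2 : F (m - N).*2 a by apply: FilMl; apply: F_ZX.
have a1 : F 1 a by apply: Fil_le a2; lia.
apply: (Wstep (StateChange (var iz * a))).
  by apply/filtLP => //; apply: Lf_z.
have -> : transform (StateChange (var iz * a)) (var iz * (pc ci + g))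
    = var iz * (pc ci + exps (Lam a) g) :> A.
  rewrite /= -[var iz * (pc ci + g)]mul1r phiS_state //; last exact: RR1.
  rewrite exps_fixed ?mul1r //; last by rewrite -(rmorph1 pc) D_pc.
  by apply: D_nilop; apply: FilN; apply: (Lf_z a1).2.
have hX := Lam_nilop a1.
apply: (IH m.+1) => //; try lia.
- by apply: RR_exps => // h hr; apply: RR_Lam.
- have h := exps_raises hX (Lam_raises a1) (leqnn 1) g1.
  by apply: Fil_sub g1; apply: Fil_le h.
- by apply: generic_exps => //; lia.
Qed.

(** Genericity enters here: the inverse of the parametric matrix makes the
    linear dependence on the parameters the standard one. What is left then
    differs from the normal form by terms of order at least 4 N. *)
Lemma linear_step (W : series R N -> Prop) g :
  (forall (t : transf) v, admissible t -> W (transform t v) -> W v) -> RR g -> F 1 g -> flat N.*2 g -> generic g ->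
  (forall g', RR g' -> F (4 * N) (g' - Q) -> W (var iz * (pc ci + g'))) ->
  W (var iz * (pc ci + g)).
Proof.
move=> Wstep gr g1 [gN gk] gg hw; have Gu := generic_unit gg.
set G := lin_mx g in Gu; set M := invmx G.
pose h (i : 'I_N) : A := \sum_(j < N) pc (M i j)%:C%C * var (imu j).
have hF i : F (@weight N) (h i) by apply: Fil_sum => j _; apply: FilMl; apply: F_varmu.
have hr i : RR (h i).
  by apply: RR_sum => j _; apply: RRM; [apply: RR_real|apply: RR_mu].
have sF := sub_mu_F hF; have hPhi := hom_subst sF.
set Phi := subst (sub_mu h) in hPhi.
have Pz : Phi (var iz) = var iz by rewrite /Phi subst_var // /sub_mu coordsE.
have Pw : Phi (var iw) = var iw by rewrite /Phi subst_var // /sub_mu coordsE.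
have Pmu i : Phi (var (imu i)) = h i by rewrite /Phi subst_var // /sub_mu coordsE.
apply: (Wstep (LinearReparametrization M)) => /=.
  by rewrite unitmx_inv.
have -> : phiLin M (var iz * (pc ci + g)) = var iz * (pc ci + Phi g) :> A.
  transitivity (Phi (var iz * (pc ci + g))).
    rewrite /phiLin /reparametrize /Phi /subst; congr (ssubst (coords _ _ _) _).
    by apply/funext => i; rewrite /h; apply: eq_bigr => j _; rewrite scaleE.
  by rewrite (homM hPhi) (homD hPhi) (hom_pc hPhi) Pz.
apply: hw; first exact: RR_sub_mu.
pose Q' : A := lead + \sum_(k < N) Z ^+ k * (\sum_(i < N) pc (G k i)%:C%C * var (imu i)).
have Q'r : RR Q'.
  apply: RRD; first by apply: RRM; [apply: RR_real|apply: RR_ZX].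
  apply: RR_sum => k _; apply: RRM; first exact: RR_ZX.
  by apply: RR_sum => i _; apply: RRM; [apply: RR_real|apply: RR_mu].
have PQ : Phi Q' = Q.
  rewrite /Q' (homD hPhi) (homM hPhi) (hom_pc hPhi) (homX hPhi) (hom_Z hPhi Pz Pw) /Qn.
  congr (_ + _); rewrite (hom_sum hPhi); apply: eq_bigr => k _.
  rewrite (homM hPhi) (homX hPhi) (hom_Z hPhi Pz Pw); congr (_ * _).
  rewrite (hom_sum hPhi).
  transitivity (\sum_(j < N) pc ((G *m M) k j)%:C%C * var (imu j) : A).
    under eq_bigr => i _ do rewrite (homM hPhi) (hom_pc hPhi) Pmu /h mulr_sumr.
    rewrite exchange_big; apply: eq_bigr => j _ /=.
    rewrite mxE rmorph_sum rmorph_sum mulr_suml; apply: eq_bigr => i _ /=.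
    by rewrite !rmorphM mulrA.
  rewrite mulmxV // (bigD1 k) //= mxE eqxx rmorph1 rmorph1 mul1r big1 ?addr0 // => j jk.
  by rewrite mxE eq_sym (negbTE jk) mulr0n !rmorph0 mul0r.
rewrite -PQ -(homB hPhi); apply: (homF hPhi).
apply: RR_F; first exact: RRB.
move=> k n; rewrite fg_zz subE => kn.
have Q'E : Q' (zz k n) = A0%:C%C * ((N == k) && (n == par0))%:R
    + (if insub k is Some i then \sum_(j < N) (G i j)%:C%C * ((n == unit_index j))%:R else 0).
  rewrite /Q' addE pcE ZX_zz sum_pure_zz; last first.
    move=> i; apply: (big_ind (@pure R N)) => [||j _].
    - by [].
    - exact: pureD.
    - by apply: pureM; [apply: pure_pc|apply: pure_var].
  congr (_ + _); case: insubP => // i _ _; rewrite sumE; apply: eq_bigr => j _.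
  by rewrite pcE mu_zz.
case E : (msz n) kn => [|[|q]] kn.
- rewrite Q'E (msz0 E) eqxx andbT.
  have -> : (if insub k is Some i then \sum_(j < N) (G i j)%:C%C * ((par0 == unit_index j))%:R else 0) = 0 :> C.
    case: insubP => // i _ _; rewrite big1 // => j _.
    case: eqP => [h0|]; last by rewrite mulr0.
    by have := msz_unit j; rewrite -h0 msz_par0.
  rewrite addr0; have [<-|Nk] := eqVneq N k; first by rewrite mulr1 gN subrr.
  by rewrite mulr0 gk ?subrr //; [lia|rewrite eq_sym].
- have [j nj] := msz1 E; rewrite Q'E nj.
  have -> : (unit_index j == par0 :> par) = false.
    by apply/eqP => h0; have := msz_unit j; rewrite h0 msz_par0.
  rewrite andbF mulr0 add0r; case: insubP => [i _ ik|]; last first.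
    by rewrite -leqNgt => Nk; exfalso; move: kn; rewrite /weight; lia.
  rewrite (bigD1 j) //= eqxx mulr1 big1 ?addr0 => [|l lj].
    rewrite /G mxE ik; have [_ /(_ (zz k (unit_index j)))/conjC_eq] := gr.
    by case: (g _) => p q /= ->; rewrite subrr.
  case: eqP => [/ffunP/(_ j)|]; last by rewrite mulr0.
  by rewrite !ffunE eqxx eq_sym (negbTE lj).
- by exfalso; move: kn; rewrite /weight; nia.
Qed.

Definition nf_approx (k : nat) (s : A * A) : Prop :=
  [/\ pure s.1, RR s.1, RR s.2 & F (4 * N + k) (Den s.1 * s.2 - Q)].
Definition field_of (s : A * A) : A := Den s.1 * (var iz * (pc ci + s.2)).

(** Iterating the improvement by one grade gives a sequence of transformations
    that converges in the filtration; the angular coefficients stabilize. *)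
Lemma nf_approx_limit g : RR g -> F (4 * N) (g - Q) ->
  exists B : par -> R, transforms_to (var iz * (pc ci + g)) (nfA A0 (bser B)).
Proof.
move=> gr gQ.
have stepP (x : nat * (A * A)) : exists y : (transf * transf * transf) * (A * A),
    nf_approx x.1 x.2 ->
    [/\ [/\ near_identity x.1.+1 y.1.1.1, near_identity x.1.+1 y.1.1.2
         & near_identity x.1.+1 y.1.2],
     transform y.1.2 (transform y.1.1.2 (transform y.1.1.1 (field_of x.2))) = field_of y.2,
     F x.1 (y.2.1 - x.2.1) & nf_approx x.1.+1 y.2].
  have [hx|hx] := pselect (nf_approx x.1 x.2); last first.
    by exists ((StateChange 0, StateChange 0, StateChange 0), (0, 0)).
  have [p1 p2 p3 p4] := hx.
  have [t1 [t2 [t3 [b' [g' [n123 e [b1 b2 b3] g'r g'F]]]]]] :=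
    state_step A0_neq0 N_gt0 (leq_addr x.1 (4 * N)) p1 p2 p3 p4.
  exists ((t1, t2, t3), (b', g')) => _; rewrite addKn in n123 b3.
  by split=> //; split=> //; rewrite addnS.
have [f hf] := choice stepP.
pose s := fix s k : A * A := if k is l.+1 then (f (l, s l)).2 else (0, g).
have sP k : nf_approx k (s k).
  elim: k => [|k IH]; last by have [] := hf (k, s k) IH.
  split=> //=; first exact: RR0.
  by rewrite addn0 /Den mulr0 addr0 mul1r.
(* Three transformations raise the grade by one. *)
pose t k := let y := f (k %/ 3, s (k %/ 3))%N in
  if (k %% 3 == 0)%N then y.1.1.1 else if (k %% 3 == 1)%N then y.1.1.2 else y.1.2.
pose u := fix u k : series R N := if k is l.+1 then transform (t l) (u l) else field_of (s 0%N).
have tn k : near_identity (k %/ 3).+1 (t k).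
  have [[n1 n2 n3] _ _ _] := hf (k %/ 3, s (k %/ 3))%N (sP _).
  by rewrite /t; case: ifP => // _; case: ifP.
have u3 k : u (3 * k)%N = field_of (s k).
  elim: k => [|k IH]; first by rewrite muln0.
  have [_ e _ _] := hf (k, s k) (sP k).
  have t0 : t (3 * k)%N = (f (k, s k)).1.1.1.
    by rewrite /t mulKn // modnMr.
  have t1 : t (3 * k).+1 = (f (k, s k)).1.1.2.
    have -> : ((3 * k).+1 = k * 3 + 1)%N by lia.
    by rewrite /t divnMDl // addn0 modnMDl.
  have t2 : t (3 * k).+2 = (f (k, s k)).1.2.
    have -> : ((3 * k).+2 = k * 3 + 2)%N by lia.
    by rewrite /t divnMDl // addn0 modnMDl.
  have -> : (3 * k.+1 = (3 * k).+3)%N by lia.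
  by rewrite [u _]/= -/(u _) t0 t1 t2 IH e.
have ul k : Lf 0 (u k).
  elim: k => [|k IH]; last exact: near_step0 (tn k) IH.
  by apply: Lf0P; apply: FilMl; apply: Fws_z.
have bstep k m : (k <= m)%N -> F k ((s m).1 - (s k).1).
  elim: m => [|m IH]; first by rewrite leqn0 => /eqP ->.
  rewrite leq_eqVlt => /orP[/eqP ->|km]; first by rewrite subrr.
  have [_ _ e _] := hf (m, s m) (sP m).
  by apply: Fil_trans (IH km); apply: Fil_le e.
pose B n := complex.Re ((s (fg (zz 0 n)).+1).1 (zz 0 n)).
have bB k : F k ((s k).1 - bser B).
  move=> d dk; rewrite subE; have [pp [_ rr] _ _] := sP k.
  have [d0|d0] := eqVneq (sdeg d) 0%N; last by rewrite pp // pure_bser // subrr.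
  have dz : d = zz 0 (param d).
    by move: d0; rewrite /sdeg => d0; apply: expo_slotP => [||i]; rewrite !zzE ?paramE //; lia.
  rewrite /bser d0 eqxx /B -dz; have [_ [_ r2] _ _] := sP (fg d).+1.
  have e1 := F_coef (bstep _ _ dk) (ltnSn (fg d)).
  rewrite e1; have := r2 d => /conjC_eq.
  by case: ((s _).1 d) => p q /= ->; rewrite subrr.
exists B, t, u; split.
- by rewrite /= /field_of /= /Den mulr0 addr0 mul1r.
- by move=> k; split=> //; apply: near_admissible (tn k).
- move=> n; exists (3 * n.+1)%N => k nk.
  have kn : (n < k %/ 3)%N by rewrite leq_divRL //; lia.
  split; first by apply: near_identity_le (tn k); lia.
  apply: (@filtL_le _ (k %/ 3)); first exact: ltnW.
  apply/filtLP; first by lia.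
  set q := (k %/ 3)%N.
  have uq : Lf q (u (3 * q)%N - nfA A0 (bser B) : A).
    have [_ _ _ pF] := sP q.
    rewrite u3; have -> : field_of (s q) - nfA A0 (bser B) =
       var iz * (pc ci * (Z ^+ N * ((s q).1 - bser B)) + (Den (s q).1 * (s q).2 - Q)).
      by rewrite /field_of /nfA /Den; ring.
    apply: Lf_z; apply: FilD; last by apply: Fil_le pF; rewrite leq_addl.
    by apply: FilMl; apply: FilMl; exact: bB.
  have grow l : Lf q (u (3 * q + l)%N - u (3 * q)%N : A).
    elim: l => [|l IH]; first by rewrite addn0 subrr; split.
    rewrite addnS -[u (3 * q + l).+1](subrK (u (3 * q + l)%N : A)) -addrA.
    apply: LfD => //; have h := near_step (ltn0Sn _) (tn (3 * q + l)%N) (ul (3 * q + l)%N).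
    apply: (Lf_le _ h); rewrite mulnC divnMDl //.
    by apply: leqW; apply: leq_addr.
  have -> : (u k - nfA A0 (bser B) : A) = (u k - u (3 * q)%N : A) + (u (3 * q)%N - nfA A0 (bser B) : A).
    by rewrite addrA subrK.
  apply: LfD => //; have := grow (k %% 3)%N.
  by rewrite mulnC -divn_eq.
Qed.

End Leading.

Theorem normal_form_exists e (alpha beta : exponent N -> R) (vt : nat -> series R N) :
  (0 < N)%N -> formal_basis_order e ->
  extended_partial_levels e (hopf_system alpha beta) vt ->
  parametric_generic vt N -> has_parametric_dimension vt N ->
  exists (A0 : R) (B : par -> R), A0 != 0 /\
    transforms_to (hopf_system alpha beta) (nfA A0 (bser B)).
Proof.
move=> N0 he [v0 lev] hgen hdim.
have hv := hopf_system_like alpha beta.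
have lev1 := lev 0%N; rewrite v0 in lev1.
have [g [gr g1 wE]] := first_level_shape he hv lev1.
have [[Y [[hP hT hS] w_chain]] _ _] := lev1.
have coef k n : vcoef (vt 1%N) (false, expo k.+1 k n) = complex.Re (g (zz k n)).
  rewrite /vcoef /= wE varE expoE /=.
  have -> : esub (expo k.+1 k n) (expo1 iz) = zz k n.
    by apply: expo_slotP => [||i]; rewrite !(zzE, ffunE) ?coordsE /= ?subn0 ?subn1.
  by rewrite addE raddfD /= /pc; case: eqP => _; rewrite add0r.
pose A0 := complex.Re (g (zz N par0)).
have real_of d : g d = (complex.Re (g d))%:C%C.
  by have [_ /(_ d)/conjC_eq] := gr; case: (g d) => p q /= ->.
have [low top] := hdim 1%N (leqnn 1).
have A0n : A0 != 0 by rewrite /A0 -coef.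
have gf : flat A0 N g.
  split; first exact: real_of.
  by move=> k kN _; rewrite real_of -coef low.
have gg : generic g.
  apply: unit_generic; rewrite -row_free_unit /row_free.
  suff -> : lin_mx g = parametric_matrix (vt 1%N) N by rewrite hgen.
  by apply/matrixP => k j; rewrite !mxE coef.
suff [B0 hB0] : exists B : par -> R, transforms_to (var iz * (pc ci + g)) (nfA A0 (bser B)).
  exists A0, B0; split=> //.
  apply: (transforms_to_step (t := StateChange Y.2)) => //.
  apply: (transforms_to_step (t := TimeRescaling Y.1.2)) => //.
  apply: (transforms_to_step (t := Reparametrization Y.1.1)) => //.
  by rewrite /= -w_chain wE.
pose W v := exists B : par -> R, transforms_to v (nfA A0 (bser B)).
have Wstep (t : transf) v : admissible t -> W (transform t v) -> W v.
  by move=> ht [B hB]; exists B; apply: transforms_to_step hB.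
have NN2 : (N <= N.*2)%N by rewrite -addnn leq_addr.
change (W (var iz * (pc ci + g))); have flt := flatten_system A0n N0 Wstep (leqnn N) NN2 gr g1 gf gg.
apply: flt => g' g'r g'1 g'f g'g.
apply: (linear_step A0n N0 Wstep g'r g'1 g'f g'g) => g2 g2r g2F.
exact: nf_approx_limit.
Qed.

End Existence.

(** * The infinitesimal action on the normal form *)

Section InfiniteLevel.
Context {R : realType} {N : nat}.
Local Notation A := (psr R N).
Local Notation C := R[i].
Local Notation par := {ffun 'I_N -> nat}.
Local Notation zz := (@zz N).
Local Notation par0 := (@par0 N).
Implicit Types (a b c f g h u v w Y : A) (d : exponent N) (n : par) (k j m : nat).

(** Together Xim and Xre give the coefficient i Xim u + Xre u of z in the
    resonant part of a field. *)
Definition Xre u : A := fun d =>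
  if d iz == d iw then (complex.Re (u (eadd (expo1 iz) d)))%:C%C else 0.
Definition Xim u : A := fun d =>
  if d iz == d iw then (complex.Im (u (eadd (expo1 iz) d)))%:C%C else 0.
Definition nres u : Prop := forall d, d iz = (d iw).+1 -> u d = 0.
Definition unr u : A := fun d => if d iz == (d iw).+1 then 0 else u d.

Lemma RR_Xre u : RR (Xre u).
Proof.
split=> d; rewrite /Xre; first by move=> /negbTE ->.
by case: ifP => _; apply/conjC_eq.
Qed.
Lemma RR_Xim u : RR (Xim u).
Proof.
split=> d; rewrite /Xim; first by move=> /negbTE ->.
by case: ifP => _; apply/conjC_eq.
Qed.

Lemma nres_unr u : nres (unr u).
Proof. by move=> d dd; rewrite /unr dd eqxx. Qed.

Lemma Xre_zmod : zmod_morphism Xre.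
Proof.
move=> f g; apply/funext => d; rewrite subE /Xre; case: ifP => _; last by rewrite subr0.
by rewrite subE raddfB rmorphB.
Qed.
Lemma Xim_zmod : zmod_morphism Xim.
Proof.
move=> f g; apply/funext => d; rewrite subE /Xim; case: ifP => _; last by rewrite subr0.
by rewrite subE raddfB rmorphB.
Qed.

Lemma F_Xre m u : F m u -> F m.-1 (Xre u).
Proof.
move=> h d; rewrite -/(fg d) => dm; rewrite /Xre; case: ifP => // _.
by rewrite h ?rmorph0 // -/(fg _) fgD /fg wdeg_expo1 wa_slots -/(fg d); lia.
Qed.
Lemma F_Xim m u : F m u -> F m.-1 (Xim u).
Proof.
move=> h d; rewrite -/(fg d) => dm; rewrite /Xim; case: ifP => // _.
by rewrite h ?rmorph0 // -/(fg _) fgD /fg wdeg_expo1 wa_slots -/(fg d); lia.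
Qed.

Lemma unr_zmod : zmod_morphism unr.
Proof.
by move=> f g; apply/funext => d; rewrite subE /unr; case: ifP; rewrite ?subr0 ?subE.
Qed.
Lemma F_unr m f : F m f -> F m (unr f).
Proof. by move=> h d dm; rewrite /unr; case: ifP => // _; apply: h. Qed.

Lemma complex_split (z : C) : z = ci * (complex.Im z)%:C%C + (complex.Re z)%:C%C.
Proof. by case: z => p q; apply/eqP; rewrite eq_complex /ci /=; apply/andP; split; apply/eqP; ring. Qed.

Lemma res_split u : u = unr u + var iz * (pc ci * Xim u + Xre u).
Proof.
apply/funext => d; rewrite addE /unr varE.
case: (posnP (d iz)) => [d0|d0]; first by rewrite d0 /= addr0.
have dE : eadd (expo1 iz) (esub d (expo1 iz)) = d by rewrite esubKC // ele_expo1.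
rewrite addE pcE /Xre /Xim dE !ffunE eqxx /= subn0.
have -> : (d iz - 1 == d iw)%N = (d iz == (d iw).+1).
  by apply/eqP/eqP => h; lia.
by case: ifP => _; rewrite ?mulr0 ?addr0 // add0r -complex_split.
Qed.

Lemma res_split_unique f r1 r2 : nres f -> RR r1 -> RR r2 ->
  f + var iz * (pc ci * r1 + r2) = 0 -> [/\ f = 0, r1 = 0 & r2 = 0].
Proof.
move=> hf [h1 h1'] [h2 h2'] e.
have ce d : d iz = d iw -> ci * r1 d + r2 d = 0.
  move=> dd; have := congr1 (fun q : A => q (eadd (expo1 iz) d)) e.
  rewrite addE varE_add addE pcE zeroE hf ?add0r // !ffunE eqxx /=; lia.
have z1 : r1 = 0 /\ r2 = 0.
  split; apply/funext => d; rewrite zeroE;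
    have [dd|dd] := eqVneq (d iz) (d iw); try by [apply: h1 | apply: h2].
  - have := ce d dd; have := h1' d; have := h2' d => /conjC_eq + /conjC_eq.
    case: (r1 d) => p q; case: (r2 d) => p' q' /= -> ->; rewrite /ci => /eqP.
    rewrite eq_complex /= => /andP[_ /eqP h]; apply/eqP; rewrite eq_complex /= eqxx andbT.
    by apply/eqP; rewrite -h; ring.
  - have := ce d dd; have := h1' d; have := h2' d => /conjC_eq + /conjC_eq.
    case: (r1 d) => p q; case: (r2 d) => p' q' /= -> ->; rewrite /ci => /eqP.
    rewrite eq_complex /= => /andP[/eqP h _]; apply/eqP; rewrite eq_complex /= eqxx andbT.
    by apply/eqP; rewrite -h; ring.
split; [|exact: z1.1|exact: z1.2].
by move: e; rewrite z1.1 z1.2 mulr0 addr0 mulr0 addr0.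
Qed.

(** The charge under rotation is additive; resonant fields have charge 1. *)
Definition chg d : int := (d iz)%:Z - (d iw)%:Z.
Definition ch (q : int) f : Prop := forall d, chg d != q -> f d = 0.
Definition nch (q : int) f : Prop := forall d, chg d = q -> f d = 0.

Lemma chgD d1 d2 : chg (eadd d1 d2) = chg d1 + chg d2.
Proof. by rewrite /chg !ffunE !PoszD; ring. Qed.

Lemma nchM p q f g : ch p f -> nch q g -> nch (p + q) (f * g).
Proof.
move=> hf hg d dd; rewrite mulE big1_seq // => x /andP[_]; rewrite mem_below => xd.
have [xp|xp] := eqVneq (chg x) p; last by rewrite hf ?mul0r.
rewrite [X in _ * X]hg ?mulr0 //; move: dd; rewrite -{1}(esubKC xd) chgD xp.
by move/addrI.
Qed.

Lemma nchD q f g : nch q f -> nch q g -> nch q (f + g).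
Proof. by move=> hf hg d dd; rewrite addE hf ?hg ?addr0. Qed.
Lemma nchB q f g : nch q f -> nch q g -> nch q (f - g).
Proof. by move=> hf hg d dd; rewrite subE hf ?hg ?subr0. Qed.

Lemma res_ch f : res f -> ch 0 f.
Proof.
move=> h d dd; apply: h; apply: contraNneq dd => e.
by rewrite /chg e subrr.
Qed.

Lemma ch_var f q : ch q f -> ch (q + 1) (var iz * f).
Proof.
move=> h d dd; rewrite varE; case: ifP => // d0; apply: h.
apply: contraNneq dd => <-; apply/eqP.
have dE : eadd (expo1 iz) (esub d (expo1 iz)) = d by rewrite esubKC // ele_expo1.
by rewrite -{1}dE chgD addrC; congr (_ + _); rewrite /chg !ffunE.
Qed.

Lemma ch_pd s f q : ch q f -> ch (q - chg (expo1 s)) (pd s f).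
Proof.
move=> h d dd; rewrite /pd /sderiv h ?mulr0 //; apply: contraNneq dd => e.
apply/eqP; rewrite -e; have -> : [ffun t => (d t + (t == s))%N] = eadd d (expo1 s).
  by apply/ffunP => t; rewrite !ffunE.
by rewrite chgD addrK.
Qed.

Lemma nres_bracket Y h1 h2 : nres Y -> RR h1 -> RR h2 ->
  nres (bracket Y (var iz * (pc ci * h1 + h2))).
Proof.
move=> hY r1 r2; set w := var iz * _.
have nresP f : nres f <-> nch 1 f.
  split=> h d dd; apply: h; move: dd; rewrite /chg; lia.
apply/nresP; rewrite bracketE; move/nresP: hY => hY; apply: nchB.
  rewrite D_zir ?RR_cs //; apply: nchD.
    rewrite -[1]add0r; apply: nchM.
      by apply: res_ch; apply: resM; [apply: res_pc|case: r1].
    by move=> d dd; rewrite ThetaE hY ?mulr0.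
  rewrite -[1]add0r; apply: nchM; first by apply: res_ch; case: r2.
  by move=> d dd; rewrite EulE hY ?mulr0.
have wch : ch (0 + 1) w.
  apply: ch_var; apply: res_ch; apply: resD; last by case: r2.
  by apply: resM; [apply: res_pc|case: r1].
have hz : chg (expo1 iz : exponent N) = 1 by rewrite /chg !ffunE.
have hw : chg (expo1 iw : exponent N) = -1 by rewrite /chg !ffunE.
apply: nchD.
  rewrite mulrC -[1]add0r; apply: nchM => //.
  by have := ch_pd (s := iz) wch; rewrite hz addrK.
rewrite mulrC; suff : nch (2%:R + (-1)) (pd iw w * cs Y) by [].
apply: nchM; first by have := ch_pd (s := iw) wch; rewrite hw.
move=> d dd; rewrite csE hY ?rmorph0 //; move: dd; rewrite /chg !swE; lia.
Qed.

Lemma bracket_res a c h1 h2 : RR a -> RR c -> RR h1 -> RR h2 ->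
  bracket (var iz * (pc ci * c + a)) (var iz * (pc ci * h1 + h2))
  = var iz * (pc ci * (h2 * Eul c - a * Eul h1) + Lam a h2) :> A.
Proof.
move=> ar cr r1 r2; rewrite bracketE !D_zir ?RR_cs //.
rewrite !ThetazE; first last.
- by apply: resD; [apply: resM; [apply: res_pc|case: cr]|case: ar].
- by apply: resD; [apply: resM; [apply: res_pc|case: r1]|case: r2].
rewrite !EulM !EulD !EulM Eul_z [Eul (pc ci)]pure_Eul; last exact: pure_pc.
rewrite /Lam; ring.
Qed.

Section NormalForm.
Variables (A0 : R) (A0_neq0 : A0 != 0).
Hypothesis N_gt0 : (0 < N)%N.
Variable b : A.
Hypotheses (b_pure : pure b) (b_rl : rl b).
Local Notation Q := (@Qn R N A0).
Local Notation lead := (pc A0%:C%C * Z ^+ N : A).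
Local Notation w0 := (nfA A0 b).

Let b_RR : RR b := RR_pure b_pure b_rl.
Let Den_RR : RR (Den b) := RR_Den b_RR.
Let Q_RR : RR Q := RR_Qn A0.

Definition grad_b (p : 'I_N -> A) : A := \sum_(i < N) pd (imu i) b * p i.
Definition Zp (p : 'I_N -> A) : A := \sum_(i < N) Z ^+ i * p i.

Lemma pd_mu_Z i k : pd (imu i) (Z ^+ k : A) = 0.
Proof.
elim: k => [|k IH]; first by rewrite expr0 pd1.
rewrite exprS pdM IH /Z pdM !pd_var /=; ring.
Qed.

Lemma pd_w0 (p : 'I_N -> A) :
  \sum_(i < N) pd (imu i) w0 * p i = var iz * (pc ci * (Z ^+ N * grad_b p) + Zp p).
Proof.
have pdw i : pd (imu i) w0 = var iz * (pc ci * (Z ^+ N * pd (imu i) b) + Z ^+ i).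
  rewrite /nfA pdM pd_var /= mul0r add0r; congr (_ * _).
  rewrite raddfD /= pdM pd_pc mul0r add0r /Den raddfD /= pd1 add0r pdM pd_mu_Z mul0r add0r.
  congr (_ + _); rewrite /Qn raddfD /= pdM pd_pc pd_mu_Z mul0r mulr0 addr0 add0r.
  rewrite raddf_sum (bigD1 i) //= pdM pd_mu_Z pd_var eqxx mul0r add0r mulr1.
  rewrite big1 ?addr0 // => j ji; rewrite pdM pd_mu_Z pd_var.
  by rewrite (inj_eq (@rshift_inj _ _)) (negbTE ji) mul0r mulr0 addr0.
rewrite /grad_b /Zp !mulr_sumr -big_split /= mulr_sumr.
by apply: eq_bigr => i _; rewrite pdw; ring.
Qed.

Lemma bracket_w0 a c : RR a -> RR c ->
  bracket (var iz * (pc ci * c + a)) w0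
  = var iz * (pc ci * (Q * Eul c - a * Eul (Den b)) + Lam a Q) :> A.
Proof. by move=> ar cr; apply: bracket_res. Qed.

(** Resonant generators act on the normal form within resonant fields. The
    radial and the angular component are the two real equations that must be
    solved in order to decide what can still be removed. *)
Lemma dmap_res (p : 'I_N -> A) (T : A) a c : RR a -> RR c ->
  dmap w0 (p, T, var iz * (pc ci * c + a))
  = var iz * (pc ci * (Z ^+ N * grad_b p + T * Den b + Q * Eul c - a * Eul (Den b))
              + (Zp p + T * Q + Lam a Q)) :> A.
Proof.
move=> ar cr; rewrite dmapE /= pd_w0 bracket_w0 // /nfA; ring.
Qed.

(** The homological equation read backwards: the coefficient of Z^k in the
    leading terms involves, besides si, only one of the unknowns: p_k for k < N,
    al_(k - N) with the factor 2 A0 (k - 2 N) for k >= N, and be for k = 2 N. *)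
Lemma leading_coefs (al : A) (p : 'I_N -> A) (be si : A) k n :
  (forall i, pure (p i)) -> pure be -> al (zz 0 par0) = 0 ->
  ((k < N)%N -> si (zz k n) != 0 -> forall i : 'I_N, i = k :> nat -> p i (zz 0 n) = 0) ->
  ((N <= k)%N -> si (zz k n) != 0 -> k = N /\ n = par0) ->
  (Lam al lead + Zp p - si + Z ^+ N * (be * lead)) (zz k n) = 0 ->
  [/\ si (zz k n) = 0, forall i : 'I_N, i = k :> nat -> p i (zz 0 n) = 0,
      (N <= k)%N -> k != N.*2 -> al (zz (k - N) n) = 0 &
      k = N.*2 -> be (zz 0 n) = 0].
Proof.
move=> hp hb al0 sp sN.
have -> : Z ^+ N * (be * lead) = pc A0%:C%C * (Z ^+ N.*2 * be).
  by rewrite -addnn exprD; ring.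
rewrite !addE oppE Lam_lead_zz /Zp sum_pure_zz // pcE ZXM_zz.
have bz : (if (N.*2 <= k)%N then be (zz (k - N.*2) n) else 0)
    = if k == N.*2 then be (zz 0 n) else 0.
  case: (ltngtP k N.*2) => [//|kN|->]; last by rewrite subnn.
  by apply: pure_zz => //; rewrite subn_gt0.
rewrite bz; case: insubP => [i ik iE|kN].
  have kN : (k < N)%N by [].
  rewrite leqNgt kN /= ltn_eqF ?mulr0 ?addr0 ?add0r; last by lia.
  move=> e; have [s0|s0] := eqVneq (si (zz k n)) 0.
    move: e; rewrite s0 subr0 => e; split=> //; [|lia].
    by move=> i' e'; have -> : i' = i by apply: val_inj; rewrite /= e' -iE.
  by move: e; rewrite (sp kN s0 i iE) sub0r => e; rewrite -oppr_eq0 e eqxx in s0.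
rewrite -leqNgt in kN; rewrite kN addr0.
have inone (i : 'I_N) : i = k :> nat -> p i (zz 0 n) = 0.
  by move=> ik; have := ltn_ord i; rewrite ik ltnNge kN.
have [kE|kE] := eqVneq k N.*2.
  have -> : (k%:R : C) = 2%:R * N%:R by rewrite kE -mul2n natrM.
  rewrite subrr mulr0 mul0r add0r => e.
  have s0 : si (zz k n) = 0.
    apply/eqP/negP => /negP s0; have [kN' _] := sN kN s0.
    by move: kE; rewrite kN'; lia.
  move: e; rewrite s0 oppr0 add0r => /eqP; rewrite mulf_eq0 (negbTE (A0C A0_neq0)) => /eqP e.
  by split.
rewrite mulr0 addr0 => e.
have q0 : 2%:R * A0%:C%C * (k%:R - 2%:R * N%:R) != 0 :> C.
  rewrite !mulf_neq0 ?pnatr_eq0 ?(A0C A0_neq0) // subr_eq0 -natrM eqr_nat mul2n.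
  exact: kE.
have s0 : si (zz k n) = 0.
  apply/eqP/negP => /negP s0; have [kN' n0] := sN kN s0.
  move: e; rewrite kN' n0 subnn al0 mulr0 add0r => /eqP; rewrite oppr_eq0 => h.
  by move: s0; rewrite kN' n0 h.
split=> // [_ _|kN2]; last by move: kE; rewrite kN2 eqxx.
by move: e => /eqP; rewrite s0 subr0 mulf_eq0 (negbTE q0) => /eqP.
Qed.

End NormalForm.
End InfiniteLevel.

(** * Independence of the normal form monomials *)

Section InfiniteLevel.
Context {R : realType} {N : nat}.
Local Notation A := (psr R N).
Local Notation C := R[i].
Local Notation par := {ffun 'I_N -> nat}.
Local Notation zz := (@zz N).
Local Notation par0 := (@par0 N).
Implicit Types (a b c f g h u v w Y : A) (d : exponent N) (n : par) (k j m : nat).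
Lemma pure_F0 m f : pure f -> (forall n, (fg (zz 0 n) < m)%N -> f (zz 0 n) = 0) -> F m f.
Proof.
move=> fp h d; rewrite -/(fg d); have [d0|d0] := eqVneq (sdeg d) 0%N; last by rewrite fp.
have -> : d = zz 0 (param d).
  by move: d0; rewrite /sdeg => d0; apply: expo_slotP => [||i]; rewrite !zzE ?paramE //; lia.
exact: h.
Qed.

Hypothesis N_gt0 : (0 < N)%N.

(** The complement to all removable directions has the real terms Z^k
    (1 <= k <= N) and Z^k mu_j (k < N), and the imaginary terms Z^N mu^n. The
    linear terms Z^k mu_j with j <> k stay out of reach at infinite level, since
    a linear reparametrization is not near-identity. *)
Definition SX k n : bool :=
  ((n == par0) && (0 < k <= N)%N) || ((k < N)%N && (msz n == 1%N)).

Definition nf_monomials : set (vmonomial N) := [set x |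
  (exists k n, x = (false, expo k.+1 k n) /\ SX k n) \/
  (exists n, x = (true, expo N.+1 N n))].

Lemma expoS_zz k n : expo k.+1 k n = eadd (expo1 iz) (zz k n).
Proof.
by apply: expo_slotP => [||i]; rewrite !(zzE, ffunE) ?coordsE /= ?add0n ?add1n.
Qed.

Lemma expo_inj j k n j' k' n' :
  expo j k n = expo j' k' n' :> exponent N -> k = k' /\ n = n'.
Proof.
move=> e; split; first by have := congr1 (fun q : exponent N => q iw) e; rewrite !expoE.
by have := congr1 (@param N) e; rewrite !param_expo.
Qed.

Lemma nf_re k n : nf_monomials (false, expo k.+1 k n) -> SX k n.
Proof.
case=> [[k' [n' [e Sk]]]|[n' e]]; last by have := congr1 fst e.
by have [-> ->] := expo_inj (congr1 snd e).
Qed.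

Lemma nf_im k n : nf_monomials (true, expo k.+1 k n) -> k = N.
Proof.
case=> [[k' [n' [e Sk]]]|[n' e]]; first by have := congr1 fst e.
by have [-> _] := expo_inj (congr1 snd e).
Qed.

Lemma nf_charge x d : nf_monomials (x, d) -> d iz = (d iw).+1.
Proof.
by case=> [[k' [n' [e _]]]|[n' e]]; rewrite (congr1 snd e : d = _) !expoE.
Qed.

Lemma fspan_nf (s : A) : fspan nf_monomials s <-> exists be si : A,
  [/\ pure be, RR be, RR si, forall k n, ~~ SX k n -> si (zz k n) = 0 &
      s = var iz * (pc ci * (Z ^+ N * be) + si)].
Proof.
split=> [hs|[be [si [bp br sr s0 sE]]] [x d] hx].
  have z d : ~ (exists x, nf_monomials (x, d)) -> s d = 0.
    move=> h; apply/eqP/negPn/negP => /vcoef_exists[x /hs hx]; apply: h.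
    by exists x.
  have u0 : unr s = 0.
    apply/funext => d; rewrite /unr zeroE; case: eqP => // dd; apply: z.
    by case=> x /nf_charge.
  pose be : A := fun d => if sdeg d == 0%N then Xim s (eadd d (zz N par0)) else 0.
  have bp : pure be by move=> d /negbTE h; rewrite /be h.
  have br : RR be.
    apply: RR_pure => // d; rewrite /be; case: ifP => _; last by rewrite rmorph0.
    by have [_ ->] := RR_Xim s.
  exists be, (Xre s); split=> //; first exact: RR_Xre.
    move=> k n nS; have [r1 r2] := RR_Xre s; rewrite /Xre !zzE eqxx -expoS_zz.
    suff -> : complex.Re (s (expo k.+1 k n)) = 0 by rewrite rmorph0.
    apply/eqP/negPn/negP => h; move/negP: nS; apply.
    exact: nf_re (hs (false, expo k.+1 k n) h).
  rewrite {1}(res_split s) u0 add0r; congr (_ * (_ * _ + _)).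
  apply/funext => d; have [dd|dd] := eqVneq (d iz) (d iw); last first.
    have [r1 _] := RR_Xim s; rewrite r1 //.
    by have [r2 _] : RR (Z ^+ N * be) by [apply: RRM => //; apply: RR_ZX]; rewrite r2.
  rewrite (res_zz dd); move: (d iz) (param d) => k n {d dd}; rewrite ZXM_zz.
  have sh j : eadd (zz j n) (zz N par0) = zz (j + N) n.
    by apply: expo_slotP => [||i]; rewrite !(zzE, ffunE) // addn0.
  case: leqP => kN; last first.
    rewrite /Xim !zzE eqxx -expoS_zz.
    suff -> : complex.Im (s (expo k.+1 k n)) = 0 by rewrite rmorph0.
    apply/eqP/negPn/negP => h.
    by move: kN; rewrite (nf_im (hs (true, expo k.+1 k n) h)) ltnn.
  rewrite /be sdeg_zz double_eq0 sh subnK //; case: eqP => // kN0.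
  rewrite /Xim !zzE eqxx -expoS_zz.
  suff -> : complex.Im (s (expo k.+1 k n)) = 0 by rewrite rmorph0.
  apply/eqP/negPn/negP => h.
  by apply: kN0; rewrite (nf_im (hs (true, expo k.+1 k n) h)) subnn.
have hd := vcoef_neq0 hx; move: hx hd; rewrite /= => hx hd.
have dz : (0 < d iz)%N by move: hd; rewrite sE varE; case: ifP; rewrite ?eqxx.
pose y := esub d (expo1 iz); have dE : d = eadd (expo1 iz) y by rewrite esubKC // ele_expo1.
have Zr : RR (Z ^+ N * be) by apply: RRM => //; apply: RR_ZX.
have sy : s d = ci * (Z ^+ N * be) y + si y by rewrite sE dE varE_add addE pcE.
have yy : y iz = y iw.
  apply/eqP; apply: contraNT hd => yy; rewrite sy.
  by have [r1 _] := Zr; have [r2 _] := sr; rewrite r1 // r2 // mulr0 addr0.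
move: sy; rewrite dE (res_zz yy); set k := y iz; set n := param y => sy.
rewrite -expoS_zz in sy *.
have := (proj2 sr) (zz k n) => /conjC_eq sIm.
have := (proj2 Zr) (zz k n) => /conjC_eq bIm.
move: hx; rewrite /vcoef dE (res_zz yy) -/k -/n -expoS_zz sy.
case: x => /= hx; [right|left].
  exists n; congr (_, _).
  suff -> : k = N by [].
  apply/eqP; apply: contraNT hx => kN.
  have -> : (Z ^+ N * be) (zz k n) = 0.
    rewrite ZXM_zz; case: leqP => // Nk; apply: pure_zz => //.
    by rewrite subn_gt0 ltn_neqAle eq_sym kN.
  by rewrite mulr0 add0r sIm.
exists k, n; split=> //; apply: contraNT hx => /s0 ->; rewrite addr0.
by move: bIm; case: (_ (zz k n)) => p q /= ->; apply/eqP; ring.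
Qed.

Lemma nf_monomials_valid x : nf_monomials x -> valid x /\ (1 <= grade x.2)%N.
Proof.
have v (t : bool) k n : (0 < k)%N || (0 < msz n)%N ->
    valid (t, expo k.+1 k n) /\ (1 <= grade (expo k.+1 k n))%N.
  move=> kn; rewrite grade_expoS fg_zz /valid /=; split.
    apply/orP; left; apply/andP; split; first by rewrite /sdeg !expoE.
    have -> : tdeg (expo k.+1 k n) = (k.+1 + k + msz n)%N.
      rewrite /tdeg /sdeg !expoE; congr (_ + _)%N.
      by apply: eq_bigr => i _; rewrite expoE.
    by case/orP: kn; lia.
  by case/orP: kn => h; [|have := @weight_gt0 N]; nia.
case=> [[k [n [-> Sk]]]|[n ->]]; apply: v.
  by case/orP: Sk => [/andP[_ /andP[->]]|/andP[_ /eqP ->]] //; rewrite orbT.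
by rewrite N_gt0.
Qed.

Lemma Qn_support (A0 : R) k n : ~~ SX k n -> Qn A0 (zz k n) = 0 :> C.
Proof.
rewrite /SX negb_or => /andP[h1 h2]; rewrite /Qn addE pcE ZX_zz sumE.
have -> : (N == k) && (n == par0) = false.
  apply/negP => /andP[/eqP kN n0]; move/negP: h1; apply.
  by rewrite n0 -kN N_gt0 leqnn.
rewrite mulr0 add0r big1 // => i _; rewrite ZXM_zz; case: leqP => // ik; rewrite mu_zz.
case: eqP => // ki; case: eqP => // ni; move/negP: h2; case.
rewrite ni msz_unit eqxx andbT; apply: leq_ltn_trans (ltn_ord i); lia.
Qed.

Variables (A0 : R) (A0_neq0 : A0 != 0).
Variable b : A.
Hypotheses (b_pure : pure b) (b_rl : rl b).
Local Notation Q := (@Qn R N A0).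
Local Notation lead := (pc A0%:C%C * Z ^+ N : A).
Local Notation w0 := (nfA A0 b).

Let b_RR : RR b := RR_pure b_pure b_rl.
Let Den_RR : RR (Den b) := RR_Den b_RR.
Let Q_RR : RR Q := RR_Qn A0.

(** The two real equations of a resonant direction in the span of the normal
    form monomials reduce, once the time rescaling is eliminated, to a single
    homological equation. Its coefficients vanish grade by grade. *)
Lemma nf_direct (p : 'I_N -> A) (T Y : A) : filtA 1 (p, T, Y) ->
  fspan nf_monomials (dmap w0 (p, T, Y)) -> dmap w0 (p, T, Y) = 0 :> A.
Proof.
move=> [/= hp hT hY] /fspan_nf[be [si [bep ber sir siS sE]]].
have pP i : [/\ pure (p i), RR (p i) & forall n, (msz n <= 1)%N -> p i (zz 0 n) = 0].
  have [h1 h2 _] := filtP_F hp i; split=> //; first exact: filtP_RR hp i.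
  move=> n n1; apply: h1; rewrite -/(fg _) fg_zz add0n add1n ltnS.
  by rewrite -[X in (_ <= X)%N]muln1 leq_mul2l n1 orbT.
have Tr : RR T.
  split=> d; first by move=> dd; apply/eqP; apply: contraNT dd => /hT[->].
  by have [->|/hT[_ ? _]] := eqVneq (T d) 0; [rewrite rmorph0|apply/conjC_eq].
have [Y1 Y2] := proj1 (filtLP _ (leqnn 1)) hY.
set a := Xre Y; set c := Xim Y.
have ar : RR a := RR_Xre Y; have cr : RR c := RR_Xim Y.
have aF : F 1 a.
  move=> d; rewrite -/(fg d) => d0; rewrite /a /Xre; case: ifP => // _.
  by rewrite Y2 ?rmorph0 //= -/(fg _) fgD /fg wdeg_expo1 wa_slots -/(fg d); lia.
have cF : F 1 c.
  move=> d; rewrite -/(fg d) => d0; rewrite /c /Xim; case: ifP => // _.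
  by rewrite Y2 ?rmorph0 //= -/(fg _) fgD /fg wdeg_expo1 wa_slots -/(fg d); lia.
have split0 : bracket (unr Y) w0 + var iz * (pc ci *
      (Z ^+ N * grad_b b p + T * Den b + Q * Eul c - a * Eul (Den b) - Z ^+ N * be)
      + (Zp p + T * Q + Lam a Q - si)) = 0 :> A.
  have dr := dmap_res A0 b_pure b_rl p T ar cr.
  have dE : dmap w0 (p, T, Y) = bracket (unr Y) w0 + dmap w0 (p, T, var iz * (pc ci * c + a)) :> A.
    rewrite !dmapE /= {1}(res_split Y) !bracketE DDl raddfD /=; ring.
  have e : dmap w0 (p, T, Y) - var iz * (pc ci * (Z ^+ N * be) + si) = 0 :> A.
    by rewrite -sE subrr.
  by rewrite -e dE dr; ring.
have [br0 im0 re0] : [/\ bracket (unr Y) w0 = 0 :> A,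
    Z ^+ N * grad_b b p + T * Den b + Q * Eul c - a * Eul (Den b) - Z ^+ N * be = 0 &
    Zp p + T * Q + Lam a Q - si = 0].
  have rG : RR (grad_b b p).
    by apply: RR_sum => i _; apply: RRM; [apply: RR_pd_mu|have [] := pP i].
  apply: res_split_unique split0.
  - by apply: nres_bracket => //; apply: nres_unr.
  - apply: RRB; last by apply: RRM => //; apply: RR_ZX.
    apply: RRB; last by apply: RRM => //; apply: RR_Eul.
    apply: RRD; last by apply: RRM => //; apply: RR_Eul.
    by apply: RRD; apply: RRM => //; apply: RR_ZX.
  - apply: RRB => //; apply: RRD; last exact: RR_Lam.
    apply: RRD; last exact: RRM.
    by apply: RR_sum => i _; apply: RRM; [apply: RR_ZX|have [] := pP i].
(* The combination of the two equations in which T cancels. *)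
pose al0 := Den b * a - Q * c.
have al0r : RR al0 by apply: RRB; apply: RRM.
have eq0 : Lam al0 Q + Den b * Zp p - Q * (Z ^+ N * grad_b b p)
    - Den b * si + Q * (Z ^+ N * be) = 0.
  transitivity (Den b * (Zp p + T * Q + Lam a Q - si) - Q * (Z ^+ N * grad_b b p + T * Den b
     + Q * Eul c - a * Eul (Den b) - Z ^+ N * be)); last by rewrite im0 re0; ring.
  by rewrite /Lam /al0 EulB !EulM; ring.
(* The direction of the field itself is trivial: Lam Q Q = 0. Subtracting a
   multiple of Q makes the coefficients of Z^N vanish, the ones on which
   the homological equation gives no condition. *)
pose e : A := fun d => if sdeg d == 0%N then (A0%:C%C)^-1 * al0 (eadd d (zz N par0)) else 0.
have ep : pure e by move=> d /negbTE h; rewrite /e h.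
have er : RR e.
  apply: RR_pure => // d; rewrite /e; case: ifP => _; last by rewrite rmorph0.
  have cM (s t : C) : ((s * t)^*)%C = (s^*)%C * (t^*)%C by exact: rmorphM.
  by rewrite cM (proj2 al0r) -fmorphV; congr (_ * _); apply/conjC_eq.
pose al := al0 - e * Q.
have alr : RR al by apply: RRB => //; apply: RRM.
have alN n : al (zz N n) = 0.
  rewrite /al subE /Qn mulrDr addE.
  have -> : e * (pc A0%:C%C * Z ^+ N) = pc A0%:C%C * (Z ^+ N * e) by ring.
  have -> : e * (\sum_(i < N) Z ^+ i * var (imu i)) = Zp (fun i => var (imu i) * e).
    by rewrite /Zp mulr_sumr; apply: eq_bigr => i _; ring.
  rewrite pcE ZXM_zz leqnn subnn /Zp sum_pure_zz; last first.
    by move=> i; apply: pureM => //; apply: pure_var.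
  case: insubP => [i iN _|_]; first by rewrite ltnn in iN.
  rewrite addr0 /e sdeg_zz /=.
  have -> : eadd (zz 0 n) (zz N par0) = zz N n.
    by apply: expo_slotP => [||i]; rewrite !(zzE, ffunE) // addn0.
  by rewrite mulrA divff ?(A0C A0_neq0) // mul1r subrr.
have al1 : F 1 al.
  apply: FilB; first by apply: FilB; apply: FilMl.
  by apply: FilMl; apply: Fil_le (F_Qn A0); lia.
have eqal : Lam al Q + Den b * Zp p - Q * (Z ^+ N * grad_b b p)
    - Den b * si + Q * (Z ^+ N * be) = 0.
  rewrite -[RHS]eq0; congr (_ + _ - _ - _ + _).
  by rewrite /al /Lam EulB EulM (pure_Eul ep); ring.
have al00 : al (zz 0 par0) = 0.
  by apply: al1; rewrite -/(fg _) fg_zz msz_par0; lia.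
have main G : [/\ F (G - N.*2) al, forall i : 'I_N, F (G - i.*2) (p i), F G si &
    F (G - 4 * N) be].
  elim: G => [|G [h1 h2 h3 h4]]; first by split.
  have ZpF : F G (Zp p).
    by apply: Fil_sum => i _; apply: Fil_le (F_ZXM (k := i) (h2 i)); lia.
  have QlF := @F_Qn_lead R N A0.
  have DF : F N.*2 (Den b - 1) by rewrite /Den addrAC subrr add0r; apply: FilMr; apply: F_ZX.
  have gF : F (G - N.*2) (grad_b b p).
    by apply: Fil_sum => i _; apply: FilMl; apply: Fil_le (h2 i); have := ltn_ord i; lia.
  have X1 : F G.+1 (Lam al lead + Zp p - si + Z ^+ N * (be * lead)).
    have -> : Lam al lead + Zp p - si + Z ^+ N * (be * lead) =
       (Lam al Q + Den b * Zp p - Q * (Z ^+ N * grad_b b p) - Den b * si + Q * (Z ^+ N * be))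
       - Lam al (Q - lead) - (Den b - 1) * Zp p + Q * (Z ^+ N * grad_b b p)
       + (Den b - 1) * si - (Q - lead) * (Z ^+ N * be).
      by rewrite Lam_zmod; ring.
    rewrite eqal sub0r.
    have x1 : F G.+1 (Lam al (Q - lead)) by apply: Fil_le (Lam_raises h1 QlF); lia.
    have x2 : F G.+1 ((Den b - 1) * Zp p) by apply: Fil_le (FilM DF ZpF); lia.
    have x3 : F G.+1 (Q * (Z ^+ N * grad_b b p)).
      by apply: Fil_le (FilM (F_Qn A0) (F_ZXM (k := N) gF)); lia.
    have x4 : F G.+1 ((Den b - 1) * si) by apply: Fil_le (FilM DF h3); lia.
    have x5 : F G.+1 ((Q - lead) * (Z ^+ N * be)).
      by apply: Fil_le (FilM QlF (F_ZXM (k := N) h4)); lia.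
    by apply: FilB => //; apply: FilD => //; apply: FilD => //; apply: FilB => //; apply: FilN.
  have co k n : fg (zz k n) = G -> [/\ si (zz k n) = 0,
      forall i : 'I_N, i = k :> nat -> p i (zz 0 n) = 0,
      (N <= k)%N -> k != N.*2 -> al (zz (k - N) n) = 0 &
      k = N.*2 -> be (zz 0 n) = 0].
    move=> kG; apply: (leading_coefs A0_neq0 N_gt0) => //.
    - by move=> i; have [] := pP i.
    - move=> kN /negP s0 i _; have [_ _ h] := pP i; apply: h.
      have : SX k n by apply/negPn/negP => /siS h; apply: s0; rewrite h eqxx.
      by case/orP => [/andP[/eqP -> _]|/andP[_ /eqP ->]] //; rewrite msz_par0.
    - move=> Nk /negP s0.
      have : SX k n by apply/negPn/negP => /siS h; apply: s0; rewrite h eqxx.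
      case/orP => [/andP[/eqP -> /andP[_ kN]]|/andP[kN _]].
        by split=> //; apply/eqP; rewrite eqn_leq kN.
      by move: Nk; rewrite leqNgt kN.
    - by apply: X1; rewrite -/(fg _) kG.
  split.
  - apply: RR_F => // k n kG; have [k1|k1] := ltnP (fg (zz k n)) (G - N.*2).
      exact: h1.
    have kG' : fg (zz (k + N) n) = G by move: kG k1; rewrite !fg_zz doubleD; lia.
    have [->|kN] := eqVneq k N; first exact: alN.
    have [_ _ h _] := co _ _ kG'; rewrite addnK in h; apply: h; first exact: leq_addl.
    by apply: contraNneq kN => h; apply/eqP; lia.
  - move=> i; have [p1 _ _] := pP i; apply: pure_F0 => // n kG.
    have [k1|k1] := ltnP (fg (zz 0 n)) (G - i.*2); first exact: h2.
    have kG' : fg (zz i n) = G by move: kG k1; rewrite !fg_zz; lia.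
    by have [_ h _ _] := co _ _ kG'; apply: h.
  - apply: RR_F => // k n; rewrite ltnS leq_eqVlt => /orP[/eqP kG|kG]; last exact: h3.
    by have [] := co _ _ kG.
  - apply: pure_F0 => // n kG.
    have [k1|k1] := ltnP (fg (zz 0 n)) (G - 4 * N); first exact: h4.
    have kG' : fg (zz N.*2 n) = G by move: kG k1; rewrite !fg_zz; lia.
    by have [_ _ _ h] := co _ _ kG'; apply: h.
have si0 : si = 0 by apply: F_eq0 => m; have [] := main m.
have be0 : be = 0.
  by apply: F_eq0 => m; have [_ _ _] := main (m + 4 * N)%N; rewrite addnK.
by rewrite sE si0 be0 mulr0 mulr0 addr0 mulr0.
Qed.

End InfiniteLevel.

(** * Surjectivity of the infinitesimal action *)

Section Surjectivity.
Context {R : realType} {N : nat}.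
Local Notation A := (psr R N).
Local Notation C := R[i].
Local Notation par := {ffun 'I_N -> nat}.
Local Notation zz := (@zz N).
Local Notation par0 := (@par0 N).
Implicit Types (a b c f g h u v w Y : A) (d : exponent N) (n : par) (k j m : nat).
Variables (A0 : R) (A0_neq0 : A0 != 0).
Hypothesis N_gt0 : (0 < N)%N.
Variable b : A.
Hypotheses (b_pure : pure b) (b_rl : rl b).
Local Notation Q := (@Qn R N A0).
Local Notation lead := (pc A0%:C%C * Z ^+ N : A).
Local Notation w0 := (nfA A0 b).

Let b_RR : RR b := RR_pure b_pure b_rl.
Let Den_RR : RR (Den b) := RR_Den b_RR.
Let Q_RR : RR Q := RR_Qn A0.

(** The leading part of the infinitesimal action, together with the normal form
    monomials, has an explicit right inverse; pick divides by Z^j, on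
    the coefficients selected by P, and scales by q: this solves for each of the
    unknowns. *)
Definition pick (P : pred (exponent N)) (q : exponent N -> R) j (f : A) : A :=
  fun d => if (d iz == d iw) && P d then (q d)%:C%C * f (eadd d (zz j par0)) else 0.

Definition solve_nr u : A := dg (fun d => if d iz == (d iw).+1 then 0
  else (ci * ((d iz)%:R - (d iw)%:R - 1))^-1) u.
Definition solve_a u : A := pick (fun d => (d != e0) && (d iz != N))
  (fun d => (2%:R * A0 * ((d iz)%:R - N%:R))^-1) N (Xre u).
Definition solve_c u : A := pick (fun d => sdeg d == 0%N) (fun=> A0^-1) N.*2 (Xre u).
Definition solve_i u : A := pick (fun d => sdeg d == 0%N) (fun=> 1) N (Xim u).
Definition solve_p u (i : 'I_N) : A :=
  pick (fun d => (sdeg d == 0%N) && (1 < pdeg d)%N) (fun=> 1) i (Xre u).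
Definition solve_T u : A := Xim u - Z ^+ N * solve_i u + Z ^+ N * solve_c u.
Definition solve_s u : A :=
  pick (fun d => SX (d iz) (param d) || (d == e0)) (fun=> 1) 0 (Xre u).

Definition solve u : ('I_N -> A) * A * A :=
  (solve_p u, solve_T u, solve_nr u + var iz * solve_a u).
Definition leftover u : A :=
  var iz * (pc ci * (Z ^+ N * (solve_i u - solve_c u)) + solve_s u).

Definition defect u : A := dmap w0 (solve u) + leftover u - u.

Lemma zz_shift k n j : eadd (zz k n) (zz j par0) = zz (k + j) n.
Proof. by apply: expo_slotP => [||i]; rewrite !(zzE, ffunE) // addn0. Qed.

Lemma zz_e0 k n : (zz k n == e0) = (k == 0%N) && (n == par0).
Proof.
have -> : e0 = zz 0 par0 by apply: expo_slotP => [||i]; rewrite !zzE !ffunE.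
apply/eqP/andP => [h|[/eqP -> /eqP ->] //]; split; apply/eqP.
  by have := congr1 (fun x : exponent N => x iz) h; rewrite !zzE.
by apply/ffunP => i; have := congr1 (fun x : exponent N => x (imu i)) h; rewrite !zzE.
Qed.

Lemma RR_pick P q j f : RR f -> RR (pick P q j f).
Proof.
move=> [_ h2]; split=> d; rewrite /pick; first by move=> /negbTE ->.
case: ifP => _; last by rewrite rmorph0.
have cM (s t : C) : ((s * t)^*)%C = (s^*)%C * (t^*)%C by exact: rmorphM.
by rewrite cM h2; congr (_ * _); apply/conjC_eq.
Qed.

Lemma pick_zmod P q j : zmod_morphism (pick P q j).
Proof.
move=> f g; apply/funext => d; rewrite subE /pick; case: ifP => _; last by rewrite subr0.
by rewrite subE mulrBr.
Qed.

Lemma F_pick P q j f m : F m f -> F (m - j.*2) (pick P q j f).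
Proof.
move=> h d; rewrite -/(fg d) => dm; rewrite /pick; case: ifP => // _.
rewrite h ?mulr0 // -/(fg _) fgD fg_zz msz_par0; lia.
Qed.

Lemma pure_pick (P : pred (exponent N)) q j f :
  (forall d, P d -> sdeg d = 0%N) -> pure (pick P q j f).
Proof.
move=> h d s0; rewrite /pick; case: ifP => // /andP[_ /h e].
by rewrite e eqxx in s0.
Qed.

Lemma solve_re u : Zp (solve_p u) + Z ^+ N * (solve_c u * lead) + Lam (solve_a u) lead
  + solve_s u = Xre u.
Proof.
have r1 := RR_Xre u.
have rl0 : RR lead by apply: RRM; [apply: RR_real|apply: RR_ZX].
have rr : RR (Zp (solve_p u) + Z ^+ N * (solve_c u * lead) + Lam (solve_a u) lead + solve_s u).
  apply: RRD; last exact: RR_pick.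
  apply: RRD; last by apply: RR_Lam => //; apply: RR_pick.
  apply: RRD; last by apply: RRM; [apply: RR_ZX|apply: RRM => //; apply: RR_pick].
  by apply: RR_sum => i _; apply: RRM; [apply: RR_ZX|apply: RR_pick].
apply: F_eq => m; apply: RR_F; first exact: RRB.
move=> k n _; rewrite subE; apply/eqP; rewrite subr_eq0; apply/eqP.
have -> : Z ^+ N * (solve_c u * lead) = pc A0%:C%C * (Z ^+ N.*2 * solve_c u).
  by rewrite -addnn exprD; ring.
rewrite !addE pcE Lam_lead_zz /Zp sum_pure_zz; last first.
  by move=> i; apply: pure_pick => d /andP[/eqP].
have cz : A0%:C%C * (Z ^+ N.*2 * solve_c u) (zz k n)
    = if k == N.*2 then Xre u (zz k n) else 0.
  rewrite ZXM_zz; case: leqP => le; last by rewrite (ltn_eqF le) mulr0.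
  rewrite /solve_c /pick !zzE eqxx sdeg_zz double_eq0 subn_eq0 /= zz_shift subnK //.
  rewrite [in RHS]eqn_leq le andbT; case: ifP => _; last by rewrite mulr0.
  by rewrite mulrA -rmorphM /= divff // rmorph1 mul1r.
have pz (i : 'I_N) : nat_of_ord i = k -> solve_p u i (zz 0 n)
    = if (1 < msz n)%N then Xre u (zz k n) else 0.
  move=> ik; rewrite /solve_p /pick !zzE eqxx sdeg_zz pdeg_zz /= zz_shift add0n ik.
  by rewrite mul1r.
have az : (N <= k)%N -> k != N.*2 ->
    2%:R * A0%:C%C * (k%:R - 2%:R * N%:R) * solve_a u (zz (k - N) n)
    = if (k == N) && (n == par0) then 0 else Xre u (zz k n).
  move=> le kN; rewrite /solve_a /pick !zzE eqxx zz_e0 /=.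
  have -> : (k - N != N)%N by apply: contraNneq kN => h; apply/eqP; lia.
  have -> : (k - N == 0)%N = (k == N) by rewrite subn_eq0 eqn_leq le andbT.
  rewrite andbT; case: ((k == N) && (n == par0)) => /=; first by rewrite mulr0.
  have e : (k%:R : C) = (k - N)%:R + N%:R by rewrite -natrD subnK.
  have q0 : 2%:R * A0%:C%C * ((k - N)%:R - N%:R) != 0 :> C.
    rewrite !mulf_neq0 ?pnatr_eq0 ?(A0C A0_neq0) // subr_eq0 eqr_nat.
    by apply: contraNneq kN => h; apply/eqP; lia.
  rewrite zz_shift subnK // mulrA fmorphV !rmorphM rmorphB !rmorph_nat.
  have -> : 2%:R * A0%:C%C * (k%:R - 2%:R * N%:R) = 2%:R * A0%:C%C * ((k - N)%:R - N%:R) :> C.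
    by rewrite e; ring.
  by rewrite divff // mul1r.
have sz : solve_s u (zz k n) = if SX k n || ((k == 0%N) && (n == par0)) then Xre u (zz k n) else 0.
  by rewrite /solve_s /pick !zzE eqxx param_expo zz_e0 /= zz_shift addn0 mul1r.
have np0 : (n == par0) = (msz n == 0%N).
  by apply/eqP/eqP => [->|/msz0 //]; rewrite msz_par0.
rewrite cz sz /SX np0; case: insubP => [i ik iE|kN].
  rewrite pz // ltn_eqF ?addr0; last by move: ik; lia.
  have -> : (N <= k)%N = false by apply/negbTE; rewrite -ltnNge.
  rewrite addr0 ik (ltnW ik) andbT /=; case: (msz n) => [|[|q]] /=; rewrite ?andbF ?orbT /= ?addr0 ?add0r //.
  by case: k {cz sz az pz iE ik}.
rewrite -leqNgt in kN; rewrite kN add0r (ltnNge k N) kN /= ?orbF.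
have -> : (k == 0%N) = false by move: kN N_gt0; case: k {cz sz az pz} => //; case: (N).
rewrite orbF; have -> : (0 < k)%N by apply: leq_trans kN.
have [kE|kE] := eqVneq k N.*2.
  have -> : (k%:R : C) = 2%:R * N%:R by rewrite kE -mul2n natrM.
  rewrite subrr mulr0 mul0r addr0.
  have -> : (k <= N)%N = false by apply/negbTE; rewrite -ltnNge kE; lia.
  by rewrite /= andbF addr0.
rewrite az // add0r np0; have -> : (k <= N)%N = (k == N) by rewrite eqn_leq kN andbT.
by rewrite andbC /=; case: ifP; rewrite ?add0r ?addr0.
Qed.

Definition defect_im u : A :=
  Z ^+ N * grad_b b (solve_p u) + solve_T u * (Z ^+ N * b) - solve_a u * Eul (Den b).
Definition defect_re u : A := Lam (solve_a u) (Q - lead)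
  + (Xim u - Z ^+ N * solve_i u) * Q + Z ^+ N * (solve_c u * (Q - lead)).

Lemma bracket_solve_nr u : bracket (solve_nr u) iZ = unr u :> A.
Proof.
rewrite bracket_iZ; apply/funext => d; rewrite pcE subE ThetaE /solve_nr /dg /unr.
case: eqP => [_|/eqP dd]; first by rewrite mul0r mulr0 subrr mulr0.
have c0 : (d iz)%:R - (d iw)%:R - 1 != 0 :> C.
  by rewrite -addrA -opprD subr_eq0 natr1 eqr_nat.
set t := (d iz)%:R - (d iw)%:R in c0 *.
transitivity (ci * (t - 1) / (ci * (t - 1)) * u d); first by ring.
by rewrite divff ?mul1r // mulf_neq0 // ci_neq0.
Qed.

Lemma defectE u : defect u =
  bracket (solve_nr u) (w0 - iZ) + var iz * (pc ci * defect_im u + defect_re u) :> A.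
Proof.
have ar : RR (solve_a u) by apply: RR_pick; apply: RR_Xre.
have dr := dmap_res A0 b_pure b_rl (solve_p u) (solve_T u) ar (@RR0 R N).
have E0 : Eul 0 = 0 :> A by apply/funext => d; rewrite EulE mulr0.
rewrite E0 !mulr0 addr0 add0r in dr.
have dE : dmap w0 (solve u) = bracket (solve_nr u) w0
    + dmap w0 (solve_p u, solve_T u, var iz * solve_a u) :> A.
  by rewrite !dmapE /= !bracketE DDl raddfD /=; ring.
have bE : bracket (solve_nr u) w0 = bracket (solve_nr u) (w0 - iZ) + unr u :> A.
  by rewrite -bracket_solve_nr bracket_zmod subrK.
have uE := res_split u; rewrite -(solve_re u) in uE.
apply/eqP; rewrite /defect dE bE dr subr_eq; apply/eqP; rewrite [X in _ = _ + X]uE.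
by rewrite /leftover /defect_im /defect_re Lam_zmod /solve_T /Den; ring.
Qed.

Lemma defect_zmod : zmod_morphism defect.
Proof.
have a_zm : zmod_morphism solve_a by move=> f g; rewrite /solve_a Xre_zmod pick_zmod.
have c_zm : zmod_morphism solve_c by move=> f g; rewrite /solve_c Xre_zmod pick_zmod.
have i_zm : zmod_morphism solve_i by move=> f g; rewrite /solve_i Xim_zmod pick_zmod.
have p_zm i : zmod_morphism (solve_p^~ i) by move=> f g; rewrite /solve_p Xre_zmod pick_zmod.
have n_zm : zmod_morphism solve_nr.
  by move=> f g; apply/funext => d; rewrite subE /solve_nr /dg subE mulrBr.
have T_zm : zmod_morphism solve_T.
  by move=> f g; rewrite /solve_T Xim_zmod i_zm c_zm; ring.
have g_zm : zmod_morphism (fun u => grad_b b (solve_p u)).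
  move=> f g; rewrite /grad_b -sumrB; apply: eq_bigr => i _.
  by rewrite (p_zm i f g) mulrBr.
have im_zm : zmod_morphism defect_im.
  by move=> f g; rewrite /defect_im g_zm T_zm a_zm; ring.
have re_zm : zmod_morphism defect_re.
  move=> f g; rewrite /defect_re /Lam Xim_zmod i_zm c_zm a_zm; move: (Q - lead) => q.
  by rewrite EulB; ring.
move=> f g; rewrite !defectE n_zm im_zm re_zm; move: (w0 - iZ) => ww.
by rewrite !bracketE DBl raddfB /=; ring.
Qed.

Lemma F_defect_im m u : F m u -> F m.-1 (defect_im u).
Proof.
move=> um; have X1 := F_Xre um; have X2 := F_Xim um.
have aF : F (m.-1 - N.*2) (solve_a u) by apply: F_pick.
have TF : F (m.-1 - N.*2) (solve_T u).
  apply: FilD.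
    apply: FilB; first by apply: Fil_le X2; lia.
    by apply: FilMl; apply: F_pick.
  by apply: Fil_le (F_ZXM (k := N) (F_pick (j := N.*2) _ _ X1)); lia.
have DF : F N.*2 (Eul (Den b)).
  have -> : Eul (Den b) = Eul (Z ^+ N * b).
    by rewrite /Den EulD (pure_Eul (f := 1)) ?add0r // -(rmorph1 pc); apply: pure_pc.
  by apply: F_Eul; apply: FilMr; apply: F_ZX.
apply: FilB; last by apply: Fil_le (FilM aF DF); lia.
apply: FilD; last by apply: Fil_le (FilM TF (FilMr b (@F_ZX R N N))); lia.
have gF : F (m.-1 - N.*2) (grad_b b (solve_p u)).
  apply: Fil_sum => i _; apply: FilMl; apply: Fil_le (F_pick (j := i) _ _ X1).
  by have := ltn_ord i; lia.
by apply: Fil_le (F_ZXM (k := N) gF); lia.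
Qed.

Lemma F_defect m u : F m u -> F m.+1 (defect u - var iz * (pc ci * defect_im u)).
Proof.
move=> um; have X1 := F_Xre um; have X2 := F_Xim um.
have -> : defect u - var iz * (pc ci * defect_im u)
    = bracket (solve_nr u) (w0 - iZ) + var iz * defect_re u :> A.
  by rewrite defectE; ring.
have QlF := @F_Qn_lead R N A0.
have wF : F N.*2.+1 (w0 - iZ).
  have -> : w0 - iZ = var iz * (pc ci * (Z ^+ N * b) + Q) by rewrite /nfA /iZ /Den; ring.
  rewrite -add1n; apply: FilM; first exact: F_varz.
  by apply: FilD; [apply: FilMl; apply: FilMr; apply: F_ZX|apply: F_Qn].
apply: FilD.
  have nF : F m (solve_nr u) by apply: Fil_dg.
  rewrite bracketE; apply: FilB.
    by apply: Fil_le (F_D wF nF); lia.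
  by apply: Fil_le (F_D nF wF); lia.
suff h : F m (defect_re u) by rewrite -add1n; apply: FilM => //; apply: F_varz.
apply: FilD; last first.
  have cF : F (m.-1 - N.*2.*2) (solve_c u) by apply: F_pick.
  by apply: Fil_le (F_ZXM (k := N) (FilM cF QlF)); lia.
apply: FilD.
  have aF : F (m.-1 - N.*2) (solve_a u) by apply: F_pick.
  by apply: Fil_le (Lam_raises aF QlF); lia.
have iF : F m.-1 (Xim u - Z ^+ N * solve_i u).
  apply: FilB => //; have h : F (m.-1 - N.*2) (solve_i u) by apply: F_pick.
  by apply: Fil_le (F_ZXM (k := N) h); lia.
by apply: Fil_le (FilM iF (F_Qn A0)); lia.
Qed.

Lemma F_defect1 m u : F m u -> F m (defect u).
Proof.
move=> um; apply: Fil_sub (Fil_le (leqnSn m) (F_defect um)) _.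
by apply: Fil_le (FilM (@F_varz R N) (FilMl (pc ci) (F_defect_im um))); lia.
Qed.

Lemma F_defect_imaginary m r : RR r -> F m.-1 r -> F m.+1 (defect (var iz * (pc ci * r))).
Proof.
move=> rr rF; set u := var iz * _.
have [n0 i0 r0] : [/\ - unr u = 0, r - Xim u = 0 & - Xre u = 0].
  apply: res_split_unique.
  - by move=> d dd; rewrite oppE nres_unr ?oppr0.
  - by apply: RRB => //; apply: RR_Xim.
  - by apply: RRN; apply: RR_Xre.
  - have -> : - unr u + var iz * (pc ci * (r - Xim u) + - Xre u)
       = u - (unr u + var iz * (pc ci * Xim u + Xre u)) by rewrite /u; ring.
    by rewrite -res_split subrr.
have {}i0 : Xim u = r by apply/eqP; rewrite eq_sym -subr_eq0 i0.
have {}r0 : Xre u = 0 by rewrite -[Xre u]opprK r0 oppr0.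
have pk0 P q j : pick P q j 0 = 0 by exact: zm0 (pick_zmod P q j).
have nr0 : solve_nr u = 0.
  apply/funext => d; rewrite /solve_nr /dg; case: eqP => [_|dd]; first by rewrite mul0r.
  have -> : u d = unr u d by rewrite /unr; case: eqP.
  by rewrite -[unr u]opprK n0 oppr0 zeroE mulr0.
have iF : F (m.-1 - N.*2) (solve_i u) by rewrite /solve_i i0; apply: F_pick.
have TF : F m.-1 (r - Z ^+ N * solve_i u).
  by apply: FilB => //; apply: Fil_le (F_ZXM (k := N) iF); lia.
have a0 : solve_a u = 0 by rewrite /solve_a r0.
have c0 : solve_c u = 0 by rewrite /solve_c r0.
have g0 : grad_b b (solve_p u) = 0.
  by rewrite /grad_b big1 // => i _; rewrite /solve_p r0 pk0 mulr0.
have T0 : solve_T u = r - Z ^+ N * solve_i u by rewrite /solve_T c0 i0 mulr0 addr0.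
rewrite defectE nr0 /defect_im /defect_re a0 c0 g0 T0 i0 /Lam.
have -> : bracket 0 (w0 - iZ) = 0 :> A.
  by rewrite bracketE raddf0 /D mul0r rmorph0 mul0r addr0 subr0.
have E0 : Eul 0 = 0 :> A by apply/funext => d; rewrite EulE mulr0.
rewrite E0 !(mulr0, mul0r, subr0, oppr0, add0r, addr0).
apply: Fil_le (FilM (@F_varz R N) (n := 1) (m := (m.-1 + N.*2)%N) _) ; first by lia.
apply: FilD; last by apply: FilM => //; apply: F_Qn.
by apply: FilMl; apply: FilM => //; apply: FilMr; apply: F_ZX.
Qed.

Lemma RR_defect_im u : RR (defect_im u).
Proof.
have r1 := RR_Xre u; have r2 := RR_Xim u.
apply: RRB; last by apply: RRM; [apply: RR_pick|apply: RR_Eul].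
apply: RRD.
  apply: RRM; first exact: RR_ZX.
  by apply: RR_sum => i _; apply: RRM; [apply: RR_pd_mu|apply: RR_pick].
apply: RRM; last by apply: RRM => //; apply: RR_ZX.
apply: RRD; last by apply: RRM; [apply: RR_ZX|apply: RR_pick].
by apply: RRB => //; apply: RRM; [apply: RR_ZX|apply: RR_pick].
Qed.

Lemma defect2_raises : raises 1 (fun u => - defect (defect u)).
Proof.
move=> m u um; rewrite addn1; apply: FilN.
set r := var iz * (pc ci * defect_im u).
have -> : defect u = (defect u - r) + r by rewrite subrK.
rewrite (zmD _ _ defect_zmod); apply: FilD.
  exact: F_defect1 (F_defect um).
apply: F_defect_imaginary; [exact: RR_defect_im|exact: F_defect_im].
Qed.

Lemma ws_defect u : Fil ws 1 u -> Fil ws 1 (defect u).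
Proof.
move=> h; rewrite defectE; apply: FilD; last exact: Fws_z.
apply: bracket_ws; first exact: Fil_dg.
by rewrite /nfA /iZ -mulrBr; apply: Fws_z.
Qed.

(** The right inverse of the leading part solves the equation up to a defect.
    The defect does not raise the order, because the radial solution feeds back
    into the angular equation at the same order; but it maps angular errors to
    higher order, so its square raises the order and id + defect has the inverse
    (id - defect) (id - defect^2)^-1. *)
Lemma nf_surjective (u : A) : Lf 1 u -> exists (Y : ('I_N -> A) * A * A) (s : A),
  [/\ filtA 1 Y, fspan (@nf_monomials N) s & u = dmap w0 Y + s].
Proof.
move=> [uws u2]; pose E2 u := - defect (defect u).
have z2 : zmod_morphism E2.
  by move=> f g; rewrite /E2 !defect_zmod; ring.
pose v := neumann E2 u; pose x := v - defect v.
have vE : v - defect (defect v) = u := neumannP z2 defect2_raises u.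
have xE : x + defect x = u.
  by rewrite -vE /x defect_zmod; ring.
have v2 : F 2 v.
  apply: (neumann_zero (S := fun d => (wdeg wa d < 2)%N)) u2 => g hg.
  by apply: FilN; apply: F_defect1; apply: F_defect1.
have vws : Fil ws 1 v.
  apply: (neumann_zero (S := fun d => (wdeg ws d < 1)%N)) uws => g hg.
  by apply: FilN; apply: ws_defect; apply: ws_defect.
have x2 : F 2 x by apply: FilB => //; apply: F_defect1.
have xws : Fil ws 1 x by apply: FilB => //; apply: ws_defect.
have X1 := F_Xre x2; have X2 := F_Xim x2.
have Xe0 : Xre x e0 = 0 by apply: X1; rewrite wdeg0.
exists (solve x), (leftover x); split.
- split=> /=.
  + move=> i d; rewrite /solve_p /pick; case: ifP => [|_]; last by rewrite eqxx.
    case/andP => dd /andP[/eqP s0 p1] _; split=> //.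
      apply/conjC_eq; have [_ r] := RR_pick (fun d => (sdeg d == 0%N) && (1 < pdeg d)%N)
        (fun=> 1) i (RR_Xre x); have := r d.
      by rewrite /pick dd s0 p1.
    by rewrite add1n /weight; nia.
  + move=> d dT; have [r1 r2] : RR (solve_T x).
      apply: RRD; last by apply: RRM; [apply: RR_ZX|apply: RR_pick; apply: RR_Xre].
      apply: RRB; first exact: RR_Xim.
      by apply: RRM; [apply: RR_ZX|apply: RR_pick; apply: RR_Xim].
    have T1 : F 1 (solve_T x).
      apply: FilD; last by apply: FilMr; apply: Fil_le (@F_ZX R N N); lia.
      apply: FilB; first exact: X2.
      by apply: FilMr; apply: Fil_le (@F_ZX R N N); lia.
    split; last first.
    - by apply: contraNT dT; rewrite -ltnNge => h; apply/eqP; apply: T1; rewrite -/(fg d) fgE.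
    - by apply/conjC_eq.
    - by apply/eqP; apply: contraNT dT => h; apply/eqP; apply: r1.
  + apply/filtLP => //; apply: LfD.
      by split; apply: Fil_dg.
    apply: Lf_z => d; rewrite -/(fg d) => d1; rewrite /solve_a /pick.
    have -> : d = e0.
      by apply: exponentP => s; have := exp_le_fg d s; rewrite ffunE; lia.
    by rewrite eqxx /= andbF.
- apply/fspan_nf => //; exists (solve_i x - solve_c x), (solve_s x); split=> //.
  + rewrite /solve_i /solve_c; apply: pureD; last apply: pureN.
      by apply: pure_pick => d /eqP.
    by apply: pure_pick => d /eqP.
  + by apply: RRB; apply: RR_pick; [apply: RR_Xim|apply: RR_Xre].
  + by apply: RR_pick; apply: RR_Xre.
  + move=> k n kn; rewrite /solve_s /pick !zzE eqxx param_expo (negbTE kn) /=.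
    case: eqP => // ->; have -> : eadd e0 (zz 0 par0) = e0 :> exponent N.
      by apply: expo_slotP => [||i]; rewrite !(zzE, ffunE).
    by rewrite Xe0 mulr0.
- rewrite -[LHS]xE; have -> : (dmap w0 (solve x) + leftover x : A) = x + defect x.
    by rewrite /defect; ring.
  by [].
Qed.

End Surjectivity.

Section InfiniteLevelNormalForm.
Context {R : realType} {N : nat}.
Local Notation A := (psr R N).
Local Notation par := {ffun 'I_N -> nat}.

Lemma nf_infinite_level (A0 : R) (B : par -> R) : A0 != 0 -> (0 < N)%N ->
  infinite_level_normal_form (nfA A0 (bser B)).
Proof.
move=> A0_neq0 N_gt0.
have bp := pure_bser B; have br := rl_bser B.
exists (@nf_monomials N); split.
- by move=> x /(nf_monomials_valid N_gt0).
- have -> : nfA A0 (bser B) - vmonomial_series (@Y10 N)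
     = var iz * (pc ci * (Z ^+ N * bser B) + Qn A0) :> A.
    rewrite vmonomial_seriesE /= -[mono _]/(var iz) /nfA /Den.
    by move: (bser B) (Qn A0) => b q; ring.
  apply/fspan_nf => //; exists (bser B), (Qn A0); split=> //.
  + exact: RR_pure.
  + exact: RR_Qn.
  + by move=> k n; apply: Qn_support.
- by move=> u /filtLP-/(_ isT); apply: nf_surjective.
- by move=> [[p T] Y]; apply: nf_direct.
Qed.

End InfiniteLevelNormalForm.

(** * Transformations as equivalences of vector fields *)

Section Equivalences.
Context {R : realType} {N : nat}.
Local Notation A := (psr R N).
Local Notation C := R[i].
Local Notation par := {ffun 'I_N -> nat}.
Local Notation transf := (@transformation R N).
Implicit Types (a b c f g u v w Y T : A) (h : 'I_N -> A) (d : exponent N) (n k m : nat).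

(** The substitutions that occur: real, compatible with the parameters, and
    tangent to the identity in z. A linear reparametrization is not close to the
    identity, so only z is constrained. *)
Record auto (Phi : A -> A) : Prop := Auto {
  auto_hom : shom Phi;
  auto_cs : forall f, Phi (cs f) = cs (Phi f);
  auto_pure : forall f, pure f -> pure (Phi f);
  auto_z : F 2 (Phi (var iz) - var iz) }.

Definition real_unit T : Prop := cs T = T /\ F 1 (T - 1).

(** Phi conjugates the field u to the field v up to the change of time T and up
    to terms of order n; working modulo an order avoids infinite compositions of
    transformations. *)
Definition orbital n (Phi : A -> A) T u v : Prop := [/\ auto Phi, real_unit T
  & forall f, F n (Phi (D u f) - T * D v (Phi f))].

Definition orb_equiv n u v : Prop := exists Phi T, orbital n Phi T u v.

Lemma real_unit1 : real_unit 1.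
Proof. by split; [rewrite rmorph1|rewrite subrr]. Qed.

Lemma real_unitM T1 T2 : real_unit T1 -> real_unit T2 -> real_unit (T1 * T2).
Proof.
move=> [c1 f1] [c2 f2]; split; first by rewrite rmorphM /= c1 c2.
have -> : T1 * T2 - 1 = (T1 - 1) * T2 + (T2 - 1) by ring.
by apply: FilD => //; apply: FilMr.
Qed.

Lemma real_unit_hom Phi T : auto Phi -> real_unit T -> real_unit (Phi T).
Proof.
move=> hP [c1 f1]; split; first by rewrite -(auto_cs hP) c1.
by rewrite -(hom1 (auto_hom hP)) -(homB (auto_hom hP)); apply: (homF (auto_hom hP)).
Qed.

Lemma real_unitV T : real_unit T -> exists2 T', real_unit T' & T * T' = 1.
Proof.
move=> [cT fT]; have [k [k1 _ kF]] := inv_unit fT.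
have {}k1 : T * k = 1 by rewrite -k1; congr (_ * _); ring.
exists k => //; split; last exact: kF.
have : T * cs k = 1 by rewrite -{1}cT -rmorphM k1 rmorph1.
move=> e; transitivity (T * k * cs k); first by rewrite k1 mul1r.
by transitivity (k * (T * cs k)); [ring|rewrite e mulr1].
Qed.

Lemma auto_id : auto id.
Proof. by split=> //; rewrite subrr. Qed.

Lemma auto_comp Phi Psi : auto Phi -> auto Psi -> auto (Phi \o Psi).
Proof.
move=> h1 h2; split=> [|f|f pf|] /=.
- by apply: hom_comp; apply: auto_hom.
- by rewrite (auto_cs h2) (auto_cs h1).
- by apply: (auto_pure h1); apply: (auto_pure h2).
- apply: Fil_trans (auto_z h1); rewrite -(homB (auto_hom h1)).
  by apply: (homF (auto_hom h1)); apply: auto_z.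
Qed.

(** The inverse comes from the Neumann series, and it inherits every property by
    injectivity. *)
Lemma auto_inv Phi : auto Phi -> raises 1 (fun f => Phi f - f) ->
  exists2 Phi', auto Phi' & cancel Phi Phi' /\ cancel Phi' Phi.
Proof.
move=> hP hr; have hh := auto_hom hP; pose E f := Phi f - f.
have Ez : zmod_morphism E by move=> f g; rewrite /E (homB hh); ring.
have K1 f : neumann E (Phi f) = f.
  by rewrite -{2}(neumannK Ez hr f); congr (neumann E _); rewrite /E; ring.
have K2 f : Phi (neumann E f) = f.
  by rewrite -{2}(neumannP Ez hr f) /E; ring.
have inj f g : Phi f = Phi g -> f = g by move=> e; rewrite -(K1 f) e K1.
have FE m f : F m f -> F m (neumann E f).
  move=> hf; apply: (neumann_zero (S := fun d => (wdeg wa d < m)%N)) hf => g hg.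
  by apply: FilB; [apply: (homF hh)|].
exists (neumann E); last by split.
have hh' : shom (neumann E).
  split=> [f g|f g|c|//].
  - by apply: inj; rewrite (homB hh) !K2.
  - by apply: inj; rewrite (homM hh) !K2.
  - by apply: inj; rewrite (hom_pc hh) !K2.
split=> // [f|f pf|].
- by apply: inj; rewrite (auto_cs hP) !K2.
- apply: (neumann_zero (S := fun d => sdeg d != 0%N)) pf => g hg.
  by apply: pureD; [apply: (auto_pure hP)|apply: pureN].
- rewrite -{2}(K1 (var iz)) -(homB hh'); apply: (homF hh').
  exact/FilBC/auto_z.
Qed.

Lemma exps_cs (X : A -> A) f : nilop X -> (forall g, X (cs g) = cs (X g)) ->
  exps X (cs f) = cs (exps X f).
Proof.
move=> hX hc; apply/F_eq => m; have close g := F_exps_upto (n := m) g hX.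
apply: Fil_trans (close (cs f)) _; apply: (Fil_trans (g := cs (exps_upto X m f))); last first.
  by rewrite -rmorphB; apply: F_cs; apply: FilBC; apply: close.
suff -> : cs (exps_upto X m f) = exps_upto X m (cs f) by rewrite subrr.
rewrite /exps_upto rmorph_sum; apply: eq_bigr => k _.
rewrite rmorphM /= cs_pc invfact_real; congr (_ * _).
by elim: (nat_of_ord k) => //= j IH; rewrite -IH hc.
Qed.

Lemma auto_exps Y : F 2 Y -> auto (exps (D Y)).
Proof.
move=> Y2; have hX := D_nilop Y2; have Er := exps_raises hX hX.2 isT.
split=> [|f|f pf|].
- split=> [|f g|c|n f hf].
  + exact: exps_zmod.
  + apply: (exps_pair (p := fun f g : A => f * g)) => //.
    * by move=> h k l; rewrite mulrBr.
    * by move=> h k l; rewrite mulrBl.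
    * by move=> n m h k hh hk; apply: Fil_le (leq_pred _) _; apply: FilM.
    * by move=> h k; rewrite DM.
  + by apply: exps_fixed => //; rewrite D_pc.
  + by rewrite -[exps _ f](subrK f); apply: FilD => //; apply: Fil_le (Er _ _ hf); lia.
- by apply: exps_cs => // g; rewrite cs_D.
- by rewrite exps_fixed // pure_D.
- exact: Er (@F_varz R N).
Qed.

Lemma phiS_D Y u f : Lf 1 Y -> Lf 0 u ->
  exps (D (- Y)) (D u f) = D (phiS Y u) (exps (D (- Y)) f).
Proof.
move=> hY hu; have Y2 := hY.2; rewrite phiS_exps //.
have hD : nilop (D (- Y)) by apply: D_nilop; apply: FilN.
apply: (exps_pair (p := fun v f : A => D v f)) => //.
- exact: bracket_nilop.
- by move=> v; apply: raddfB.
- by move=> g v w; rewrite DBl.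
- by move=> n m v g hv hg; apply: F_D.
- move=> v g; rewrite bracketE !DNl raddfN /=.
  have := D_bracket Y v g => e; rewrite -[D v Y - D Y v]opprB DNl -e; ring.
Qed.

(** Near-identity and linear reparametrizations are both of this kind. *)
Definition reparam (h : 'I_N -> A) : Prop :=
  forall i, [/\ F (@weight N) (h i), pure (h i) & cs (h i) = h i].

Lemma auto_reparam h : reparam h -> auto (subst (sub_mu h)).
Proof.
move=> hh; have hF : forall s, F (wa s) (sub_mu h s).
  by apply: sub_mu_F => i; have [] := hh i.
split=> [|f|f pf|].
- exact: hom_subst.
- apply: subst_cs => //; rewrite /sub_mu ?coordsE; first by rewrite cs_var.
  by move=> i; rewrite coordsE; have [] := hh i.
- by apply: pure_subst => // i; rewrite /sub_mu coordsE; have [] := hh i.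
- by rewrite subst_var // /sub_mu coordsE subrr.
Qed.

Lemma reparam_D h u f : reparam h ->
  subst (sub_mu h) (D u f) = D (subst (sub_mu h) u) (subst (sub_mu h) f).
Proof.
move=> hh; have ha := auto_reparam hh; have hP := auto_hom ha.
set Phi := subst (sub_mu h) in ha hP *.
have hF : forall s, F (wa s) (sub_mu h s) by apply: sub_mu_F => i; have [] := hh i.
apply: F_eq => k; move: f.
apply: (hom_deriv_ext (Phi := Phi) (d1 := fun f => Phi (D u f)) (d2 := fun f => D (Phi u) (Phi f))) => //.
- by move=> f g; rewrite raddfB (homB hP).
- by move=> f g; rewrite (homB hP) raddfB.
- by move=> c; rewrite D_pc (hom0 hP).
- by move=> c; rewrite (hom_pc hP) D_pc.
- by move=> f g; rewrite DM (homD hP) !(homM hP).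
- by move=> f g; rewrite (homM hP) DM.
- by move=> m f hf; apply: (homF hP); have := F_D (Fil0 u) hf; rewrite add0n subn1.
- by move=> m f hf; have := F_D (Fil0 (Phi u)) (homF hP hf); rewrite add0n subn1.
- move=> s; rewrite /Phi subst_var // -/Phi /sub_mu.
  case: (slotP s) => [->|->|[i ->]]; rewrite !coordsE !D_var ?subrr //.
    by rewrite (auto_cs ha) subrr.
  by rewrite (hom0 hP) pure_D ?subrr //; have [] := hh i.
Qed.

Lemma reparam_Lf h u : reparam h -> Lf 0 u -> Lf 0 (subst (sub_mu h) u).
Proof.
move=> hh [u1 u2]; have hF : forall s, F (wa s) (sub_mu h s).
  by apply: sub_mu_F => i; have [] := hh i.
split; last exact: Fil_subst.
apply: Fil_subst => // s; have := Fil_var (wt := ws) (s := s).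
by case: (slotP s) => [->|->|[i ->]]; rewrite /sub_mu /ws !coordsE.
Qed.

Definition lin_mu (M : 'M[R]_N) (i : 'I_N) : A := \sum_(j < N) pc (M i j)%:C%C * var (imu j).

Lemma phiLinE M u : phiLin M u = subst (sub_mu (lin_mu M)) u.
Proof.
rewrite /phiLin /reparametrize /subst; congr (ssubst (coords _ _ _) _).
by apply/funext => i; apply: eq_bigr => j _; rewrite scaleE.
Qed.

Lemma reparam_lin M : reparam (lin_mu M).
Proof.
move=> i; split.
- by apply: Fil_sum => j _; apply: FilMl; apply: F_varmu.
- apply: (big_ind (@pure R N)) => [||j _] //; first exact: pureD.
  by apply: pureM; [apply: pure_pc|apply: pure_var].
- rewrite rmorph_sum; apply: eq_bigr => j _; rewrite rmorphM /= cs_pc cs_var.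
  by congr (pc _ * _); apply/conjC_eq.
Qed.

Lemma reparam_linM M M' f : M' *m M = 1%:M ->
  subst (sub_mu (lin_mu M)) (subst (sub_mu (lin_mu M')) f) = f.
Proof.
move=> MM; have hP L := auto_hom (auto_reparam (reparam_lin L)).
have hF L : forall s, F (wa s) (sub_mu (lin_mu L) s).
  by apply: sub_mu_F => i; have [] := reparam_lin L i.
have hid : shom (id : A -> A) by split.
apply: (hom_ext (hom_comp (hP M) (hP M')) hid) => s /=; rewrite subst_var // {2}/sub_mu.
case: (slotP s) => [->|->|[i ->]]; rewrite coordsE ?subst_var // /sub_mu ?coordsE //.
rewrite {1}/lin_mu (hom_sum (hP M)).
under eq_bigr => j _ do rewrite (homM (hP M)) (hom_pc (hP M)) subst_var // /sub_mu coordsE mulr_sumr.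
rewrite exchange_big /=.
transitivity (\sum_(k < N) pc ((M' *m M) i k)%:C%C * var (imu k) : A).
  apply: eq_bigr => k _; rewrite mxE !rmorph_sum mulr_suml; apply: eq_bigr => j _ /=.
  by rewrite !rmorphM mulrA.
rewrite MM (bigD1 i) //= mxE eqxx !rmorph1 mul1r big1 ?addr0 // => j ji.
by rewrite mxE eq_sym (negbTE ji) mulr0n !rmorph0 mul0r.
Qed.

(** Each transformation is induced by an invertible substitution that maps the
    derivation of the old field to a real multiple of that of the new one:
    state changes by exp (- D Y), time rescalings by the identity with the
    factor 1 / (1 + T), reparametrizations by themselves. *)
Lemma transform_conj (t : transf) u : admissible t -> Lf 0 u ->
  exists Phi Phi' T, [/\ auto Phi /\ auto Phi', cancel Phi Phi', cancel Phi' Phi,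
    real_unit T & forall f, Phi (D u f) = T * D (transform t u) (Phi f)].
Proof.
case: t => [Y|T|Y|M] /= ht hu.
- have hY := proj1 (filtLP _ (leqnn 1)) ht.
  have Y2 : F 2 (- Y) by apply: FilN; case: hY.
  have hX := D_nilop Y2; have ha := auto_exps Y2.
  have [Phi' ha' [K1 K2]] := auto_inv ha (exps_raises hX hX.2 isT).
  exists (exps (D (- Y))), Phi', 1; split=> //; first exact: real_unit1.
  by move=> f; rewrite mul1r phiS_D.
- have TF : F 1 (T : A) := filtR_F ht.
  have Tr : cs T = T.
    apply: RR_cs; split=> d; first by move=> dd; apply/eqP; apply: contraNT dd => /ht[->].
    by have [->|/ht[_ ? _]] := eqVneq (T d) 0; [rewrite rmorph0|apply/conjC_eq].
  have Tu : real_unit ((1 : A) + (T : A)).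
    by split; [rewrite rmorphD rmorph1 /= Tr|rewrite addrAC subrr add0r].
  have [T' Tu' TT] := real_unitV Tu.
  exists id, id, T'; split=> //; first by split; apply: auto_id.
  move=> f; have -> : phiT T u = ((1 : A) + (T : A)) * u :> A by rewrite mulrDl mul1r.
  by rewrite DMl; [rewrite mulrA [T' * _]mulrC TT mul1r|case: Tu].
- pose h i := var (imu i) + Y i : A.
  have hh : reparam h.
    move=> i; have [f1 f2 f3] := filtP_F ht i; split.
    + by apply: FilD; [apply: F_varmu|apply: Fil_le f1; lia].
    + by apply: pureD => //; apply: pure_var.
    + by rewrite rmorphD /= f3 cs_var.
  have ha := auto_reparam hh.
  have [Phi' ha' [K1 K2]] := auto_inv ha (phiP_raises ht).
  exists (subst (sub_mu h)), Phi', 1; split=> //; first exact: real_unit1.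
  by move=> f; rewrite mul1r reparam_D.
- have h1 : M *m invmx M = 1%:M by exact: mulmxV.
  have h2 : invmx M *m M = 1%:M by exact: mulVmx.
  have ha L := auto_reparam (reparam_lin L).
  exists (subst (sub_mu (lin_mu M))), (subst (sub_mu (lin_mu (invmx M)))), 1; split=> //.
  + by move=> f; apply: reparam_linM.
  + by move=> f; apply: reparam_linM.
  + exact: real_unit1.
  + by move=> f; rewrite mul1r phiLinE reparam_D //; apply: reparam_lin.
Qed.

Lemma transform_Lf0 (t : transf) u : admissible t -> Lf 0 u -> Lf 0 (transform t u).
Proof.
case: t => [Y|T|Y|M] ht hu; try exact: (near_step0 (n := 1)) ht hu.
by rewrite /= phiLinE; apply: reparam_Lf => //; apply: reparam_lin.
Qed.

Lemma orbital_comp n (P1 P2 : A -> A) T1 T2 u v w : orbital n P1 T1 u v ->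
  orbital n P2 T2 v w -> orbital n (P2 \o P1) (P2 T1 * T2) u w.
Proof.
move=> [a1 t1 r1] [a2 t2 r2]; split.
- exact: auto_comp.
- by apply: real_unitM => //; apply: real_unit_hom.
- move=> f /=; have hP := auto_hom a2.
  have -> : P2 (P1 (D u f)) - P2 T1 * T2 * D w (P2 (P1 f)) =
     P2 (P1 (D u f) - T1 * D v (P1 f)) + P2 T1 * (P2 (D v (P1 f)) - T2 * D w (P2 (P1 f))).
    by rewrite (homB hP) (homM hP); ring.
  by apply: FilD; [apply: (homF hP); apply: r1|apply: FilMl; apply: r2].
Qed.

Lemma orb_trans n u v w : orb_equiv n u v -> orb_equiv n v w -> orb_equiv n u w.
Proof.
move=> [P1 [T1 h1]] [P2 [T2 h2]].
by exists (P2 \o P1), (P2 T1 * T2); apply: orbital_comp h1 h2.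
Qed.

Lemma orb_near n u v : F n.+1 (u - v) -> orb_equiv n u v.
Proof.
move=> h; exists id, 1; split; [exact: auto_id|exact: real_unit1|].
by move=> f; rewrite mul1r -DBl; have := F_D h (Fil0 f); rewrite addn0.
Qed.

Lemma orb_transform n (t : transf) u : admissible t -> Lf 0 u ->
  orb_equiv n u (transform t u) /\ orb_equiv n (transform t u) u.
Proof.
move=> ht hu; have [P [P' [T [[a1 a2] K1 K2 hT hr]]]] := transform_conj ht hu.
split; first by exists P, T; split=> // f; rewrite hr subrr.
have [T' hT' TT] := real_unitV hT.
exists P', (P' T'); split=> //; first exact: real_unit_hom.
move=> f; have -> : P' T' * D u (P' f) = P' (T' * P (D u (P' f))).
  by rewrite (homM (auto_hom a2)) K1.
by rewrite hr mulrA [T' * T]mulrC TT mul1r K2 subrr.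
Qed.

(** Up to order n a convergent sequence of transformations is a finite one. *)
Lemma transforms_to_orb v w n : Lf 0 v -> transforms_to v w ->
  orb_equiv n v w /\ orb_equiv n w v.
Proof.
move=> hv [t [u [u0 st lim]]].
have hu k : Lf 0 (u k) /\ orb_equiv n v (u k) /\ orb_equiv n (u k) v.
  elim: k => [|k [IH1 [IH2 IH3]]].
    by rewrite u0; split=> //; split; apply: orb_near; rewrite subrr.
  have [ht ->] := st k; split; first exact: transform_Lf0.
  have [o1 o2] := orb_transform n ht IH1.
  by split; [apply: orb_trans o1|apply: orb_trans IH3].
have [K /(_ K (leqnn K))[_ hK]] := lim n.+1.
have [_ [o1 o2]] := hu K; have [_ wF] := proj1 (filtLP _ (ltn0Sn n)) hK.
have {}wF : F n.+1 (u K - w : A) by apply: Fil_le wF.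
split; first by apply: orb_trans o1 _; apply: orb_near.
by apply: orb_trans o2; apply: orb_near; apply: FilBC.
Qed.

End Equivalences.

(** * Normalization of an equivalence between resonant fields *)

Section ResonantEquivalence.
Context {R : realType} {N : nat}.
Local Notation A := (psr R N).
Local Notation C := R[i].
Local Notation z := (var iz : A).
Local Notation w := (var iw : A).
Implicit Types (a b c f g u v Y T : A) (d : exponent N) (n k m : nat).

(** The resonant field z' = z (i + g). *)
Definition amp g : A := z * (pc ci + g).

Lemma D_amp g f : RR g -> D (amp g) f = pc ci * Theta f + g * Eul f.
Proof.
move=> gr; rewrite /amp -[pc ci]mulr1 D_zir ?rmorph1 //.
exact: RR_cs.
Qed.

Lemma cs_dg (lam : exponent N -> C) f : (forall d, lam (sw d) = ((lam d)^*)%C) ->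
  cs f = f -> cs (dg lam f) = dg lam f.
Proof.
move=> hl hf; apply/funext => d; rewrite csE /dg.
have cM (s t : C) : ((s * t)^*)%C = (s^*)%C * (t^*)%C by exact: rmorphM.
by rewrite cM -(csE f) hf -hl swK.
Qed.

Lemma real_coef f d : cs f = f -> d iz = d iw -> ((f d)^*)%C = f d.
Proof.
move=> hf dd; rewrite -{2}hf csE; congr ((f _)^*)%C.
by apply: expo_slotP => [||i]; rewrite !swE // dd.
Qed.

Lemma ci_real_eq (s t : C) : (s^*)%C = s -> (t^*)%C = t -> ci * s = t -> s = 0.
Proof.
move=> /conjC_eq hs /conjC_eq ht; case: s t hs ht => [p q] [p' q'] /= -> ->.
rewrite /ci => /eqP; rewrite eq_complex /= => /andP[_ /eqP h].
by apply/eqP; rewrite eq_complex /= eqxx andbT -h; apply/eqP; ring.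
Qed.

Lemma Xim_ciz b d : cs b = b -> Xim (z * (pc ci * b)) d = if d iz == d iw then b d else 0.
Proof.
move=> hb; rewrite /Xim; case: eqP => // dd; rewrite varE_add pcE.
have := real_coef hb dd => /conjC_eq; rewrite /ci.
by case: (b d) => p q /= ->; apply/eqP; rewrite eq_complex /=; apply/andP; split=> //; apply/eqP; ring.
Qed.

Section TwoFields.
Variables (g1 g2 : A).
Hypotheses (g1_RR : RR g1) (g2_RR : RR g2) (g1_1 : F 1 g1) (g2_1 : F 1 g2).
Local Notation X2 := (D (amp g2)).

Lemma F_X2 m f : F m f -> F m (X2 f).
Proof.
move=> hf; rewrite D_amp //; apply: FilD; apply: FilMl; [exact: F_Theta|exact: F_Eul].
Qed.

Lemma X2_near m f : F m f -> F m.+1 (X2 f - pc ci * Theta f).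
Proof.
move=> hf; rewrite D_amp // addrAC subrr add0r -add1n.
by apply: FilM => //; apply: F_Eul.
Qed.

Lemma X2_z f : F 2 (f - z) -> F 2 (X2 f - pc ci * z).
Proof.
move=> h; have -> : X2 f - pc ci * z = (X2 f - pc ci * Theta f) + pc ci * Theta (f - z).
  by rewrite ThetaB Theta_z; ring.
apply: FilD; last by apply: FilMl; apply: F_Theta.
by apply: X2_near; apply: (Fil_sub (g := z)); [apply: Fil_le h|apply: F_varz].
Qed.

(** The resonant real part of Phi z, continued to a substitution. *)
Definition res_sub (Phi : A -> A) : 'I_(2 + N) -> A :=
  coords (z * Xre (Phi z)) (w * Xre (Phi z)) (fun i => Phi (var (imu i))).

Lemma res_sub_F (Phi : A -> A) : shom Phi -> forall s, F (wa s) (res_sub Phi s).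
Proof.
move=> hP s; case: (slotP s) => [->|->|[i ->]]; rewrite wa_slots /res_sub coordsE.
- by apply: FilMr; apply: F_varz.
- by apply: FilMr; apply: F_varw.
- by apply: (homF hP); apply: F_varmu.
Qed.

Lemma pure_real_RR f : pure f -> cs f = f -> RR f.
Proof.
move=> fp fc; apply: RR_pure => // d; have [s0|s0] := eqVneq (sdeg d) 0%N; last first.
  by rewrite fp // rmorph0.
by apply: real_coef => //; move: s0; rewrite /sdeg; lia.
Qed.

Lemma auto_mu (Phi : A -> A) i : auto Phi ->
  [/\ RR (Phi (var (imu i))), pure (Phi (var (imu i))) & F (@weight N) (Phi (var (imu i)))].
Proof.
move=> ha; have p := auto_pure ha (@pure_var R N i); split=> //.
  by apply: pure_real_RR => //; rewrite -(auto_cs ha) cs_var.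
by apply: (homF (auto_hom ha)); apply: F_varmu.
Qed.

Lemma res_sub_RR (Phi : A -> A) f : auto Phi -> RR f -> RR (subst (res_sub Phi) f).
Proof.
move=> ha hf; apply: RR_subst => //; first exact: res_sub_F (auto_hom ha).
  rewrite /res_sub !coordsE; have rr := RR_Xre (Phi z).
  have -> : z * Xre (Phi z) * (w * Xre (Phi z)) = Z * (Xre (Phi z) * Xre (Phi z)).
    by rewrite /Z; ring.
  by apply: RRM; [apply: RR_Z|apply: RRM].
by move=> i; rewrite /res_sub coordsE; have [] := auto_mu i ha.
Qed.

Section AtZ.
Variables (n m : nat) (Phi : A -> A) (T : A).
Hypotheses (orb : orbital n Phi T (amp g1) (amp g2)) (mn : (m < n)%N) (m0 : (0 < m)%N).
Local Notation psi := (Phi z).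
Local Notation r := (Xre psi).
Local Notation e := (psi - z * r).
Local Notation rho := (subst (res_sub Phi) g1).
Hypotheses (uF : F m (unr psi)) (sF : F m.-1 (Xim psi)) (tF : F m.-1 (T - 1 : A)).

Lemma psi_error : e = unr psi + z * (pc ci * Xim psi).
Proof. by rewrite {1}(res_split psi); ring. Qed.

Lemma F_psi_error : F m e.
Proof.
rewrite psi_error; apply: FilD => //; rewrite -(prednK m0) -add1n.
by apply: FilM; [apply: F_varz|apply: FilMl].
Qed.

(** The conjugation relation at z, with Phi z = z r + e and the error e of order
    m: replacing Phi by the resonant substitution in Phi g1 costs only higher
    order, since g1 has positive order. *)
Lemma relation_at_z :
  F m.+1 (pc ci * (e - Theta e) - pc ci * (T - 1) * z + z * (r * rho - g2 * (r + Eul r))).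
Proof.
have [ha _ hrel] := orb; have hP := auto_hom ha; have eF := F_psi_error.
have rr := RR_Xre psi.
have P1 : F 1 psi by apply: (homF hP); apply: F_varz.
have rel0 := hrel z; rewrite D_var in rel0.
have h1 : F m.+1 (psi * (pc ci + Phi g1) - T * X2 psi).
  have -> : psi * (pc ci + Phi g1) = Phi (amp g1) by rewrite (homM hP) (homD hP) (hom_pc hP).
  by apply: Fil_le rel0.
have h2 : F m.+1 (psi * Phi g1 - z * r * rho).
  have near : F m (Phi g1 - rho).
    apply: hom_near => //; first by apply: hom_subst; apply: res_sub_F.
    move=> s; rewrite subst_var; last exact: res_sub_F.
    case: (slotP s) => [->|->|[i ->]]; rewrite /res_sub coordsE ?subrr //.
    have -> : Phi w - w * r = cs e.
      by rewrite rmorphB rmorphM /= -(auto_cs ha) cs_var (RR_cs rr).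
    exact: F_cs.
  have -> : psi * Phi g1 - z * r * rho = e * Phi g1 + z * r * (Phi g1 - rho) by ring.
  have x1 : F m.+1 (e * Phi g1) by apply: Fil_le (FilM eF (homF hP g1_1)); lia.
  have x2 : F m.+1 (z * r * (Phi g1 - rho)).
    by apply: Fil_le (FilM (FilMr r (@F_varz R N)) near); lia.
  exact: FilD.
have h3 : F m.+1 ((T - 1) * (X2 psi - pc ci * z)).
  by apply: Fil_le (FilM tF (X2_z (auto_z ha))); lia.
have h4 : F m.+1 (g2 * Eul e) by apply: Fil_le (FilM g2_1 (F_Eul eF)); lia.
have te : Theta psi = z * r + Theta e by rewrite ThetaB ThetazE; [ring|case: rr].
have ee : Eul psi = z * (r + Eul r) + Eul e by rewrite EulB EulM Eul_z; ring.
have -> : pc ci * (e - Theta e) - pc ci * (T - 1) * z + z * (r * rho - g2 * (r + Eul r))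
  = (psi * (pc ci + Phi g1) - T * X2 psi) - (psi * Phi g1 - z * r * rho)
    + (T - 1) * (X2 psi - pc ci * z) + g2 * Eul e.
  rewrite D_amp // te ee; move: (Theta e) (Eul e) (Eul r) => te' ee' er; ring.
by apply: FilD => //; apply: FilD => //; apply: FilB.
Qed.

Hypotheses (sF' : F m (Xim psi))
  (tnr : forall d, (fg d < m)%N -> d iz != d iw -> (T - 1) d = 0).

(** The angular component of the resonant part of the relation at z kills the
    resonant part of T - 1; the non-resonant part of the relation then kills
    that of Phi z, because 1 - Theta is invertible on it. *)
Lemma relation_improves : F m (T - 1) /\ F m.+1 (unr psi).
Proof.
have [ha [cT _] _] := orb; have rr := RR_Xre psi.
pose u := unr psi; pose q := r * rho - g2 * (r + Eul r).
have qr : RR q.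
  apply: RRB; first by apply: RRM => //; apply: res_sub_RR.
  by apply: RRM => //; apply: RRD => //; apply: RR_Eul.
have zs : F m.+1 (z * (pc ci * Xim psi)).
  by rewrite -add1n; apply: FilM; [apply: F_varz|apply: FilMl].
have h : F m.+1 (pc ci * (u - Theta u) - pc ci * (T - 1) * z + z * q).
  have e1 : e - Theta e = (u - Theta u)
      + (z * (pc ci * Xim psi) - Theta (z * (pc ci * Xim psi))).
    by rewrite psi_error ThetaD -/u; ring.
  have := relation_at_z; rewrite e1 -/q => h0.
  have -> : pc ci * (u - Theta u) - pc ci * (T - 1) * z + z * q =
     (pc ci * (u - Theta u + (z * (pc ci * Xim psi) - Theta (z * (pc ci * Xim psi))))
       - pc ci * (T - 1) * z + z * q)
     - pc ci * (z * (pc ci * Xim psi) - Theta (z * (pc ci * Xim psi))) by ring.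
  by apply: FilB => //; apply: FilMl; apply: FilB => //; apply: F_Theta.
have TF : F m (T - 1).
  move=> d dm; have [dd|] := eqVneq (d iz) (d iw); last exact: tnr.
  have dr : ((eadd (expo1 iz) d) iz = ((eadd (expo1 iz) d) iw).+1).
    by rewrite !ffunE eqxx /= dd add1n.
  have hd : (wdeg wa (eadd (expo1 iz) d) < m.+1)%N.
    by rewrite -/(fg _) fgD [fg (expo1 iz)]wdeg_expo1 wa_slots add1n ltnS.
  have hh : ci * (T - 1) d = q d.
    have := h _ hd; have -> : pc ci * (T - 1) * z = z * (pc ci * (T - 1)) by ring.
    move: (T - 1) => t.
    rewrite addE subE !varE_add !pcE subE ThetaE [u _]/unr dr eqxx.
    by rewrite mulr0 subrr mulr0 sub0r addrC => /eqP; rewrite subr_eq0 => /eqP ->.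
  apply: (ci_real_eq (t := q d)) => //.
  - by apply: real_coef => //; rewrite rmorphB rmorph1 /= cT.
  - by have [_] := qr.
split=> // d dm; have [dd|dd] := eqVneq (d iz) (d iw).+1; first by rewrite /unr dd eqxx.
have hz : F m.+1 (pc ci * (T - 1) * z).
  by rewrite -addn1; apply: FilM; [apply: FilMl|apply: F_varz].
have zq0 : (z * q) d = 0.
  rewrite varE; case: ifP => // d0; have [qres _] := qr; apply: qres.
  by rewrite !ffunE eqxx /=; apply: contraNneq dd => dq; apply/eqP; lia.
have hu : u d - ((d iz)%:R - (d iw)%:R) * u d = 0.
  have := h d dm; move: (hz d dm); move: (pc ci * (T - 1) * z) => t t0.
  rewrite addE subE zq0 t0 subr0 addr0 pcE subE ThetaE.
  by move/eqP; rewrite mulf_eq0 (negbTE ci_neq0) => /eqP.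
have c0 : 1 - ((d iz)%:R - (d iw)%:R) != 0 :> C.
  rewrite opprB addrA subr_eq0 addrC natr1 eqr_nat eq_sym.
  exact: dd.
have : (1 - ((d iz)%:R - (d iw)%:R)) * u d = 0 by rewrite -hu; ring.
by move/eqP; rewrite mulf_eq0 (negbTE c0) => /eqP.
Qed.

End AtZ.
Section Flow.
Variables (b : A) (m : nat).
Hypotheses (b_real : cs b = b) (bF : F m b) (m0 : (0 < m)%N).

Definition flow : A := - (b * amp g2).
(** The infinitesimal change of the factor of v along the flow of - b v. *)
Definition time_op f : A := f * X2 b - b * X2 f.

Lemma F_amp : F 1 (amp g2).
Proof. by apply: FilMr; apply: F_varz. Qed.

Lemma F_flow : F m.+1 flow.
Proof. by apply: FilN; rewrite -addn1; apply: FilM => //; apply: F_amp. Qed.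

Lemma F_flow2 : F 2 flow.
Proof. exact: Fil_le F_flow. Qed.

Lemma D_flow f : D flow f = - (b * X2 f).
Proof. by rewrite /flow DNl DMl. Qed.

Lemma flow_raises : raises m (D flow).
Proof. exact: D_raises F_flow. Qed.

Lemma time_op_raises : raises m time_op.
Proof.
move=> k f fk; apply: FilB; first by apply: FilM => //; apply: F_X2.
by rewrite addnC; apply: FilM => //; apply: F_X2.
Qed.

Lemma time_op_nilop : nilop time_op.
Proof.
split; last exact: raises_le time_op_raises.
by move=> f g; rewrite /time_op raddfB /=; ring.
Qed.

Lemma time_op1 : time_op 1 = X2 b.
Proof. by rewrite /time_op -(rmorph1 pc) D_pc rmorph1; ring. Qed.

Lemma cs_time_op f : time_op (cs f) = cs (time_op f).
Proof. by rewrite /time_op rmorphB !rmorphM /= !cs_D b_real. Qed.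

Lemma flow_conj f : exps (D flow) (X2 f) = exps time_op 1 * X2 (exps (D flow) f).
Proof.
have hX := D_nilop F_flow2; rewrite -[X2 f]mul1r.
apply: (exps_pair (p := fun f g : A => f * X2 g)) => //; first exact: time_op_nilop.
- by move=> h k l; rewrite raddfB /= mulrBr.
- by move=> h k l; rewrite mulrBl.
- move=> j l h k hh hk; apply: Fil_le (leq_pred _) _; apply: FilM => //.
  exact: F_X2.
- move=> h k; rewrite !D_flow /time_op raddfN /= !DM; ring.
Qed.

Lemma flow_orbital n : orbital n (exps (D flow)) (exps time_op 1) (amp g2) (amp g2).
Proof.
split=> [||f]; first exact: auto_exps F_flow2.
  split.
    by rewrite -exps_cs ?rmorph1 //; [exact: time_op_nilop|exact: cs_time_op].
  apply: Fil_le (exps_raises time_op_nilop time_op_raises m0 (Fil0 1)).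
  by rewrite add0n.
by rewrite flow_conj subrr.
Qed.

End Flow.

(** Flows of real multiples b of the second field v conjugate v to multiples of
    v, so they may be composed with Phi. To leading order they change T by
    i Theta b and Phi z by - i b z; the non-resonant part of b removes that of T,
    and the resonant part of b removes the rotation in Phi z. *)
Lemma equivalence_step n m Phi T : orbital n Phi T (amp g1) (amp g2) ->
  (2 <= m)%N -> F m (unr (Phi z)) -> F m.-1 (Xim (Phi z)) -> F m.-1 (T - 1) ->
  exists Phi' T', [/\ orbital n Phi' T' (amp g1) (amp g2), F m (unr (Phi' z)),
    F m (Xim (Phi' z)), F m.-1 (T' - 1) &
    forall d, (fg d < m)%N -> d iz != d iw -> (T' - 1) d = 0].
Proof.
move=> orb m2 uF sF tF; have [ha [cT tF1] _] := orb; have hP := auto_hom ha.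
set psi := Phi z in uF sF *.
pose lam d : C := if d iz == d iw then 0 else ci / ((d iz)%:R - (d iw)%:R).
pose b := Xim psi + dg lam (T - 1).
have b_real : cs b = b.
  rewrite rmorphD /= (RR_cs (RR_Xim psi)); congr (_ + _); apply: cs_dg.
    move=> d; rewrite /lam !swE eq_sym; case: ifP => _; first by rewrite rmorph0.
    have cM (s t : C) : ((s * t)^*)%C = (s^*)%C * (t^*)%C by exact: rmorphM.
    by rewrite cM conj_ci fmorphV rmorphB !rmorph_nat mulNr -mulrN -invrN opprB.
  by rewrite rmorphB rmorph1 /= cT.
have bF : F m.-1 b by apply: FilD => //; apply: Fil_dg.
have m0 : (0 < m.-1)%N by lia.
have bX : F m.-1 (X2 b) by exact: F_X2.
have orb' := orbital_comp orb (flow_orbital b_real bF m0 n).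
set Psi := exps (D (flow b)) in orb'; set TP := exps (time_op b) 1 in orb'.
have hX := D_nilop (F_flow2 bF m0); have hXr := flow_raises bF.
have hPsi := auto_hom (auto_exps (F_flow2 bF m0)); rewrite -/Psi in hPsi.
have TPF : F m (TP - 1 - X2 b).
  have e1 := time_op1 b; have := exps_second (time_op_nilop bF m0) (time_op_raises bF).
  move=> /(_ m.-1 1); rewrite e1 => /(_ bX); apply: Fil_le; lia.
have TF' : F m (Psi T * TP - T - X2 b).
  have -> : Psi T * TP - T - X2 b = (Psi (T - 1) - (T - 1)) * TP + T * (TP - 1 - X2 b)
      + (T - 1) * X2 b by rewrite (homB hPsi) (hom1 hPsi); ring.
  apply: FilD; last by apply: Fil_le (FilM tF bX); lia.
  apply: FilD; last exact: FilMl.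
  by apply: FilMr; apply: Fil_le (exps_raises hX hXr m0 tF); lia.
have psi2 := auto_z ha; rewrite -/psi in psi2.
have psi1 : F 1 psi by apply: (homF hP); apply: F_varz.
have pF : F m.+1 (Psi psi - psi + z * (pc ci * b)).
  have h1 : F m (D (flow b) psi).
    by have := hXr _ _ psi1; apply: Fil_le; lia.
  have h2 := exps_second hX hXr h1; rewrite D_flow // in h2.
  have h3 : F m.+1 (b * (X2 psi - pc ci * z)).
    by apply: Fil_le (FilM bF (X2_z psi2)); lia.
  have -> : Psi psi - psi + z * (pc ci * b) = (Psi psi - psi - - (b * X2 psi))
    - b * (X2 psi - pc ci * z) by ring.
  by apply: FilB => //; apply: Fil_le h2; lia.
have zb : F m (z * (pc ci * b)).
  by apply: Fil_le (FilM (@F_varz R N) (FilMl (pc ci) bF)); lia.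
exists (Psi \o Phi), (Psi T * TP); split=> //=.
- have -> : unr (Psi psi) = unr psi + unr (Psi psi - psi) by rewrite unr_zmod; ring.
  apply: FilD => //; apply: F_unr.
  have -> : Psi psi - psi = (Psi psi - psi + z * (pc ci * b)) - z * (pc ci * b) by ring.
  by apply: FilB => //; apply: Fil_le pF.
- have h := F_Xim pF; move=> d dm; have := h d dm.
  have -> : Psi psi - psi + z * (pc ci * b) = Psi psi - (psi - z * (pc ci * b)) by ring.
  rewrite !Xim_zmod !subE Xim_ciz //.
  have [sr _] := RR_Xim psi; case: eqP => [dd|/eqP dd]; last by rewrite (sr d dd) subr0 subr0.
  rewrite /b addE /dg /lam dd eqxx mul0r addr0 subrr subr0; exact.
- have -> : Psi T * TP - 1 = (Psi T * TP - T - X2 b) + (T - 1) + X2 b by ring.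
  by apply: FilD => //; apply: FilD => //; apply: Fil_le TF'; lia.
- move=> d dm dd.
  have -> : Psi T * TP - 1 = (Psi T * TP - T - X2 b) + ((T - 1) + pc ci * Theta b)
     + (X2 b - pc ci * Theta b) by ring.
  have h : F m (X2 b - pc ci * Theta b) by apply: Fil_le (X2_near bF); lia.
  rewrite addE (h d dm) addr0 addE (TF' d dm) add0r addE pcE ThetaE.
  have -> : b d = Xim psi d + lam d * (T - 1) d by [].
  have [sr _] := RR_Xim psi; rewrite (sr d dd) add0r /lam (negbTE dd).
  have c0 : (d iz)%:R - (d iw)%:R != 0 :> C by rewrite subr_eq0 eqr_nat.
  move: ((T - 1) d) ((d iz)%:R - (d iw)%:R) c0 => t c c0.
  transitivity (t + ci * ci * (c / c) * t); first by ring.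
  by rewrite ci2 divff //; ring.
Qed.

Lemma equivalence_normalized n m : orb_equiv n (amp g1) (amp g2) -> (2 <= m <= n)%N ->
  exists Phi T, [/\ orbital n Phi T (amp g1) (amp g2), F m (unr (Phi z)),
    F m.-1 (Xim (Phi z)) & F m.-1 (T - 1)].
Proof.
move=> oe; elim: m => // m IH /andP[m2 mn].
case: (ltnP m 2) => [m1|{}m2].
  have -> : m = 1%N by lia.
  have [Phi [T orb]] := oe; have [ha [_ tF] _] := orb; have pz := auto_z ha.
  exists Phi, T; split=> //=.
    rewrite -[Phi z](subrK z) -[X in _ + X]opprK unr_zmod.
    have -> : unr (- z) = 0 :> A; last by rewrite subr0; apply: F_unr.
    apply/funext => d; rewrite /unr; case: eqP => // dd.
    rewrite oppE /var /svar /smonomial; case: eqP => [dE|_]; last by rewrite oppr0.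
    by exfalso; apply: dd; rewrite dE !ffunE.
  have -> : Xim (Phi z) = Xim (Phi z - z) + Xim z by rewrite Xim_zmod subrK.
  have -> : Xim z = 0 :> A; last by rewrite addr0; apply: (F_Xim (m := 2)).
  apply/funext => d; rewrite /Xim -[z]mulr1 varE_add oneE.
  by case: (d == e0); case: ifP => _ //=; rewrite ?raddf0.
have [Phi [T [orb uF sF tF]]] := IH (introT andP (conj m2 (ltnW mn))).
have [Phi' [T' [orb' uF' sF' tF' tnr]]] := equivalence_step orb m2 uF sF tF.
have m0 : (0 < m)%N by lia.
have sF2 : F m.-1 (Xim (Phi' z)) by apply: Fil_le sF'; lia.
have [h1 h2] := relation_improves orb' mn m0 uF' sF2 tF' sF' tnr.
by exists Phi', T'.
Qed.

(** The equivalence of two resonant fields reduces to an equation between real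
    resonant series: r z is the new coordinate, h are the new parameters, and
    there is no change of time any more. *)
Lemma resonant_equivalence n : orb_equiv n (amp g1) (amp g2) -> (3 <= n)%N ->
  exists r (h : 'I_N -> A), [/\ RR r, F 1 (r - 1),
    forall i, [/\ RR (h i), pure (h i) & F (@weight N) (h i)] &
    F (n - 2) (r * subst (coords (z * r) (w * r) h) g1 - g2 * (r + Eul r))].
Proof.
move=> oe n3; have mn : (2 <= n.-1 <= n)%N by lia.
have [Phi [T [orb uF sF tF]]] := equivalence_normalized oe mn.
have nn : (n.-1 < n)%N by lia.
have n0 : (0 < n.-1)%N by lia.
have h := relation_at_z orb nn n0 uF sF tF.
have [ha _ _] := orb; set r := Xre (Phi z) in h.
exists r, (fun i => Phi (var (imu i))); split.
- exact: RR_Xre.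
- have -> : r - 1 = Xre (Phi z - z).
    rewrite Xre_zmod; congr (_ - _); apply/funext => d.
    rewrite /Xre -[z]mulr1 varE_add oneE.
    have [->|d0] := eqVneq d e0; first by rewrite !ffunE /= rmorph1.
    by case: ifP => _ //=; rewrite rmorph0.
  exact: F_Xre (auto_z ha).
- by move=> i; apply: auto_mu.
- rewrite -/(res_sub Phi); set q := r * _ - _ in h *.
  have eF := F_psi_error n0 uF sF.
  have zq : F n.-1 (z * q).
    set e := Phi z - z * r in eF h.
    have -> : z * q = (pc ci * (e - Theta e) - pc ci * (T - 1) * z + z * q)
       - pc ci * (e - Theta e) + pc ci * (T - 1) * z by ring.
    have tz : F n.-1 (pc ci * (T - 1) * z).
      by apply: Fil_le (FilM (FilMl (pc ci) tF) (@F_varz R N)); lia.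
    apply: FilD => //; apply: FilB; first by apply: Fil_le h.
    by apply: FilMl; apply: FilB => //; apply: F_Theta.
  move=> d dn; rewrite -[q d](varE_add iz); apply: zq.
  by rewrite -/(fg _) fgD [fg (expo1 iz)]wdeg_expo1 wa_slots -/(fg d); move: dn; rewrite -/(fg d); lia.
Qed.

End TwoFields.
End ResonantEquivalence.

(** * Uniqueness of the coefficients *)

Section Uniqueness.
Context {R : realType} {N : nat}.
Local Notation A := (psr R N).
Local Notation C := R[i].
Local Notation par := {ffun 'I_N -> nat}.
Local Notation zz := (@zz N).
Local Notation par0 := (@par0 N).
Local Notation z := (var iz : A).
Local Notation w := (var iw : A).
Implicit Types (a b c f g u v Y T r : A) (h : 'I_N -> A) (d : exponent N) (n k m : nat).

Lemma F_divz m f : F m.+1 (z * f) -> F m f.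
Proof.
move=> hf d dm; rewrite -[f d](varE_add iz); apply: hf.
by rewrite -/(fg _) fgD [fg (expo1 iz)]wdeg_expo1 wa_slots.
Qed.

Lemma exps_intertwine (X L : A -> A) q f : nilop X -> nilop L ->
  (forall g, X (q * g) = q * L g) -> exps X (q * f) = q * exps L f.
Proof.
move=> hX hL hq; apply: F_eq => m.
apply: Fil_trans (F_exps_upto (n := m) _ hX) _.
suff -> : exps_upto X m (q * f) = q * exps_upto L m f.
  by rewrite -mulrBr; apply: FilMl; apply: FilBC; apply: F_exps_upto.
rewrite /exps_upto mulr_sumr; apply: eq_bigr => k _; rewrite mulrCA; congr (_ * _).
by elim: (nat_of_ord k) => //= j ->.
Qed.

Lemma pow_near m r j : F m (r - 1) -> F m (r ^+ j - 1).
Proof.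
move=> hr; elim: j => [|j IH]; first by rewrite expr0 subrr.
have -> : r ^+ j.+1 - 1 = (r - 1) * r ^+ j + (r ^+ j - 1) by rewrite exprS; ring.
by apply: FilD => //; apply: FilMr.
Qed.

Lemma pow_near2 m r j : F m (r - 1) -> F (m + m) (r ^+ j - 1 - j%:R * (r - 1)).
Proof.
move=> hr; elim: j => [|j IH]; first by rewrite expr0 mul0r !subrr.
have -> : r ^+ j.+1 - 1 - j.+1%:R * (r - 1) =
  (r ^+ j - 1 - j%:R * (r - 1)) + (r - 1) * (r ^+ j - 1).
  by rewrite exprS -(natr1 j); ring.
by apply: FilD => //; apply: FilM => //; apply: pow_near.
Qed.

Lemma orb_scale n T u : real_unit T ->
  orb_equiv n (T * u) u /\ orb_equiv n u (T * u).
Proof.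
move=> hT; have [cT _] := hT; have [T' hT' TT] := real_unitV hT.
split; [exists id, T|exists id, T'].
  by split=> [||f] //; [exact: auto_id|rewrite DMl ?subrr].
split=> [||f] //; first exact: auto_id.
by rewrite DMl // mulrA [T' * T]mulrC TT mul1r subrr.
Qed.

Lemma real_unit_Den b : (0 < N)%N -> RR b -> real_unit (Den b).
Proof.
move=> N0 br; split; first exact/RR_cs/RR_Den.
rewrite /Den addrAC subrr add0r; apply: FilMr; apply: Fil_le (@F_ZX R N N); lia.
Qed.

(** Dividing by the angular speed is a time rescaling, after which the normal
    form is a field of angular speed 1. *)
Lemma nf_amplitude A0 b : (0 < N)%N -> RR b -> exists g, [/\ RR g, Den b * g = Qn A0 &
  forall n, orb_equiv n (nfA A0 b) (amp g) /\ orb_equiv n (amp g) (nfA A0 b)].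
Proof.
move=> N0 br; have hu := real_unit_Den N0 br.
have [k [k1 kr _]] : exists k : A, [/\ (1 + Z ^+ N * b) * k = 1,
    RR (Z ^+ N * b) -> RR k & forall m, F m (Z ^+ N * b) -> F m (k - 1)].
  apply: inv_unit; apply: FilMr; apply: Fil_le (@F_ZX R N N); lia.
have {}kr : RR k by apply: kr; apply: RRM => //; apply: RR_ZX.
have e : Den b * (k * Qn A0) = Qn A0 by rewrite mulrA k1 mul1r.
exists (k * Qn A0); split=> //; first by apply: RRM => //; apply: RR_Qn.
move=> n; have -> : nfA A0 b = Den b * amp (k * Qn A0).
  by rewrite /nfA -{1}e /amp; ring.
by split; [apply: (orb_scale n _ hu).1|apply: (orb_scale n _ hu).2].
Qed.

Definition sub_r r h : A -> A := subst (coords (z * r) (w * r) h).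

Definition sub_ok r h : Prop :=
  RR r /\ forall i, [/\ RR (h i), pure (h i) & F (@weight N) (h i)].

Lemma sub_r_F r h : sub_ok r h -> forall s, F (wa s) (coords (z * r) (w * r) h s).
Proof.
move=> [_ hh] s; case: (slotP s) => [->|->|[i ->]]; rewrite wa_slots coordsE.
- by apply: FilMr; apply: F_varz.
- by apply: FilMr; apply: F_varw.
- by have [] := hh i.
Qed.

Lemma sub_r_hom r h : sub_ok r h -> shom (sub_r r h).
Proof. by move=> ok; apply: hom_subst; apply: sub_r_F. Qed.

Lemma sub_r_var r h : sub_ok r h -> [/\ sub_r r h z = z * r, sub_r r h w = w * r
  & forall i, sub_r r h (var (imu i)) = h i].
Proof.
by move=> /sub_r_F ok; split=> [||i]; rewrite /sub_r subst_var // coordsE.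
Qed.

Lemma sub_r_Z r h j : sub_ok r h -> sub_r r h (Z ^+ j) = Z ^+ j * r ^+ (2 * j).
Proof.
move=> ok; have [e1 e2 _] := sub_r_var ok; have hP := sub_r_hom ok.
by rewrite (homX hP) /Z (homM hP) e1 e2 exprM -exprMn; congr (_ ^+ j); ring.
Qed.

Section Comparison.
Variables (A1 A2 : R) (b1 b2 g1 g2 : A) (k : nat).
Hypotheses (A1_neq0 : A1 != 0) (N_gt0 : (0 < N)%N).
Hypotheses (b1_pure : pure b1) (b1_RR : RR b1) (b2_pure : pure b2) (b2_RR : RR b2).
Hypotheses (g1_RR : RR g1) (g2_RR : RR g2).
Hypotheses (g1E : Den b1 * g1 = Qn A1) (g2E : Den b2 * g2 = Qn A2).
Local Notation lead A0 := (pc A0%:C%C * Z ^+ N : A).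

Definition intertwines r h : Prop := F k (r * sub_r r h g1 - g2 * (r + Eul r)).

(** The relation between the amplitudes, multiplied by both angular speeds. *)
Lemma cleared r h : sub_ok r h -> intertwines r h ->
  F k (r * (pc A1%:C%C * (Z ^+ N * r ^+ (2 * N)) + \sum_(i < N) Z ^+ i * r ^+ (2 * i) * h i)
         * Den b2
       - Qn A2 * (1 + Z ^+ N * r ^+ (2 * N) * sub_r r h b1) * (r + Eul r)).
Proof.
move=> ok hk; have hP := sub_r_hom ok; have [_ _ emu] := sub_r_var ok.
have eD : sub_r r h (Den b1) = 1 + Z ^+ N * r ^+ (2 * N) * sub_r r h b1.
  by rewrite /Den (homD hP) (hom1 hP) (homM hP) sub_r_Z.
have eQ : sub_r r h (Qn A1) = pc A1%:C%C * (Z ^+ N * r ^+ (2 * N))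
    + \sum_(i < N) Z ^+ i * r ^+ (2 * i) * h i.
  rewrite /Qn (homD hP) (homM hP) (hom_pc hP) sub_r_Z // (hom_sum hP); congr (_ + _).
  by apply: eq_bigr => i _; rewrite (homM hP) sub_r_Z // emu.
rewrite -eQ -eD -g1E -g2E (homM hP).
have -> : r * (sub_r r h (Den b1) * sub_r r h g1) * Den b2
   - Den b2 * g2 * sub_r r h (Den b1) * (r + Eul r)
  = sub_r r h (Den b1) * Den b2 * (r * sub_r r h g1 - g2 * (r + Eul r)).
  by move: (Den b2) (Eul r) => x y; ring.
exact: FilMl.
Qed.

(** At order 2 N the parameters do not contribute yet. *)
Lemma leading_unique r h : sub_ok r h -> F 1 (r - 1) -> intertwines r h ->
  (N.*2 < k)%N -> A1 = A2.
Proof.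
move=> ok r1 hk Nk; have hc := cleared ok hk; have [rr hh] := ok.
have ZF : F N.*2 (Z ^+ N : A) by apply: F_ZX.
have rN := pow_near (2 * N) r1; have Qn2 := F_Qn_lead A2 : F _ (_ : A).
set s := \sum_(i < N) _ in hc; set be := sub_r r h b1 in hc.
have sF : F N.*2.+1 s.
  apply: Fil_sum => i _; apply: FilMl; have [_ _] := hh i.
  by apply: Fil_le; rewrite /weight.
have E1 : F 1 (r + Eul r - 1).
  have -> : r + Eul r - 1 = (r - 1) + Eul (r - 1).
    by rewrite EulB (pure_Eul (f := 1)) ?subr0; [ring|rewrite -(rmorph1 pc); apply: pure_pc].
  by apply: FilD => //; apply: F_Eul.
have h0 : F N.*2.+1 (lead A1 - lead A2).
  move: (Eul r) E1 hc => er E1 hc.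
  have -> : lead A1 - lead A2 =
     (r * (pc A1%:C%C * (Z ^+ N * r ^+ (2 * N)) + s) * Den b2
       - Qn A2 * (1 + Z ^+ N * r ^+ (2 * N) * be) * (r + er))
     - r * Den b2 * s - lead A1 * r * Den b2 * (r ^+ (2 * N) - 1)
     - lead A1 * Den b2 * (r - 1) - lead A1 * (Z ^+ N * b2)
     + (Qn A2 - lead A2) * (1 + Z ^+ N * r ^+ (2 * N) * be) * (r + er)
     + lead A2 * (1 + Z ^+ N * r ^+ (2 * N) * be) * (r + er - 1)
     + lead A2 * (Z ^+ N * r ^+ (2 * N) * be).
    by move: (Qn A2) => q; rewrite /Den; ring.
  have lF (a : R) : F N.*2 (lead a) by apply: FilMl.
  have x1 (a : R) f g : F 1 f -> F N.*2.+1 (lead a * g * f).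
    by move=> f1; rewrite -addn1; apply: FilM => //; apply: FilMr; apply: lF.
  have x2 (a : R) f : F N.*2.+1 (lead a * (Z ^+ N * f)).
    by apply: Fil_le (FilM (lF a) (FilMr f ZF)); lia.
  apply: FilD; last by rewrite -[Z ^+ N * _ * be]mulrA; apply: x2.
  apply: FilD; last exact: x1.
  apply: FilD; last by do 2!apply: FilMr.
  apply: FilB; last exact: x2.
  apply: FilB; last exact: x1.
  apply: FilB; last by rewrite -[lead A1 * r * _]mulrA; apply: x1; apply: pow_near.
  by apply: FilB; [apply: Fil_le hc|apply: FilMl].
have := h0 (zz N par0); rewrite -/(fg _) fg_zz msz_par0 muln0 addn0 => /(_ (ltnSn _)).
rewrite subE !pcE ZX_zz !eqxx !mulr1 => /eqP; rewrite subr_eq0 => /eqP.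
by move/(congr1 (@complex.Re R)).
Qed.
End Comparison.

Section Induction.
Variables (A0 : R) (b1 b2 g1 g2 : A) (k : nat).
Hypotheses (A0_neq0 : A0 != 0) (N_gt0 : (0 < N)%N).
Hypotheses (b1_pure : pure b1) (b1_RR : RR b1) (b2_pure : pure b2) (b2_RR : RR b2).
Hypotheses (g1_RR : RR g1) (g2_RR : RR g2).
Hypotheses (g1E : Den b1 * g1 = Qn A0) (g2E : Den b2 * g2 = Qn A0).
Local Notation Q := (Qn A0 : A).
Local Notation lead := (pc A0%:C%C * Z ^+ N : A).
Local Notation intertwines := (intertwines g1 g2 k).

Definition close_sub m r h : Prop := [/\ sub_ok r h, F m (r - 1),
  forall i : 'I_N, F (m + N.*2 - i.*2) (h i - var (imu i)),
  F (m - N.*2) (b1 - b2) & intertwines r h].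

(** To leading order the deviations of r from 1, of h from mu and of b1 from b2
    satisfy the homological equation. *)
Lemma comparison_leading m r h : (0 < m)%N -> (m + N.*2 < k)%N -> close_sub m r h ->
  F (m + N.*2).+1 (Lam (r - 1) lead + Zp (fun i => - (h i - var (imu i))) - 0
                   + Z ^+ N * ((b1 - b2) * lead)).
Proof.
move=> m0 Gk [ok r1 hmu hb hk]; have hc := cleared g1E g2E ok hk.
have [rr hh] := ok; set be := sub_r r h b1 in hc.
have ZF : F N.*2 (Z ^+ N : A) by apply: F_ZX.
have lF : F N.*2 lead by apply: FilMl.
have QF : F N.*2 Q by apply: F_Qn.
have QlF : F N.*2.+1 (Q - lead) by apply: F_Qn_lead.
set s := \sum_(i < N) _ in hc.
set p := \sum_(i < N) Z ^+ i * (h i - var (imu i)).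
set s0 : A := \sum_(i < N) Z ^+ i * var (imu i).
have -> : Zp (fun i => - (h i - var (imu i))) = - p.
  by rewrite /Zp /p -sumrN; apply: eq_bigr => i _; rewrite mulrN.
have pF : F (m + N.*2) p.
  apply: Fil_sum => i _; apply: Fil_le (F_ZXM (k := i) (hmu i)); lia.
have sF : F (m + N.*2).+1 (r * s - s0 - p).
  have -> : r * s - s0 - p = \sum_(i < N) Z ^+ i * ((r ^+ (2 * i).+1 - 1) * h i).
    rewrite /s /s0 /p mulr_sumr -!sumrB; apply: eq_bigr => i _; rewrite exprS; ring.
  apply: Fil_sum => i _; apply: FilMl; have [_ _ hw] := hh i.
  apply: Fil_le (FilM (pow_near (2 * i).+1 r1) hw); rewrite /weight; lia.
have rF : F (m + N.*2).+1 (lead * (r ^+ (2 * N).+1 - 1 - (2 * N).+1%:R * (r - 1))).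
  by apply: Fil_le (FilM lF (pow_near2 (2 * N).+1 r1)); lia.
have eF : F m (Eul (r - 1)) by apply: F_Eul.
have Er : Eul r = Eul (r - 1).
  by rewrite EulB (pure_Eul (f := 1)) ?subr0 // -(rmorph1 pc); apply: pure_pc.
have beF : F m (be - b1).
  have hid : shom (id : A -> A) by split.
  apply: (hom_near (sub_r_hom ok) hid) => t; have [e1 e2 e3] := sub_r_var ok.
  case: (slotP t) => [->|->|[i ->]]; rewrite ?e1 ?e2 ?e3.
  - by have -> : z * r - z = z * (r - 1) by [ring]; apply: FilMl.
  - by have -> : w * r - w = w * (r - 1) by [ring]; apply: FilMl.
  - by apply: Fil_le (hmu i); have := ltn_ord i; lia.
have QE : Q = lead + s0 by [].
have LE : Lam (r - 1) lead = lead * Eul (r - 1) - (2 * N)%:R * ((r - 1) * lead).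
  rewrite /Lam EulM Eul_ZX [Eul (pc _)](_ : _ = 0); first by ring.
  by apply: pure_Eul; apply: pure_pc.
have r2N : F m (r ^+ (2 * N) - 1) := pow_near _ r1.
rewrite LE Er /Den in hc *.
move: (Eul (r - 1)) eF hc => er eF hc.
pose E1 := r * (pc A0%:C%C * (Z ^+ N * r ^+ (2 * N)) + s) * (1 + Z ^+ N * b2)
   - Q * (1 + Z ^+ N * r ^+ (2 * N) * be) * (r + er).
(* Each term on the right has order greater than m + 2 N. *)
have dec : lead * er - (2 * N)%:R * ((r - 1) * lead) + - p - 0
      + Z ^+ N * ((b1 - b2) * lead) =
   - E1 + (r * s - s0 - p) * (1 + Z ^+ N * b2)
   + lead * (r ^+ (2 * N).+1 - 1 - (2 * N).+1%:R * (r - 1)) * (1 + Z ^+ N * b2)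
   + (p + (2 * N).+1%:R * (lead * (r - 1))) * (Z ^+ N * b2)
   - Q * (Z ^+ N * (be * (r ^+ (2 * N) - 1)) * (r + er))
   - Q * (Z ^+ N * (be - b1) * (r + er)) - Q * (Z ^+ N * b1 * (r - 1 + er))
   - (Q - lead) * (r - 1 + er) - (Q - lead) * (Z ^+ N * (b1 - b2)).
  rewrite /E1 QE exprS -(natr1 (2 * N)); move: ((2 * N)%:R : A) => c.
  by move: (s) (s0) (p) (be) => x1 x2 x3 x4; ring.
rewrite dec.
have x1 : F (m + N.*2).+1 ((p + (2 * N).+1%:R * (lead * (r - 1))) * (Z ^+ N * b2)).
  have y : F (m + N.*2) (p + (2 * N).+1%:R * (lead * (r - 1))).
    by apply: FilD => //; apply: FilMl; apply: Fil_le (FilM lF r1); lia.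
  by apply: Fil_le (FilM y (FilMr b2 ZF)); lia.
have x2 f g : F m f -> F (m + N.*2).+1 (Q * (Z ^+ N * f * g)).
  by move=> y; apply: Fil_le (FilM QF (FilMr g (FilM ZF y))); lia.
have x3 : F m (r - 1 + er) by apply: FilD.
have x4 : F (m + N.*2).+1 ((Q - lead) * (r - 1 + er)).
  by apply: Fil_le (FilM QlF x3); lia.
have x5 : F (m + N.*2).+1 ((Q - lead) * (Z ^+ N * (b1 - b2))).
  by apply: Fil_le (FilM QlF (FilM ZF hb)); lia.
have x6 : F (m + N.*2).+1 (Q * (Z ^+ N * b1 * (r - 1 + er))).
  by apply: Fil_le (FilM QF (FilM (FilMr b1 ZF) x3)); lia.
apply: FilB => //; apply: FilB => //; apply: FilB => //.
apply: FilB; last exact: x2.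
apply: FilB; last by apply: x2; apply: FilMl.
apply: FilD => //; apply: FilD; last exact: FilMr.
by apply: FilD; [apply: FilN; apply: Fil_le hc|apply: FilMr].
Qed.

(** The flow of the radial part of the second field, for a time c that depends
    on the parameters, is a symmetry of that field. It changes r by c A0 Z^N to
    leading order. *)
Lemma comparison_flow m r h (c : A) : (0 < m)%N -> sub_ok r h -> F m (r - 1) ->
  intertwines r h -> pure c -> RR c -> F (m - N.*2) c ->
  exists r', [/\ sub_ok r' h, F m.+1 (r' - r - c * lead) & intertwines r' h].
Proof.
move=> m0 ok r1 hk cp cr cF; have [rr hh] := ok.
have gQ : F (4 * N) (Den b2 * g2 - Q) by rewrite g2E subrr.
have g2F : F N.*2 g2 by apply: (amplitude_order gQ); lia.
have g2l : F N.*2.+1 (g2 - lead) by apply: (lead_order A0_neq0 N_gt0 gQ).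
set M := (m - N.*2 + N.*2)%N.
have cg : F M (c * g2) by apply: FilM.
have M0 : (0 < M)%N by rewrite /M; lia.
have cgr : RR (c * g2) by apply: RRM.
pose Y := z * (c * g2).
have Y1 : F M.+1 Y by rewrite -add1n; apply: FilM => //; apply: F_varz.
have Y2 : F 2 Y by apply: Fil_le Y1.
have hX := D_nilop Y2; have hXr := D_raises Y1.
have DE f : D Y f = c * g2 * Eul f by rewrite D_zr ?RR_cs.
pose L f := c * g2 * (f + Eul f).
have Lr : raises M L.
  by move=> l f hf; rewrite addnC; apply: FilM => //; apply: FilD => //; apply: F_Eul.
have hL : nilop L.
  by split; [move=> f g; rewrite /L EulB; move: (Eul f) (Eul g) => x y; ring|apply: raises_le Lr].
pose Psi := exps (D Y); have hPsi : shom Psi := auto_hom (auto_exps Y2).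
have Pz f : Psi (z * f) = z * exps L f.
  by apply: exps_intertwine => // g; rewrite DE EulM Eul_z /L; ring.
have Pw f : Psi (w * f) = w * exps L f.
  by apply: exps_intertwine => // g; rewrite DE EulM Eul_w /L; ring.
have Pp f : pure f -> Psi f = f by move=> fp; apply: exps_fixed => //; apply: pure_D.
set r' := exps L r.
have r'r : RR r'.
  by apply: RR_exps => // f fr; apply: RRM => //; apply: RRD => //; apply: RR_Eul.
have ok' : sub_ok r' h by split.
exists r'; split=> //.
- have eF : F m (Eul (r - 1)) by apply: F_Eul.
  have Er : Eul r = Eul (r - 1).
    by rewrite EulB (pure_Eul (f := 1)) ?subr0 // -(rmorph1 pc); apply: pure_pc.
  have LF : F M (L r) by have := Lr _ _ (Fil0 r); rewrite add0n.
  have h2 := exps_second hL Lr LF; rewrite -/r' in h2.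
  have -> : r' - r - c * lead = (r' - r - L r) + c * g2 * ((r - 1) + Eul (r - 1))
      + c * (g2 - lead).
    by rewrite /L Er; move: (Eul (r - 1)) => x; ring.
  apply: FilD; last by apply: Fil_le (FilM cF g2l); lia.
  apply: FilD; first by apply: Fil_le h2; rewrite /M; lia.
  by apply: Fil_le (FilM cg (FilD r1 eF)); rewrite /M; lia.
- have comp f : Psi (sub_r r h f) = sub_r r' h f.
    apply: (hom_ext (hom_comp hPsi (sub_r_hom ok)) (sub_r_hom ok')) => t /=.
    have [e1 e2 e3] := sub_r_var ok; have [d1 d2 d3] := sub_r_var ok'.
    case: (slotP t) => [->|->|[i ->]]; rewrite ?e1 ?e2 ?e3 ?d1 ?d2 ?d3.
    + exact: Pz.
    + exact: Pw.
    + by apply: Pp; have [] := hh i.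
  have X2P f : Psi (g2 * Eul f) = g2 * Eul (Psi f).
    rewrite -[X in Psi X]mul1r -[RHS]mul1r -{2}(Pp 1); last first.
      by rewrite -(rmorph1 pc); apply: pure_pc.
    apply: (exps_pair (p := fun f g : A => f * (g2 * Eul g))) => //.
    + by move=> f0 u v; rewrite EulB; ring.
    + by move=> f0 u v; rewrite mulrBl.
    + move=> j l u v hu hv; apply: Fil_le (leq_pred _) _; apply: FilM => //.
      by apply: FilMl; apply: F_Eul.
    + move=> u v; rewrite !DE !EulM (pure_Eul cp).
      by move: (Eul (Eul v)) (Eul v) (Eul g2) (Eul u) => x1 x2 x3 x4; ring.
  apply: F_divz.
  have -> : z * (r' * sub_r r' h g1 - g2 * (r' + Eul r')) =
      Psi (z * (r * sub_r r h g1 - g2 * (r + Eul r))).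
    have -> : z * (r * sub_r r h g1 - g2 * (r + Eul r)) = z * r * sub_r r h g1 - g2 * Eul (z * r).
      by rewrite EulM Eul_z; ring.
    by rewrite (homB hPsi) (homM hPsi) comp X2P Pz EulM Eul_z -/r'; ring.
  by apply: (homF hPsi); rewrite -add1n; apply: FilM => //; apply: F_varz.
Qed.

(** All coefficients of the deviations at the next grade vanish by the
    homological equation, except those of Z^N in r, which the symmetry removes. *)
Lemma comparison_step m r h : (0 < m)%N -> (m + N.*2 < k)%N -> close_sub m r h ->
  exists r', close_sub m.+1 r' h.
Proof.
move=> m0 Gk hs; have hl := comparison_leading m0 Gk hs.
have [ok r1 hmu hb hk] := hs; have [rr hh] := ok.
have phi0 : (r - 1) (zz 0 par0) = 0.
  by apply: r1; rewrite -/(fg _) fg_zz msz_par0; lia.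
have phir : RR (r - 1) by apply: RRB => //; apply: RR1.
have pp i : pure (h i - var (imu i)).
  by apply: pureD; [have [] := hh i|apply: pureN; apply: pure_var].
have co j (n : par) : fg (zz j n) = (m + N.*2)%N -> [/\
      forall i : 'I_N, i = j :> nat -> (h i - var (imu i)) (zz 0 n) = 0,
      (N <= j)%N -> j != N.*2 -> (r - 1) (zz (j - N) n) = 0 &
      j = N.*2 -> (b1 - b2) (zz 0 n) = 0].
  move=> jG; have ppN i : pure (- (h i - var (imu i))) by apply: pureN.
  have bp : pure (b1 - b2) by apply: pureD => //; apply: pureN.
  have z0 : ((0 : A) (zz j n) != 0) = false by rewrite zeroE eqxx.
  have [|||_ h2 h3 h4] := leading_coefs A0_neq0 N_gt0 (k := j) (n := n) (si := 0) ppN bp phi0.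
  - by rewrite z0.
  - by rewrite z0.
  - by apply: hl; rewrite -/(fg _) jG.
  split=> // i ij; apply/eqP; rewrite -oppr_eq0; apply/eqP; exact: h2.
have hb' : F (m.+1 - N.*2) (b1 - b2).
  apply: pure_F0; first by apply: pureD => //; apply: pureN.
  move=> n kG; have [k1|k1] := ltnP (fg (zz 0 n)) (m - N.*2); first exact: hb.
  have kG' : fg (zz N.*2 n) = (m + N.*2)%N by move: kG k1; rewrite !fg_zz; lia.
  by have [_ _ h4] := co _ _ kG'; apply: h4.
have hmu' (i : 'I_N) : F (m.+1 + N.*2 - i.*2) (h i - var (imu i)).
  apply: pure_F0 => // n kG.
  have [k1|k1] := ltnP (fg (zz 0 n)) (m + N.*2 - i.*2); first exact: hmu.
  have kG' : fg (zz i n) = (m + N.*2)%N.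
    by have := ltn_ord i; move: kG k1; rewrite !fg_zz; lia.
  by have [h2 _ _] := co _ _ kG'; apply: h2.
have phiN j (n : par) : (fg (zz j n) < m.+1)%N -> j != N -> (r - 1) (zz j n) = 0.
  rewrite ltnS leq_eqVlt => /orP[/eqP jm|jm] jN; last exact: r1.
  have jG : fg (zz (j + N) n) = (m + N.*2)%N by move: jm; rewrite !fg_zz doubleD; lia.
  have [_ h3 _] := co _ _ jG; rewrite addnK in h3; apply: h3; first exact: leq_addl.
  by apply: contraNneq jN => e; apply/eqP; lia.
pose c : A := fun d => if sdeg d == 0%N then - (A0%:C%C)^-1 * (r - 1) (eadd d (zz N par0)) else 0.
have cp : pure c by move=> d /negbTE e; rewrite /c e.
have cM (s t : C) : ((s * t)^*)%C = (s^*)%C * (t^*)%C by exact: rmorphM.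
have cr : RR c.
  apply: RR_pure => // d; rewrite /c; case: ifP => _; last by rewrite rmorph0.
  rewrite cM (proj2 phir) rmorphN -fmorphV; congr (- _ * _); exact/conjC_eq.
have cF : F (m - N.*2) c.
  move=> d dm; rewrite /c; case: ifP => // _; rewrite r1 ?mulr0 //.
  by rewrite -/(fg _) fgD fg_zz msz_par0; move: dm; rewrite -/(fg d); lia.
have [r' [ok' r'F hk']] := comparison_flow m0 ok r1 hk cp cr cF.
exists r'; split=> //; have [r'r _] := ok'.
have -> : r' - 1 = (r' - r - c * lead) + ((r - 1) + c * lead) by ring.
apply: FilD => //; apply: RR_F.
  by apply: RRD => //; apply: RRM => //; apply: RRM; [apply: RR_real|apply: RR_ZX].
move=> j n jm; have -> : c * lead = pc A0%:C%C * (Z ^+ N * c) by ring.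
rewrite addE pcE ZXM_zz; case: leqP => Nj; last by rewrite mulr0 addr0 phiN // ltn_eqF.
have [jN|jN] := eqVneq j N; last first.
  rewrite phiN // pure_zz ?mulr0 ?addr0 //.
  by rewrite subn_gt0 ltn_neqAle eq_sym jN.
rewrite jN subnn /c sdeg_zz /=.
have -> : eadd (zz 0 n) (zz N par0) = zz N n.
  by apply: expo_slotP => [||i]; rewrite !(zzE, ffunE) // addn0.
by rewrite mulNr mulrN mulrA divff ?(A0C A0_neq0) // mul1r subrr.
Qed.

Lemma comparison r h : sub_ok r h -> F 1 (r - 1) -> intertwines r h ->
  forall m, (0 < m)%N -> (m + N.*2 <= k)%N -> F (m - N.*2) (b1 - b2).
Proof.
move=> ok r1 hk m m0 mk.
suff [r' []] : exists r', close_sub m r' h by [].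
elim: m m0 mk => // m IH _ mk; case: (posnP m) => [->|m0]; last first.
  have [r' hr'] := IH m0 (ltnW mk); exact: comparison_step hr'.
exists r; split=> //.
- move=> i; have [_ _ hw] := proj2 ok i.
  by apply: FilB; [apply: Fil_le hw|apply: Fil_le (F_varmu i)]; rewrite /weight; lia.
- by apply: Fil_le (Fil0 _); lia.
Qed.

End Induction.

(** An equivalence exists to every order; the comparison of coefficients then
    applies to every order of b1 - b2. *)
Lemma nf_unique A1 A2 b1 b2 : A1 != 0 -> (0 < N)%N -> pure b1 -> RR b1 -> pure b2 -> RR b2 ->
  (forall n, orb_equiv n (nfA A1 b1) (nfA A2 b2)) -> A1 = A2 /\ b1 = b2.
Proof.
move=> A1_neq0 N0 p1 r1 p2 r2 oe.
have [g1 [g1r g1E o1]] := nf_amplitude A1 N0 r1.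
have [g2 [g2r g2E o2]] := nf_amplitude A2 N0 r2.
have ord1 A0 b g : Den b * g = Qn A0 -> F 1 g.
  move=> e; have h : F N.*2 (Den b * g - Qn A0) by rewrite e subrr.
  by apply: Fil_le (amplitude_order h _); lia.
have key n : exists r h, [/\ sub_ok r h, F 1 (r - 1) & intertwines g1 g2 n r h].
  have o12 : orb_equiv n.+3 (amp g1) (amp g2).
    by apply: orb_trans (o1 n.+3).2 (orb_trans (oe _) (o2 n.+3).1).
  have [r [h [rr rF hh hr]]] := resonant_equivalence g1r g2r (ord1 _ _ _ g1E) (ord1 _ _ _ g2E) o12 isT.
  exists r, h; split=> //; apply: Fil_le hr; lia.
have e12 : A1 = A2.
  have [r [h [ok rF hk]]] := key N.*2.+1.
  exact: leading_unique g1E g2E _ _ ok rF hk _.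
split=> //; apply: F_eq => m.
have [r [h [ok rF hk]]] := key (m + 4 * N).+1.
rewrite -e12 in g2E.
have := comparison A1_neq0 N0 p1 p2 g2r g1E g2E ok rF hk (m := (m + N.*2).+1) isT.
by move=> hc; apply: Fil_le (hc _); lia.
Qed.

End Uniqueness.

(** * The parametric normal form of the Hopf singularity *)

Lemma bser_inj (R : realType) (N : nat) (B1 B2 : {ffun 'I_N -> nat} -> R) :
  bser B1 = bser B2 -> forall n, B1 n = B2 n.
Proof.
move=> e n; have := congr1 (fun f : psr R N => complex.Re (f (zz 0 n))) e.
by rewrite /bser sdeg_zz /= param_expo.
Qed.

Theorem corollary5p4 (R : realType) (N0 : nat)
    (alpha beta : exponent N0 -> R)
    (e : nat -> vmonomial N0) (vt : nat -> series R N0) :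
  (1 <= N0)%N ->
  formal_basis_order e ->
  extended_partial_levels e (hopf_system alpha beta) vt ->
  parametric_generic vt N0 ->
  has_parametric_dimension vt N0 ->
  exists (sigma : {perm 'I_N0}) (A : R) (B : {ffun 'I_N0 -> nat} -> R),
    [/\ transforms_to (hopf_system alpha beta) (hopf_normal_form sigma A B),
        infinite_level_normal_form (hopf_normal_form sigma A B) &
        forall (A' : R) (B' : {ffun 'I_N0 -> nat} -> R),
          transforms_to (hopf_system alpha beta)
                        (hopf_normal_form sigma A' B') ->
          A' = A /\ (forall n, B' n = B n)].
Proof.
move=> N_gt0 he hlev hgen hdim.
have [A [B [A_neq0 hAB]]] := normal_form_exists N_gt0 he hlev hgen hdim.
exists 1%g, A, B; rewrite hopf_nfE; split=> //; first exact: nf_infinite_level.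
move=> A' B'; rewrite hopf_nfE => hAB'.
have [v0 _] := hopf_system_like alpha beta.
have bRR (B0 : {ffun 'I_N0 -> nat} -> R) : RR (bser B0).
  by apply: RR_pure; [apply: pure_bser|apply: rl_bser].
have [||n|-> eB] // := nf_unique (A2 := A') (b2 := bser B') A_neq0 N_gt0 (pure_bser B) (bRR B).
- exact: pure_bser.
- have [_ o1] := transforms_to_orb n v0 hAB.
  by have [o2 _] := transforms_to_orb n v0 hAB'; apply: orb_trans o1 o2.
by split=> // n; rewrite (bser_inj eB).
Qed.
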